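(* Let $(X,\sigma)$ be either a $\beta$-shift $\Sigma_\beta$ for some real $\beta>1$, or an $S$-gap shift $\Sigma_S$ for some infinite set $S\subset\{0,1,2,\dots\}$. Then every subshift factor $(Y,\sigma)$ of $(X,\sigma)$ is intrinsically ergodic. Moreover, the unique measure of maximal entropy of $(Y,\sigma)$ is the (well defined) weak* limit as $n\to\infty$ of the measures $$\mu_n=\frac{1}{\#\mathrm{Per}(n)}\sum_{y\in \mathrm{Per}(n)}\delta_y,\qquad \mathrm{Per}(n)=\{y\in Y \mid \sigma^k(y)=y \text{ for some } 1\le k\le n\}.$$
   Context: Shifts and factors. $\sigma$ denotes the left shift. A shift space is a nonempty closed $\sigma$-invariant subset of $A^{\mathbb N}$ (one-sided) or $A^{\mathbb Z}$ (two-sided), with $A$ a finite alphabet. A subshift factor of $(X,\sigma)$ is a shift space $(Y,\sigma)$ (over a possibly different finite alphabet, and one- or two-sided according to $X$) for which there is a continuous surjective map $\pi:X\to Y$ with $\pi\circ\sigma=\sigma\circ\pi$. Intrinsic ergodicity. A measure of maximal entropy is a $\sigma$-invariant Borel probability measure $\mu$ with $h_\mu(\sigma)$ equal to the topological entropy of the system; a system is intrinsically ergodic if it has exactly one measure of maximal entropy. $\beta$-shifts. Let $\beta>1$ be real and $b=\lceil\beta\rceil$. Let $w(\beta)=(w_j(\beta))_{j\ge1}$ be the lexicographic supremum over all sequences of digits $(w_j)_{j\geq 1}\in\{0,\dots,b\}^{\mathbb N}$ satisfying $\sum_{j=1}^\infty w_j\beta^{-j}=1$. The $\beta$-shift is the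 one-sided shift space $\Sigma_\beta=\{x\in\{0,\dots,b\}^{\mathbb N} \mid \sigma^k(x)\preceq w(\beta)\text{ for all }k\ge0\}$, where $\preceq$ is the lexicographic order. $S$-gap shifts. For an infinite set $S\subset\{0,1,2,\dots\}$, $\Sigma_S\subset\{0,1\}^{\mathbb Z}$ is the two-sided shift space in which the number of $0$'s between consecutive $1$'s is always an element of $S$; precisely, the set of finite words appearing in sequences of $\Sigma_S$ is $\{0^n10^{n_1}10^{n_2}1\cdots10^{n_k}10^m \mid k\ge 0,\ n_i\in S \text{ for } 1\le i\le k,\ n,m\geq 0\}\cup\{0^n \mid n\ge0\}$. *)

(* Defs.v *)
(* Conventions.
   - A subsystem of a dynamical system [f : X -> X] is a subset [K] of [X] with
     [f @` K `<=` K].  Borel probability measures on [K] are represented by the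
     Borel probability measures [mu] on [X] with [mu K = 1].
   - A measure is a function on all subsets of [X], of which only the values on
     measurable sets are meaningful; equality of measures is therefore always
     stated on measurable sets. *)
From HB Require Import structures.
From mathcomp Require Import all_boot all_order all_algebra.
From mathcomp Require Import all_classical all_reals all_analysis.

Set Implicit Arguments.
Unset Strict Implicit.
Unset Printing Implicit Defensive.

Import Order.TTheory GRing.Theory Num.Theory.
Import numFieldNormedType.Exports.
Local Open Scope classical_set_scope.
Local Open Scope ring_scope.

Notation borel X := (g_sigma_algebraType (@open X)).

Section Dynamics.
Context {R : realType} {X : ptopologicalType}.
Variables (f : X -> X) (K : set X).

Definition invariant_probability (mu : probability (borel X) R) :=
  mu K = 1%E /\
  forall A : set (borel X), measurable A -> mu (f @^-1` A) = mu A.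

(* A finite measurable partition is given by its labelling
   [xi : borel X -> 'I_k]; the cells of its [n]-th refinement are indexed by the
   itineraries [w : n.-tuple 'I_k].  Note that [ln 0 = 0]. *)
Definition partition_entropy (mu : probability (borel X) R) (k : nat)
    (xi : borel X -> 'I_k) (n : nat) : R :=
  \sum_(w : n.-tuple 'I_k)
    let p := fine (mu [set x | forall i : 'I_n, xi (iter i f x) = tnth w i]) in
    - (p * ln p).

Definition measure_entropy (mu : probability (borel X) R) : \bar R :=
  ereal_sup [set h | exists (k : nat) (xi : borel X -> 'I_k),
    (forall i, measurable (xi @^-1` [set i])) /\
    h = limn (fun n => (partition_entropy mu xi n / n%:R)%:E)].

Definition join_cell (k : nat) (U : 'I_k -> set X) (n : nat)
    (w : n.-tuple 'I_k) : set X :=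
  [set x | forall i : 'I_n, U (tnth w i) (iter i f x)].

(* Smallest cardinality of a subcover of [K] extracted from the join of
   [U, f^-1 U, .., f^-(n-1) U]. *)
Definition cover_number (k : nat) (U : 'I_k -> set X) (n : nat) : nat :=
  \big[minn/#|{: n.-tuple 'I_k}|]_(F : {set n.-tuple 'I_k} |
      `[< K `<=` \bigcup_(w in [set` F]) join_cell U w >]) #|F|.

(* Topological entropy of [f] on the compact set [K], through open covers. *)
Definition topological_entropy : \bar R :=
  ereal_sup [set h | exists (k : nat) (U : 'I_k -> set X),
    [/\ forall i, open (U i), K `<=` \bigcup_i U i &
      h = limn (fun n => (ln (cover_number U n)%:R / n%:R)%:E)]].

Definition maximal_entropy_measure (mu : probability (borel X) R) :=
  invariant_probability mu /\ measure_entropy mu = topological_entropy.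

Definition intrinsically_ergodic :=
  (exists mu, maximal_entropy_measure mu) /\
  forall mu nu, maximal_entropy_measure mu -> maximal_entropy_measure nu ->
    forall A : set (borel X), measurable A -> mu A = nu A.

Definition Per (n : nat) : set X :=
  [set y | K y /\ exists k, (1 <= k <= n)%N /\ iter k f y = y].

(* This is the zero measure when [Per n] is empty or infinite; [Per n] is always
   finite if [X] is a full shift. *)
Definition periodic_measure (n : nat) : {measure set (borel X) -> \bar R} :=
  let s : seq (borel X) := finmap.enum_fset (fset_set (Per n)) in
  mscale ((size s)%:R^-1)%:nng (msum (fun i => \d_(nth point s i)) (size s)).

Definition weak_star_cvg (mus : nat -> {measure set (borel X) -> \bar R})
    (mu : probability (borel X) R) :=
  forall g : X -> R, {within K, continuous g} ->
    (\int[mus n]_(x in (K : set (borel X))) (g x)%:E @[n --> \oo] -->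
     \int[mu]_(x in (K : set (borel X))) (g x)%:E)%E.

End Dynamics.
Arguments topological_entropy R {X} f K.
Arguments intrinsically_ergodic R {X} f K.

(* Nonempty finite alphabets. *)
#[short(type="alphabetType")]
HB.structure Definition Alphabet := {A of Finite A & Pointed A}.
HB.instance Definition _ (n : nat) := isPointed.Build 'I_n.+1 ord0.
HB.instance Definition _ (n : nat) := Finite.on 'I_n.+1.
HB.instance Definition _ := Finite.on bool.

(* [fullshift nat A] is one-sided and [fullshift int A] is two-sided. *)
Definition fullshift (I : Type) (A : alphabetType) : Type :=
  {ptws I -> discrete_topology A}.
HB.instance Definition _ (I : Type) (A : alphabetType) :=
  Pointed.on (fullshift I A).
HB.instance Definition _ (I : Type) (A : alphabetType) :=
  Topological.on (fullshift I A).

Definition sigma {I : pzSemiRingType} {A : alphabetType} (x : fullshift I A) :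
  fullshift I A := fun i => x (i + 1).

(* For the factors of a shift space with [sigma @` X = X], such as those below,
   the inclusion is an equality, also in the two-sided case. *)
Definition shift_space (I : pzSemiRingType) (A : alphabetType)
    (X : set (fullshift I A)) :=
  [/\ X !=set0, closed X & sigma @` X `<=` X].

Definition subshift_factor (I : pzSemiRingType) (A B : alphabetType)
    (X : set (fullshift I A)) (Y : set (fullshift I B)) :=
  shift_space Y /\
  exists phi : fullshift I A -> fullshift I B,
    [/\ {within X, continuous phi}, phi @` X = Y &
      forall x, X x -> phi (sigma x) = sigma (phi x)].

Section BetaShift.
Variables (R : realType) (beta : R).

Definition top_digit : nat := `|Num.ceil beta|%N.

Definition digits := fullshift nat 'I_top_digit.+1.

Definition lex_le (x y : digits) :=
  x = y \/ exists n, (forall i, (i < n)%N -> x i = y i) /\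
                     (val (x n) < val (y n))%N.

(* [w i] is the digit of [beta^-(i+1)]. *)
Definition expansion_of_one : set digits :=
  [set w | series (fun i => (val (w i))%:R / beta ^+ i.+1) @ \oo --> (1 : R)].

Definition lex_sup (E : set digits) : set digits :=
  [set w | (forall v, E v -> lex_le v w) /\
           forall u, (forall v, E v -> lex_le v u) -> lex_le w u].

(* [lex_sup expansion_of_one] is a singleton if [1 < beta]. *)
Definition w_beta : digits := xget point (lex_sup expansion_of_one).

Definition beta_shift : set digits :=
  [set x | forall k, lex_le (iter k sigma x) w_beta].

End BetaShift.
Arguments beta_shift {R} beta.

(* Here [true] is the symbol 1 and [false] the symbol 0. *)
Definition gap_language (S : set nat) : set (seq bool) :=
  [set u | exists n m (s : seq nat), (forall k, k \in s -> S k) /\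
     u = nseq n false ++
         true :: flatten [seq rcons (nseq k false) true | k <- s] ++
         nseq m false] `|`
  [set u | exists n, u = nseq n false].

Definition gap_shift (S : set nat) : set (fullshift int bool) :=
  [set x | forall (i : int) (n : nat),
     gap_language S [seq (x (i + j%:Z) : bool) | j <- iota 0 n]].

(* Main.v *)
(* Both families are coded: up to a prefix and a suffix, of which there is one of
   each length, their words lie in a free submonoid [G] of words that can be
   concatenated at will and repeated periodically (Climenhaga-Thompson).  This is
   inherited by a factor [Y] through the block code of the factor map.

   Let [h > 0] be the entropy of [Y] and [lam = exp h].  As prefixes and suffixes
   carry no entropy, the numbers of words of length [n] of [Y], and of those coming
   from [G], are comparable to [lam^n].  So the periodic measures satisfy the Gibbs
   bound [mu_N [w] <= C lam^-|w|], whence every limit point [m] has entropy [h]; and,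
   for most words [u], [v] of length [n], the bound
   [c lam^-2n <= m([u] `&` sigma^-d [v])] for some bounded gap, i.e. mixing.
   Another measure [nu] of maximal entropy would, through a Hahn decomposition of
   [nu - m], give a set [Q] with [Q `<=` sigma^-1 Q] and [m Q < nu Q]; approximating
   [Q] by cylinders, of which there must be about [lam^n], contradicts mixing.

   If [h = 0], then [G] has at most one image of each length, so the factor map is
   constant on [G], and there is only one invariant measure.

   All limit points of the periodic measures being equal, these converge. *)
From HB Require Import structures.
Require Import Defs.
From mathcomp Require Import all_boot all_order all_algebra finmap.
From mathcomp Require Import all_classical all_reals all_analysis.
From mathcomp Require Import ring lra zify.

Set Implicit Arguments.
Unset Strict Implicit.
Unset Printing Implicit Defensive.

Import Order.TTheory GRing.Theory Num.Theory.
Import numFieldNormedType.Exports.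
Local Open Scope classical_set_scope.
Local Open Scope ring_scope.

(** * Full shifts *)

(** Counts are needed up to constants, not only to exponential order; this is why prefixes and
    suffixes must be unique of each length. Words of length [n] with prefix and suffix of total
    length [l] then number at most a constant times [(l + 1) lam^(n - l)], and the sum over [l]
    stays comparable to [lam^n] only if [lam > 1]: hence the separate case [h = 0]. In the factor a
    decomposition can no longer be read off from the word, but only images of cores are counted, and
    their numbers are supermultiplicative.

    A suffix may have no completion to a core, as in a beta-shift whose greedy expansion of 1 is
    finite; such words cannot recur and are null for every invariant measure. The lengths of cores
    and of completions are known up to a bounded error only, which pigeonhole arguments absorb.

    Ergodic decompositions are avoided: an arbitrary second measure is compared directly with the
    limit [m]. Limits are taken along ultrafilters, where all frequencies converge at once. One- and
    two-sided shifts are treated together by enumerating the coordinates and shifting any of them to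
    a nonnegative one. *)

Section FullShiftTopology.
Context {I : pzSemiRingType} {B : alphabetType}.
Implicit Types x y z : fullshift I B.

Lemma fullshift_compact : compact [set: fullshift I B].
Proof.
have := @tychonoff I (fun=> discrete_topology B) (fun=> setT)
  (fun i => @finite_compact (discrete_topology B) setT (@finite_finset B setT)).
by rewrite (_ : [set f | _] = setT)//; apply/seteqP; split.
Qed.

Lemma coord_clopen (i : I) (P : set B) : clopen [set x : fullshift I B | P (x i)].
Proof.
have c : continuous (fun x : fullshift I B => x i : discrete_topology B).
  exact: (@proj_continuous I (fun=> discrete_topology B) i).
split.
  exact: (open_comp (fun x _ => c x) (@discrete_open (discrete_topology B) P)).
exact: (closed_comp (fun x _ => c x) (@discrete_closed (discrete_topology B) P)).
Qed.

Lemma cvg_fullshift (F : set_system (fullshift I B)) x : Filter F ->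
  (forall i, F [set y : fullshift I B | y i = x i]) -> F --> x.
Proof.
move=> FF Fx; apply/cvg_sup => i U [V] [[W] oW <-] Wx WU.
by apply: filterS (Fx i) => y /= yi; apply: WU; rewrite /= yi.
Qed.

Lemma sigma_continuous : continuous (@sigma I B).
Proof.
move=> x.
pose F : set_system (fullshift I B) := nbhs (fmap (@sigma I B) (nbhs x)).
have FF : Filter F by exact: (@fmap_filter _ _ (@sigma I B) (nbhs x) _).
apply: (@cvg_fullshift F (sigma x) FF) => i.
have [oC _] := coord_clopen (i + 1) [set x (i + 1)].
exact: (open_nbhs_nbhs (conj oC (erefl (x (i + 1))))).
Qed.

Lemma iter_sigmaE n x i : iter n sigma x i = x (i + n%:R).
Proof.
elim: n x i => [|n IHn] x i; first by rewrite addr0.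
by rewrite iterSr IHn /sigma -addrA -[1]/(1%:R) -natrD addn1.
Qed.

Variable e : nat -> I.
Hypothesis e_surj : forall i, exists k, e k = i.

(* [e] enumerates the coordinates, so that [nat] and [int] are treated alike. *)
Definition agree n x y := forall k, (k < n)%N -> x (e k) = y (e k).

Lemma agreexx n x : agree n x x. Proof. by []. Qed.

Lemma agree_sym n x y : agree n x y -> agree n y x.
Proof. by move=> xy k kn; rewrite xy. Qed.

Lemma agree_trans n y x z : agree n x y -> agree n y z -> agree n x z.
Proof. by move=> xy yz k kn; rewrite xy// yz. Qed.

Lemma agree_le m n x y : (m <= n)%N -> agree n x y -> agree m x y.
Proof. by move=> mn xy k km; apply: xy; apply: leq_trans mn. Qed.

Lemma agree_clopen n x : clopen [set y | agree n x y].
Proof.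
elim: n => [|n IHn].
  by rewrite (_ : [set _ | _] = setT); [exact: clopenT|apply/seteqP; split].
rewrite (_ : [set _ | _] = [set y | agree n x y] `&`
    [set y : fullshift I B | [set x (e n)] (y (e n))]).
  apply: clopenI => //; exact: coord_clopen.
apply/seteqP; split=> y /=.
  move=> xy; split; last by rewrite /= xy.
  exact: agree_le xy.
move=> [xy yn] k; rewrite ltnS leq_eqVlt => /predU1P[->|/xy//].
by rewrite yn.
Qed.

Lemma agree_nbhs n x : nbhs x [set y | agree n x y].
Proof.
have [oC _] := agree_clopen n x.
by apply: open_nbhs_nbhs; split => //; exact: agreexx.
Qed.

Lemma nbhs_agree x U : nbhs x U -> exists n, [set y | agree n x y] `<=` U.
Proof.
pose F : set_system (fullshift I B) :=
  [set V | exists n, [set y | agree n x y] `<=` V].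
have FF : Filter F.
  split; first by exists 0%N.
  - move=> V W [n xV] [m xW]; exists (maxn n m) => y /= xy.
    by split; [apply: xV|apply: xW]; apply: agree_le xy;
      rewrite ?leq_maxl ?leq_maxr.
  - by move=> V W VW [n xV]; exists n => y /xV /VW.
have : F --> x.
  apply: cvg_fullshift => i; have [k <-] := e_surj i.
  by exists k.+1 => y /= ->.
by move=> Fx /Fx.
Qed.

Lemma saturated_clopen n (U : set (fullshift I B)) :
  (forall x y, agree n x y -> U x -> U y) -> clopen U.
Proof.
move=> Usat; split.
  rewrite openE => x Ux; apply: filterS (agree_nbhs n x) => y xy.
  exact: Usat xy Ux.
rewrite -[U]setCK; apply: open_closedC; rewrite openE => x Ux.
apply: filterS (agree_nbhs n x) => y xy Uy; apply: Ux.
exact: Usat (agree_sym xy) Uy.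
Qed.

Lemma open_bigcup_clopen (U : set (fullshift I B)) : open U ->
  exists C : nat -> set (fullshift I B),
    (forall n, clopen (C n)) /\ U = \bigcup_n C n.
Proof.
move=> oU; exists (fun n => [set x | [set y | agree n x y] `<=` U]); split.
  move=> n; apply: (@saturated_clopen n) => x y xy xU z yz.
  by apply: xU; apply: agree_trans yz.
apply/seteqP; split=> [x Ux|x [n _]].
  move: oU; rewrite openE => /(_ _ Ux) /nbhs_agree[n xU].
  by exists n.
by move=> /(_ x); apply; exact: agreexx.
Qed.

(** A Lebesgue number argument: compactness is used as a near covering, with the depth [n] as the
    parameter tending to infinity. Heredity of [P] makes the sets [D n] increase with [n]. *)
Lemma compact_agree_set (K : set (fullshift I B)) (P : set (set (fullshift I B))) :
  closed K -> (forall U V, U `<=` V -> P V -> P U) ->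
  (forall x, K x -> exists2 U, nbhs x U & P (K `&` U)) ->
  exists n, forall x, K x -> P (K `&` [set y | agree n x y]).
Proof.
move=> cK PS KP.
pose D n := [set x | P (K `&` [set y | agree n x y])].
have Dle m n : (m <= n)%N -> D m `<=` D n.
  move=> mn x; apply: PS => y [Ky xy]; split => //.
  exact: agree_le xy.
have kK : compact K by apply: subclosed_compact cK fullshift_compact _.
have : near_covering K by apply/compact_near_coveringP.
move=> /(_ nat \oo (fun n => D n) _) [|n _ /(_ n (leqnn n)) KD]; last by exists n.
move=> x Kx; have [U xU UP] := KP x Kx; have [n xnU] := nbhs_agree xU.
exists ([set y | agree n x y], [set m | (n <= m)%N]).
  by split; [exact: agree_nbhs|exists n].
move=> [y m] /= [xy nm]; apply: Dle nm _ _; apply: PS UP => z [Kz yz]; split => //.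
by apply: xnU; apply: agree_trans yz.
Qed.

(** A local property of pairs holds at a uniform depth. This supplies the window of a factor map,
    the modulus of continuity of a test function and the depth of a clopen set. *)
Lemma compact_agree (K : set (fullshift I B))
    (E : fullshift I B -> fullshift I B -> Prop) : closed K ->
  (forall x, K x -> exists2 U, nbhs x U &
     forall y z, K y -> K z -> U y -> U z -> E y z) ->
  exists n, forall y z, K y -> K z -> agree n y z -> E y z.
Proof.
move=> cK KE.
have [||n H] := @compact_agree_set K
    [set U | forall y z, U y -> U z -> E y z] cK.
- by move=> U V UV VE y z Uy Uz; apply: VE; exact: UV.
- move=> x Kx; have [U xU UE] := KE x Kx; exists U => // y z [Ky Uy] [Kz Uz].
  exact: UE.
- by exists n => y z Ky Kz yz; apply: (H y Ky) => //; split => //; exact: agreexx.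
Qed.

Lemma clopen_saturated (U : set (fullshift I B)) : clopen U ->
  exists n, forall x y, agree n x y -> U x -> U y.
Proof.
move=> [oU cU].
have [|n nU] := @compact_agree setT (fun x y => U x -> U y) closedT; last first.
  by exists n => x y xy; apply: nU.
move=> x _; have [Ux|nUx] := pselect (U x).
  by exists U => //; exact: open_nbhs_nbhs.
by exists (~` U) => //; apply: open_nbhs_nbhs; split => //; exact: closed_openC.
Qed.

End FullShiftTopology.

Lemma ultra_cvg01 (R : realType) (F : set_system nat) (u : nat -> R) :
  UltraFilter F -> (forall n, 0 <= u n <= 1) -> cvg (u @ F).
Proof.
move=> UF u01.
have uF : ProperFilter (u @ F) by exact: fmap_proper_filter.
have : compact `[(0 : R), 1] by exact: segment_compact.
move=> /(_ (u @ F) uF) [|p [_ pF]].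
  apply: (@filterS _ F _ setT); last exact: filterT.
  by move=> n _; rewrite /= in_itv /=; exact: u01.
apply/cvg_ex; exists p => U pU.
have [//|FnU] := in_ultra_setVsetC (u @^-1` U) UF.
have [|x [nUx Ux]] := pF (~` U) U _ pU; first exact: FnU.
by have := nUx Ux.
Qed.

(* Clopen sets form an algebra on which, by compactness, every finitely additive
   content is sigma-additive and hence extends to a Borel measure. *)
Definition clopen_space (T : Type) : Type := T.
HB.instance Definition _ (T : ptopologicalType) := Pointed.on (clopen_space T).
HB.instance Definition _ (T : ptopologicalType) :=
  @isAlgebraOfSets.Build default_measure_display (clopen_space T) (@clopen T)
    (@clopen0 T) (fun A B => @clopenU T A B) (fun A => clopenC (A:=A) set0).

Section LimitMeasure.
Context {R : realType} {I : pzSemiRingType} {B : alphabetType}.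
Variable e : nat -> I.
Hypothesis e_surj : forall i, exists k, e k = i.
Local Notation T := (fullshift I B).

Lemma borelE : <<s @open T >> = <<s @clopen T >>.
Proof.
apply/seteqP; split; apply: smallest_sub; try exact: smallest_sigma_algebra.
  move=> U /(open_bigcup_clopen e_surj)[C [cC ->]].
  apply: (@sigma_algebra_bigcup _ setT).
    by move=> n; apply: sub_sigma_algebra; exact: cC.
by move=> U [oU _]; apply: sub_sigma_algebra.
Qed.

Lemma clopen_measurable (C : set (borel T)) : clopen (C : set T) -> measurable C.
Proof. by move=> [oC _]; apply: sub_sigma_algebra. Qed.

Section Content.
Variable p : set T -> R.
Hypothesis p_ge0 : forall A, 0 <= p A.
Hypothesis pU : forall A C, A `&` C = set0 -> p (A `|` C) = p A + p C.

Let q (A : set (clopen_space T)) : \bar R := (p A)%:E.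

Let p0 : p set0 = 0.
Proof. by have := @pU set0 set0; rewrite setI0 setU0 => /(_ erefl); lra. Qed.

Let q0 : q set0 = 0%E. Proof. by rewrite /q p0. Qed.
Let q_ge0 A : (0 <= q A)%E. Proof. by rewrite lee_fin. Qed.

Let q_sigma : semi_sigma_additive q.
Proof.
move=> F cF tF cUF.
(* The union is clopen, hence compact, and the [F n] are an open cover of it; as they are disjoint,
   all but finitely many are empty. *)
have [N UFN] : exists N, forall x, (\bigcup_n F n) x -> exists2 n, (n < N)%N & F n x.
  have kU : compact (\bigcup_n F n : set T).
    by apply: subclosed_compact (proj2 cUF) (fullshift_compact) _.
  have : near_covering (\bigcup_n F n : set T) by apply/compact_near_coveringP.
  move=> /(_ nat \oo (fun N => [set x | exists2 n, (n < N)%N & F n x]) _).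
  move=> [|N _ /(_ N (leqnn N)) UFN]; last by exists N.
  move=> x [n _ Fnx]; exists (F n, [set m | (n < m)%N]).
    split => /=; first by apply: open_nbhs_nbhs; split => //; have [] := cF n.
    by exists n.+1.
  by move=> [y m] /= [Fny nm]; exists n.
have F0 n : (N <= n)%N -> F n = set0.
  move=> Nn; apply/eqP/negPn/negP => /set0P[x Fnx].
  have [m mN Fmx] := UFN x (ex_intro2 _ _ n Logic.I Fnx).
  by have := tF n m Logic.I Logic.I (ex_intro _ x (conj Fnx Fmx)); move: Nn mN; lia.
have qsum n : (\sum_(0 <= i < n) q (F i))%E = q (\bigcup_(i in `I_n) F i).
  elim: n => [|n IHn]; first by rewrite big_geq// II0 bigcup_set0 q0.
  rewrite big_nat_recr//= IHn IIS bigcup_setU bigcup_set1 /q -EFinD pU//.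
  apply/seteqP; split => // x [[i /= iin Fix] Fnx].
  by have := tF i n Logic.I Logic.I (ex_intro _ x (conj Fix Fnx)); move: iin; lia.
apply: cvg_near_cst; exists N => // n /= Nn; apply/eqP; rewrite qsum.
suff -> : \bigcup_(i in `I_n) F i = \bigcup_n F n by [].
apply/seteqP; split => [x [i _ Fix]|x /UFN[i iN Fix]]; first by exists i.
by exists i => //=; apply: leq_trans Nn.
Qed.

HB.instance Definition _ := isMeasure.Build _ _ _ q q0 q_ge0 q_sigma.

Lemma clopen_content_extension : p setT = 1 ->
  exists m : probability (borel T) R, forall C, clopen C -> m C = (p C)%:E.
Proof.
move=> pT.
pose f : set (borel T) -> \bar R := measure_extension q.
have fC C : clopen C -> f C = (p C)%:E.
  by move=> cC; rewrite /f /measure_extension measurable_mu_extE.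
have f0 : f set0 = 0%E by exact: measure0.
have f_ge0 A : (0 <= f A)%E by exact: measure_ge0.
have f_sigma : semi_sigma_additive f.
  move=> F mF tF mUF; apply: (@measure_semi_sigma_additive _ _ _ (measure_extension q)) => //.
    by move=> i; have := mF i; rewrite /measurable /= borelE.
  by move: mUF; rewrite /measurable /= borelE.
have fT : f setT = 1%E by rewrite fC ?pT//; exact: clopenT.
pose mf := isMeasure.Build _ (borel T) R f f0 f_ge0 f_sigma.
pose m : {measure set (borel T) -> \bar R} := HB.pack f mf.
have mT : m setT = 1%E by exact: fT.
pose pm := Measure_isProbability.Build _ (borel T) R m mT.
by exists (HB.pack_for (probability (borel T) R) (Measure.sort m) pm).
Qed.
End Content.

(** Along an ultrafilter the limits exist for all sets at once and are finitely additive. The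
    measure is extended from their values on clopen sets, and is known to agree with them there
    only. *)
Lemma ultralimit_probability (F : set_system nat) (k : nat -> set T -> R) :
  UltraFilter F ->
  (forall n A, 0 <= k n A <= 1) ->
  (forall n A C, A `&` C = set0 -> k n (A `|` C) = k n A + k n C) ->
  F [set n | k n setT = 1] ->
  exists m : probability (borel T) R, forall C, clopen C ->
    k n C @[n --> F] --> fine (m C).
Proof.
move=> UF k01 kU kT.
pose p A := lim (k n A @[n --> F]).
have cvgp A : k n A @[n --> F] --> p A by apply: ultra_cvg01.
have p_ge0 A : 0 <= p A.
  by apply: limr_ge; [exact: cvgp|apply: filterS filterT => n _; have /andP[] := k01 n A].
have pU A C : A `&` C = set0 -> p (A `|` C) = p A + p C.
  move=> AC; apply/cvg_lim => //.
  by under eq_fun do rewrite kU//; exact: cvgD.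
have pT : p setT = 1.
  by apply/cvg_lim => //; apply: cvg_near_cst; apply: filterS kT => n /= ->.
have [m mC] := clopen_content_extension p_ge0 pU pT.
by exists m => C cC; rewrite mC.
Qed.

End LimitMeasure.

(** * Entropy of finite-valued random variables *)

Definition pr {d} {T : measurableType d} {R : realType} (mu : probability T R)
  (A : set T) : R := fine (mu A).

Section RealProbability.
Context {d} {T : measurableType d} {R : realType} (mu : probability T R).
Implicit Types A C : set T.

Lemma prE A : measurable A -> mu A = (pr mu A)%:E.
Proof. by move=> mA; rewrite /pr fineK// fin_num_measure. Qed.

Lemma pr_ge0 A : 0 <= pr mu A. Proof. exact: fine_ge0. Qed.

Lemma pr_set0 : pr mu set0 = 0. Proof. by rewrite /pr measure0. Qed.

Lemma pr_setT : pr mu setT = 1. Proof. by rewrite /pr probability_setT. Qed.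

Lemma le_pr A C : measurable A -> measurable C -> A `<=` C -> pr mu A <= pr mu C.
Proof.
by move=> mA mC AC; rewrite -lee_fin -!prE// le_measure// inE.
Qed.

Lemma pr_le1 A : measurable A -> pr mu A <= 1.
Proof. by move=> mA; rewrite -pr_setT; apply: le_pr. Qed.

Lemma prU A C : measurable A -> measurable C -> A `&` C = set0 ->
  pr mu (A `|` C) = pr mu A + pr mu C.
Proof.
move=> mA mC AC; apply: EFin_inj; rewrite EFinD -!prE//; last exact: measurableU.
exact: measureU.
Qed.

Lemma prU_le A C : measurable A -> measurable C ->
  pr mu (A `|` C) <= pr mu A + pr mu C.
Proof.
move=> mA mC; rewrite -lee_fin EFinD -!prE//; last exact: measurableU.
exact: measureU2.
Qed.

Lemma prDI A C : measurable A -> measurable C ->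
  pr mu A = pr mu (A `\` C) + pr mu (A `&` C).
Proof.
move=> mA mC; rewrite -prU; [|exact: measurableD|exact: measurableI|].
  by rewrite setUC -[in LHS](setIT A) -(setUCr C) setIUr -setDE.
by rewrite setDE setIACA setICl setI0.
Qed.

Lemma prC A : measurable A -> pr mu (~` A) = 1 - pr mu A.
Proof.
move=> mA; have := prDI (measurableT : measurable [set: T]) mA.
by rewrite pr_setT setTD setTI => ->; rewrite addrK.
Qed.

Lemma pr_sum_seq (J : eqType) (F : J -> set T) (s : seq J) : uniq s ->
  (forall j, measurable (F j)) ->
  (forall i j x, F i x -> F j x -> i = j) ->
  measurable [set x | exists2 j, j \in s & F j x] /\
  pr mu [set x | exists2 j, j \in s & F j x] = \sum_(j <- s) pr mu (F j).
Proof.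
move=> + mF tF; elim: s => [_|j s IHs /= /andP[js us]].
  rewrite big_nil (_ : [set x | _] = set0); first by rewrite pr_set0.
  by apply/seteqP; split=> // x [].
have [m1 m2] := IHs us.
have -> : [set x | exists2 k, k \in j :: s & F k x] =
    F j `|` [set x | exists2 k, k \in s & F k x].
  apply/seteqP; split=> [x [k]|x [Fjx|[k ks Fkx]]].
  - by rewrite inE => /predU1P[->|ks] Fkx; [left|right; exists k].
  - by exists j => //; rewrite mem_head.
  - by exists k => //; rewrite inE ks orbT.
split; first exact: measurableU.
rewrite big_cons prU ?m2//.
by apply/seteqP; split=> // x [Fjx [k ks Fkx]]; move: js; rewrite (tF _ _ _ Fjx Fkx) ks.
Qed.

Lemma pr_le_sum (J : finType) (F : J -> set T) : (forall j, measurable (F j)) ->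
  measurable [set x | exists j, F j x] /\
  pr mu [set x | exists j, F j x] <= \sum_j pr mu (F j).
Proof.
move=> mF.
suff: forall s : seq J, measurable [set x | exists2 j, j \in s & F j x] /\
    pr mu [set x | exists2 j, j \in s & F j x] <= \sum_(j <- s) pr mu (F j).
  move=> /(_ (index_enum J)); rewrite (_ : [set x | _] = [set x | exists j, F j x])//.
  apply/seteqP; split=> x [j]; first by move=> _ Fjx; exists j.
  by move=> Fjx; exists j => //; rewrite mem_index_enum.
elim=> [|j s [ms IHs]].
  rewrite big_nil (_ : [set x | _] = set0); first by rewrite pr_set0.
  by apply/seteqP; split=> // x [].
have -> : [set x | exists2 k, k \in j :: s & F k x] =
    F j `|` [set x | exists2 k, k \in s & F k x].
  apply/seteqP; split=> [x [k]|x [Fjx|[k ks Fkx]]].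
  - by rewrite inE => /predU1P[->|ks] Fkx; [left|right; exists k].
  - by exists j => //; rewrite mem_head.
  - by exists k => //; rewrite inE ks orbT.
split; first exact: measurableU.
rewrite big_cons; apply: le_trans (prU_le _ _) _ => //.
by rewrite lerD2l.
Qed.

Lemma pr_sum_set (J : finType) (F : J -> set T) (D : {set J}) :
  (forall j, measurable (F j)) ->
  (forall i j x, F i x -> F j x -> i = j) ->
  measurable [set x | exists2 j, j \in D & F j x] /\
  pr mu [set x | exists2 j, j \in D & F j x] = \sum_(j in D) pr mu (F j).
Proof.
move=> mF tF; have [] := pr_sum_seq (enum_uniq D) mF tF.
rewrite big_enum /= (_ : [set x | _] = [set x | exists2 j, j \in D & F j x])//.
by apply/seteqP; split=> x [j]; rewrite ?mem_enum => Dj Fjx; exists j; rewrite ?mem_enum.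
Qed.

End RealProbability.

(** * Approximation of Borel sets by clopen sets *)

Section Approximation.
Context {R : realType} {I : pzSemiRingType} {B : alphabetType}.
Variable e : nat -> I.
Hypothesis e_surj : forall i, exists k, e k = i.
Local Notation T := (fullshift I B).

Lemma probability_clopen_ext (m1 m2 : probability (borel T) R) :
  (forall C, clopen C -> m1 C = m2 C) -> forall A, measurable A -> m1 A = m2 A.
Proof.
move=> m12 A mA.
apply: (@measure_unique _ R (borel T) (@clopen T) (fun=> setT)) => //.
- by rewrite -(borelE e_surj).
- by move=> C D cC cD; exact: clopenI.
- by move=> _; exact: clopenT.
- by rewrite bigcup_const//; exists 0%N.
- move=> _; have := ltry (1 : R); congr (_ < _)%E; apply/esym.
  exact: (probability_setT m1).
Qed.

Definition symdiff (A C : set (borel T)) : set (borel T) := (A `\` C) `|` (C `\` A).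

Lemma clopen_approx (mu : {measure set (borel T) -> \bar R}) :
  (mu setT < +oo)%E -> forall A : set (borel T), measurable A ->
  forall eps : R, 0 < eps ->
  exists2 C, clopen C & (mu (symdiff A C) < eps%:E)%E.
Proof.
move=> muoo.
pose Q (A : set (borel T)) := measurable A /\ forall eps : R, 0 < eps ->
  exists2 C, clopen C & (mu (symdiff A C) < eps%:E)%E.
have msd (A C : set (borel T)) : measurable A -> measurable C ->
    measurable (symdiff A C).
  by move=> mA mC; apply: measurableU; exact: measurableD.
have lemu (A C : set (borel T)) : measurable A -> measurable C -> A `<=` C ->
    (mu A <= mu C)%E.
  by move=> mA mC AC; rewrite le_measure// inE.
have QU A A' : Q A -> Q A' -> Q (A `|` A').
  move=> [mA QA] [mA' QA']; split; first exact: measurableU.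
  move=> eps eps0.
  have [|C cC AC] := QA (eps / 2); first by rewrite divr_gt0.
  have [|C' cC' AC'] := QA' (eps / 2); first by rewrite divr_gt0.
  exists (C `|` C'); first exact: clopenU.
  have mC := clopen_measurable cC; have mC' := clopen_measurable cC'.
  rewrite (splitr eps) EFinD; apply: le_lt_trans (lteD AC AC').
  apply: le_trans (measureU2 _ _ _); [|exact: msd|exact: msd].
  apply: lemu; [by apply: msd; exact: measurableU|
    by apply: measurableU; exact: msd|].
  move=> x; rewrite /symdiff /=; tauto.
have Qclopen C : clopen C -> Q C.
  move=> cC; split; first exact: clopen_measurable.
  move=> eps eps0; exists C => //.
  by rewrite /symdiff !setDv setU0 measure0.
suff : <<s @clopen T >> `<=` Q by rewrite -(borelE e_surj) => QA A /QA[].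
apply: smallest_sub; last exact: Qclopen.
split.
- by apply: Qclopen; exact: clopen0.
- move=> A [mA QA]; rewrite setTD; split; first exact: measurableC.
  move=> eps /QA[C cC AC]; exists (~` C); first exact: clopenC.
  rewrite (_ : symdiff _ _ = symdiff A C)//.
  by rewrite /symdiff !setDE !setCK setUC (setIC A) (setIC C).
- move=> F' QF; pose F : nat -> set (borel T) := F'.
  rewrite -/F; have mF n : measurable (F n) by have [] := QF n.
  have mUF : measurable (\bigcup_n F n) by exact: bigcupT_measurable.
  split => // eps eps0.
  pose G n := \bigcup_(i in `I_n) F i.
  have QG n : Q (G n).
    elim: n => [|n IHn]; rewrite /G.
      by rewrite II0 bigcup_set0; apply: Qclopen; exact: clopen0.
    by rewrite IIS bigcup_setU bigcup_set1; apply: QU.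
  have mG n : measurable (G n) by have [] := QG n.
  (* Continuity from above: the differences decrease to the empty set, so a finite union exhausts
     the countable one up to [eps / 2]. *)
  have [N GN] : exists N, (mu ((\bigcup_n F n) `\` G N) < (eps / 2)%:E)%E.
    apply: contrapT => /forallNP nG.
    have mD n : measurable ((\bigcup_n F n) `\` G n) by exact: measurableD.
    have D0 : \bigcap_n ((\bigcup_n F n) `\` G n) = set0.
      apply/seteqP; split => // x Dx.
      have [[n _ Fnx] _] := Dx 0%N Logic.I.
      by have [_] := Dx n.+1 Logic.I; apply; exists n => /=.
    have : mu ((\bigcup_n F n) `\` G n) @[n --> \oo] --> mu set0.
      rewrite -D0; apply: nonincreasing_cvg_mu => //.
      - by apply: le_lt_trans muoo; apply: lemu.
      - by rewrite D0.
      - move=> m n mn; apply/subsetPset => x [Ux nGx]; split => //.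
        by move=> [i /= im Fix]; apply: nGx; exists i => //=; apply: leq_trans mn.
    rewrite measure0 => c0.
    have : ((eps / 2)%:E <= lim (mu ((\bigcup_n F n) `\` G n) @[n --> \oo]))%E.
      apply: lime_ge; first by apply/cvg_ex; exists 0%E.
      by apply: nearW => n; rewrite leNgt; apply/negP; exact: nG.
    by move/cvg_lim : c0 => ->//; rewrite lee_fin leNgt divr_gt0.
  have [_ /(_ (eps / 2))[|C cC GC]] := QG N; first by rewrite divr_gt0.
  exists C => //; have mC := clopen_measurable cC.
  rewrite (splitr eps) EFinD; apply: le_lt_trans (lteD GN GC).
  apply: le_trans (measureU2 _ _ _); [|exact: measurableD|exact: msd].
  apply: lemu; [exact: msd|by apply: measurableU; [exact: measurableD|exact: msd]|].
  move=> x; rewrite /symdiff => -[[Ux nCx]|[Cx nUx]].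
    by have [Gx|] := pselect (G N x); [right; left|left].
  by right; right; split => // -[i _ Fix]; apply: nUx; exists i.
Qed.

(** Applying [clopen_approx] to the finite measure [m1 + m2] gives one clopen set that serves
    both. *)
Lemma clopen_approx2 (m1 m2 : probability (borel T) R) (A : set (borel T)) (eps : R) :
  measurable A -> 0 < eps ->
  exists2 C, clopen C & pr m1 (symdiff A C) < eps /\ pr m2 (symdiff A C) < eps.
Proof.
move=> mA eps0.
pose mu : {measure set (borel T) -> \bar R} := measure_add m1 m2.
have muE D : measurable D -> mu D = (pr m1 D + pr m2 D)%:E.
  by move=> mD; rewrite EFinD -!prE//; exact: measure_addE.
have [|C cC] := @clopen_approx mu _ A mA eps eps0.
  by rewrite muE ?ltry//; exact: measurableT.
have mC := clopen_measurable cC.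
have mD : measurable (symdiff A C) by apply: measurableU; exact: measurableD.
rewrite muE// lte_fin => H; exists C => //.
have := pr_ge0 m1 (symdiff A C); have := pr_ge0 m2 (symdiff A C).
by split; lra.
Qed.

End Approximation.

(** * The function - p ln p and Gibbs' inequality *)

Section Eta.
Context {R : realType}.
Implicit Types p q : R.

Definition eta p := - (p * ln p).

Lemma eta0 : eta 0 = 0. Proof. by rewrite /eta mul0r oppr0. Qed.

Lemma eta_ge0 p : 0 <= p <= 1 -> 0 <= eta p.
Proof.
move=> /andP[p0 p1]; rewrite /eta -mulrN mulr_ge0// oppr_ge0.
exact: ln_le0.
Qed.

Lemma ln_le_sub1 p : 0 < p -> ln p <= p - 1.
Proof.
move=> p0; have := @le_ln1Dx R (p - 1).
by rewrite (_ : 1 + (p - 1) = p); [apply; lra|lra].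
Qed.

(** The tangent inequality [ln t <= t - 1] at [t = q / p], multiplied by [p]. Summed over two
    distributions of equal mass it is Gibbs' inequality, as the terms [q - p] cancel. The
    implication [q = 0 -> p = 0] is forced by the convention [ln 0 = 0]. *)
Lemma eta_le_gibbs p q : 0 <= p -> 0 <= q -> (q = 0 -> p = 0) ->
  eta p <= - (p * ln q) + (q - p).
Proof.
rewrite le_eqVlt => /predU1P[<-|p0] q0 qp.
  by rewrite eta0 mul0r subr0 oppr0 add0r.
have {}q0 : 0 < q by rewrite lt_neqAle q0 andbT; apply/eqP => /esym /qp; lra.
have /(ler_wpM2l (ltW p0)) : ln (q / p) <= q / p - 1.
  by apply: ln_le_sub1; rewrite divr_gt0.
rewrite ln_div ?posrE// !mulrBr mulr1 mulrCA divff ?gt_eqF// mulr1.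
by rewrite /eta; lra.
Qed.

Lemma eta_le1B p : 0 <= p -> eta p <= 1 - p.
Proof.
move=> p0; have := @eta_le_gibbs p 1 p0 ler01; rewrite ln1 mulr0 oppr0 add0r.
by apply => /eqP; rewrite oner_eq0.
Qed.

(** The tangent inequality at [1 / sqrt p]. It quantifies the continuity of [eta] at [0]: an event
    of measure at most [s ^ 2] contributes at most [2 * s]. *)
Lemma eta_sqrt p : 0 <= p -> eta p <= 2 * Num.sqrt p.
Proof.
rewrite le_eqVlt => /predU1P[<-|p0]; first by rewrite eta0 sqrtr0 mulr0.
have s0 : 0 < Num.sqrt p by rewrite sqrtr_gt0.
have := ln_le_sub1 (_ : 0 < (Num.sqrt p)^-1); rewrite invr_gt0 => /(_ s0).
rewrite lnV ?posrE// => H.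
have pE : p = Num.sqrt p * Num.sqrt p by rewrite -expr2 sqr_sqrtr// ltW.
have -> : eta p = p * (- ln (Num.sqrt p)) * 2.
  by rewrite /eta [in ln p]pE lnM ?posrE//; lra.
have : p * (- ln (Num.sqrt p)) <= p * (Num.sqrt p)^-1.
  by rewrite ler_wpM2l// ?ltW//; lra.
have -> : p * (Num.sqrt p)^-1 = Num.sqrt p.
  by apply: (mulIf (lt0r_neq0 s0)); rewrite divfK ?gt_eqF.
lra.
Qed.

Lemma eta_sum (J : finType) (P : pred J) (p : J -> R) : (forall j, 0 <= p j) ->
  eta (\sum_(j | P j) p j) <= \sum_(j | P j) eta (p j).
Proof.
move=> p0; rewrite /eta mulr_suml -sumrN; apply: ler_sum => j Pj.
have := p0 j; rewrite le_eqVlt => /predU1P[<-|pj]; first by rewrite !mul0r.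
rewrite lerN2 ler_wpM2l//.
have le : p j <= \sum_(j | P j) p j.
  by rewrite (bigD1 j)//= lerDl sumr_ge0.
by rewrite ler_ln ?posrE//; apply: lt_le_trans le.
Qed.

(** Gibbs' inequality against the uniform distribution on [D] of the same mass [a]. For [a = 1] the
    last term vanishes and the logarithm of the number of values is left; smaller [a] serves to
    split an entropy over [D] and its complement. *)
Lemma sum_eta_le (J : finType) (D : {set J}) (p : J -> R) :
  (forall j, 0 <= p j) ->
  \sum_(j in D) eta (p j) <=
  (\sum_(j in D) p j) * ln #|D|%:R + eta (\sum_(j in D) p j).
Proof.
move=> p0; set a := \sum_(j in D) p j.
have a0 : 0 <= a by exact: sumr_ge0.
have [D0|D0] := posnP #|D|.
  have D00 : D = finset.set0 by apply/eqP; rewrite -cards_eq0 D0.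
  by rewrite /a D00 !big_set0 mul0r eta0 addr0.
have cD : (0 : R) < #|D|%:R by rewrite ltr0n.
apply: (@le_trans _ _ (\sum_(j in D) (- (p j * ln (a / #|D|%:R)) + (a / #|D|%:R - p j)))).
  apply: ler_sum => j jD; apply: eta_le_gibbs => //.
    by rewrite divr_ge0// ltW.
  move/eqP; rewrite mulf_eq0 invr_eq0 (gt_eqF cD) orbF => /eqP a00.
  apply/eqP; rewrite eq_le p0 andbT -a00 /a (bigD1 j)//= lerDl.
  by apply: sumr_ge0.
rewrite big_split/= sumrN -mulr_suml -/a.
have -> : \sum_(j in D) (a / #|D|%:R - p j) = 0.
  by rewrite sumrB sumr_const -/a -[X in X - _]mulr_natr divfK ?subrr ?gt_eqF.
rewrite addr0.
have [a00|an0] := eqVneq a 0; first by rewrite a00 !mul0r eta0 oppr0 addr0.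
have {}a0 : 0 < a by rewrite lt_neqAle eq_sym an0.
by rewrite ln_div ?posrE// /eta mulrBr opprB addrC addrC.
Qed.

End Eta.

Section Entropy.
Context {d} {T : measurableType d} {R : realType} (mu : probability T R).

Definition mrv (V : finType) (X : T -> V) :=
  forall v, measurable (X @^-1` [set v]).

Definition entropy (V : finType) (X : T -> V) : R :=
  \sum_v eta (pr mu (X @^-1` [set v])).

Lemma mrv_preimage (V : finType) (X : T -> V) (D : {set V}) : mrv X ->
  measurable [set x | X x \in D] /\
  pr mu [set x | X x \in D] = \sum_(v in D) pr mu (X @^-1` [set v]).
Proof.
move=> mX; have [] := pr_sum_set mu D mX.
  by move=> i j x <-.
rewrite (_ : [set x | exists2 j, j \in D & _] = [set x | X x \in D])//.
by apply/seteqP; split=> x /=; [move=> [j jD ->]|move=> XD; exists (X x)].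
Qed.

Lemma mrv_sum1 (V : finType) (X : T -> V) : mrv X ->
  \sum_v pr mu (X @^-1` [set v]) = 1.
Proof.
move=> mX; have [_] := mrv_preimage [set: V]%SET mX.
under [in RHS]eq_bigl do rewrite inE.
rewrite (_ : [set x | _] = setT) ?pr_setT//.
by apply/seteqP; split=> x //= _; rewrite inE.
Qed.

Lemma comp_preimage (V W : finType) (X : T -> V) (g : V -> W) w :
  (g \o X) @^-1` [set w] = [set x | X x \in [set v | g v == w]%SET].
Proof.
by apply/seteqP; split=> x /=; rewrite inE => /eqP.
Qed.

Lemma mrv_comp (V W : finType) (X : T -> V) (g : V -> W) : mrv X -> mrv (g \o X).
Proof.
by move=> mX w; rewrite comp_preimage; have [] := mrv_preimage [set v | g v == w]%SET mX.
Qed.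

Lemma pr_comp (V W : finType) (X : T -> V) (g : V -> W) w : mrv X ->
  pr mu ((g \o X) @^-1` [set w]) = \sum_(v | g v == w) pr mu (X @^-1` [set v]).
Proof.
move=> mX; rewrite comp_preimage; have [_ ->] := mrv_preimage [set v | g v == w]%SET mX.
by apply: eq_bigl => v; rewrite inE.
Qed.

Lemma entropy_comp (V W : finType) (X : T -> V) (g : V -> W) : mrv X ->
  entropy (g \o X) <= entropy X.
Proof.
move=> mX; rewrite /entropy (partition_big g xpredT)//=.
apply: ler_sum => w _; rewrite pr_comp//.
by apply: eta_sum => v; exact: pr_ge0.
Qed.

Lemma mrv_pair (V W : finType) (X : T -> V) (Y : T -> W) : mrv X -> mrv Y ->
  mrv (fun x => (X x, Y x)).
Proof.
move=> mX mY [v w]; have := measurableI _ _ (mX v) (mY w).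
congr measurable; apply/seteqP; split=> x /=; first by move=> [-> ->].
by case.
Qed.

(** Gibbs' inequality against the product of the two marginals; subadditivity is thus obtained
    without conditional entropies. *)
Lemma entropy_pair (V W : finType) (X : T -> V) (Y : T -> W) : mrv X -> mrv Y ->
  entropy (fun x => (X x, Y x)) <= entropy X + entropy Y.
Proof.
move=> mX mY; set Z := fun x => _; have mZ : mrv Z by exact: mrv_pair.
set p := fun v => pr mu (X @^-1` [set v]); set q := fun w => pr mu (Y @^-1` [set w]).
set r := fun v => pr mu (Z @^-1` [set v]).
have pE v : p v = \sum_w r (v, w).
  rewrite /p (_ : X = fst \o Z)// pr_comp//.
  transitivity (\sum_(a | a == v) \sum_b r (a, b)); last by rewrite big_pred1_eq.
  by rewrite pair_big/=; apply: eq_big => [[a b]|[a b]]//=; rewrite andbT.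
have qE w : q w = \sum_v r (v, w).
  rewrite /q (_ : Y = snd \o Z)// pr_comp//.
  transitivity (\sum_v \sum_(w' | w' == w) r (v, w')).
    by rewrite pair_big/=; apply: eq_big => [[a b]|[a b]].
  by apply: eq_bigr => v _; rewrite big_pred1_eq.
have r0 z : 0 <= r z by exact: pr_ge0.
have p0 z : 0 <= p z by exact: pr_ge0.
have q0 z : 0 <= q z by exact: pr_ge0.
have rp v w : r (v, w) <= p v by rewrite pE (bigD1 w)//= lerDl sumr_ge0.
have rq v w : r (v, w) <= q w by rewrite qE (bigD1 v)//= lerDl sumr_ge0.
have key v w : eta (r (v, w)) <=
    - (r (v, w) * ln (p v)) - r (v, w) * ln (q w) + (p v * q w - r (v, w)).
  have [r00|rn0] := eqVneq (r (v, w)) 0.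
    by rewrite r00 eta0 !mul0r oppr0 !add0r addr0 mulr_ge0.
  have rpos : 0 < r (v, w) by rewrite lt_neqAle eq_sym rn0 r0.
  have ppos : 0 < p v by apply: lt_le_trans (rp v w).
  have qpos : 0 < q w by apply: lt_le_trans (rq v w).
  have := @eta_le_gibbs R (r (v, w)) (p v * q w) (r0 _) (mulr_ge0 (p0 _) (q0 _)).
  rewrite lnM ?posrE// mulrDr opprD; apply => /eqP.
  by rewrite mulf_eq0 !gt_eqF.
rewrite /entropy.
apply: (@le_trans _ _ (\sum_v \sum_w (- (r (v, w) * ln (p v)) - r (v, w) * ln (q w)
    + (p v * q w - r (v, w))))).
  by rewrite pair_big/=; apply: ler_sum => -[v w] _ /=; exact: key.
have E1 : \sum_v \sum_w - (r (v, w) * ln (p v)) = \sum_v eta (p v).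
  by apply: eq_bigr => v _; rewrite sumrN -mulr_suml -pE.
have E2 : \sum_v \sum_w - (r (v, w) * ln (q w)) = \sum_w eta (q w).
  rewrite exchange_big; apply: eq_bigr => w _.
  by rewrite sumrN -mulr_suml -qE.
have E3 : \sum_v \sum_w (p v * q w) = 1.
  have := mrv_sum1 mX; have := mrv_sum1 mY => Y1 X1.
  by under eq_bigr do rewrite -mulr_sumr Y1 mulr1.
have E4 : \sum_v \sum_w r (v, w) = 1.
  by rewrite pair_big/= -(mrv_sum1 mZ); apply: eq_bigr => -[].
under eq_bigr => v _.
  rewrite big_split/= big_split/= [X in _ + X]sumrB.
  over.
by rewrite big_split/= big_split/= [X in _ + X]sumrB E1 E2 E3 E4 subrr addr0.
Qed.

Lemma entropy_ge0 (V : finType) (X : T -> V) : mrv X -> 0 <= entropy X.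
Proof.
by move=> mX; apply: sumr_ge0 => v _; apply: eta_ge0; rewrite pr_ge0 pr_le1.
Qed.

Section Itineraries.
Variable f : T -> T.
Hypothesis mf : forall A, measurable A -> measurable (f @^-1` A).
Hypothesis muf : forall A, measurable A -> mu (f @^-1` A) = mu A.

Definition itinerary (V : Type) (X : T -> V) n x : n.-tuple V :=
  [tuple X (iter i f x) | i < n].

Lemma measurable_iter n A : measurable A -> measurable (iter n f @^-1` A).
Proof.
elim: n A => [//|n IHn] A mA.
rewrite (_ : _ @^-1` A = iter n f @^-1` (f @^-1` A))//.
exact/IHn/mf.
Qed.

Lemma pr_iter n A : measurable A -> pr mu (iter n f @^-1` A) = pr mu A.
Proof.
elim: n A => [//|n IHn] A mA.
rewrite (_ : _ @^-1` A = iter n f @^-1` (f @^-1` A))// IHn; last exact: mf.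
by rewrite /pr muf.
Qed.

Lemma mrv_iter (V : finType) (X : T -> V) n : mrv X -> mrv (X \o iter n f).
Proof. by move=> mX v; exact: (measurable_iter n (mX v)). Qed.

Lemma entropy_iter (V : finType) (X : T -> V) n : mrv X ->
  entropy (X \o iter n f) = entropy X.
Proof.
move=> mX; apply: eq_bigr => v _; rewrite -(pr_iter n (mX v)).
by [].
Qed.

Definition cat_pair (V : Type) m n (z : m.-tuple V * n.-tuple V) : (m + n).-tuple V :=
  cat_tuple z.1 z.2.

Lemma itineraryD (V : Type) (X : T -> V) m n x :
  itinerary X (m + n) x = cat_pair (itinerary X m x, itinerary X n (iter m f x)).
Proof.
apply: eq_from_tnth => i; rewrite /cat_pair /= tnth_mktuple.
case: (fintype.split_ordP i) => j -> /=.
  by rewrite tnth_lshift tnth_mktuple.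
by rewrite tnth_rshift tnth_mktuple addnC iterD.
Qed.

Lemma mrv_itinerary (V : finType) (X : T -> V) n : mrv X -> mrv (itinerary X n).
Proof.
move=> mX; elim: n => [|n IHn] v.
  rewrite (_ : _ @^-1` _ = setT)//; apply/seteqP; split => // x _ /=.
  by rewrite (tuple0 v); apply: tuple0.
rewrite -addn1 in v *.
have -> : itinerary X (n + 1) =
    @cat_pair V n 1 \o (fun x => (itinerary X n x, itinerary X 1 (iter n f x))).
  by apply/funext => x; exact: itineraryD.
apply: mrv_comp; apply: mrv_pair => // w.
have := measurable_iter n (mX (tnth w ord0)).
congr measurable; apply/seteqP; split => x /=.
  move=> Xw; apply: eq_from_tnth => i; rewrite ord1 tnth_mktuple /=.
  exact: Xw.
by move=> <-; rewrite tnth_mktuple.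
Qed.

Lemma entropy_itineraryD (V : finType) (X : T -> V) m n : mrv X ->
  entropy (itinerary X (m + n)) <= entropy (itinerary X m) + entropy (itinerary X n).
Proof.
move=> mX; have mI k := mrv_itinerary (n := k) mX.
have -> : itinerary X (m + n) = @cat_pair V m n \o
    (fun x => (itinerary X m x, (itinerary X n \o iter m f) x)).
  by apply/funext => x; exact: itineraryD.
have mIm : mrv (itinerary X n \o iter m f) by exact: mrv_iter.
apply: le_trans (entropy_comp _ (mrv_pair (mI m) mIm)) _.
by rewrite -(entropy_iter m (mI n)); exact: entropy_pair.
Qed.

Lemma entropy_itinerary0 (V : finType) (X : T -> V) : entropy (itinerary X 0) = 0.
Proof.
rewrite /entropy (big_pred1 [tuple]) => [|t]; last by apply/esym/eqP; exact: tuple0.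
rewrite (_ : _ @^-1` _ = setT) ?pr_setT ?/eta ?ln1 ?mulr0 ?oppr0//.
by apply/seteqP; split => // x _ /=; exact: tuple0.
Qed.

Lemma entropy_itineraryM (V : finType) (X : T -> V) n k : mrv X ->
  entropy (itinerary X (k * n)) <= k%:R * entropy (itinerary X n).
Proof.
move=> mX; elim: k => [|k IHk]; first by rewrite mul0n mul0r entropy_itinerary0.
rewrite mulSn -natr1 mulrDl mul1r addrC.
apply: le_trans (entropy_itineraryD _ _ mX) _.
by rewrite lerD2l.
Qed.

Lemma entropy_itinerary1 (V : finType) (X : T -> V) : mrv X ->
  entropy (itinerary X 1) <= entropy X.
Proof.
move=> mX; have -> : itinerary X 1 = (fun v => [tuple v]) \o X.
  by apply/funext => x; apply: eq_from_tnth => i; rewrite ord1 tnth_mktuple.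
exact: entropy_comp.
Qed.

(** A substitute for conditional entropy: [E] records what [Z] does not determine about [X], and
    costs at most [entropy E] per step. *)
Lemma entropy_itinerary_factor (V W U : finType) (X : T -> V) (Z : T -> W)
    (E : T -> U) (g : W -> U -> V) n : mrv Z -> mrv E ->
  (forall x, X x = g (Z x) (E x)) ->
  entropy (itinerary X n) <= entropy (itinerary Z n) + n%:R * entropy E.
Proof.
move=> mZ mE XE.
have mI := mrv_itinerary (n := n) mZ; have mJ := mrv_itinerary (n := n) mE.
pose h (z : n.-tuple W * n.-tuple U) : n.-tuple V :=
  [tuple g (tnth z.1 i) (tnth z.2 i) | i < n].
have -> : itinerary X n = h \o (fun x => (itinerary Z n x, itinerary E n x)).
  by apply/funext => x; apply: eq_from_tnth => i /=; rewrite !tnth_mktuple.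
apply: le_trans (entropy_comp _ (mrv_pair mI mJ)) _.
apply: le_trans (entropy_pair mI mJ) _.
rewrite lerD2l; have := @entropy_itineraryM _ E 1 n mE; rewrite muln1.
by move/le_trans; apply; rewrite ler_wpM2l//; exact: entropy_itinerary1.
Qed.

End Itineraries.
End Entropy.

(** * Words as a generator *)

Section Generator.
Context {R : realType} {I : pzSemiRingType} {B : alphabetType}.
Variable e : nat -> I.
Hypothesis e_surj : forall i, exists k, e k = i.
Hypothesis forward : forall i : I, exists N j : nat, i + N%:R = j%:R.
Local Notation T := (fullshift I B).
Local Notation itin := (@itinerary _ (borel T) (@sigma I B) _).

Lemma sigma_measurable (A : set (borel T)) : measurable A ->
  measurable ((@sigma I B) @^-1` A : set (borel T)).
Proof.
move: A; suff : <<s @open T >> `<=`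
    [set A | measurable ((@sigma I B) @^-1` A : set (borel T))] by [].
apply: smallest_sub.
  split=> [|A|F] /=.
  - by rewrite preimage_set0; exact: measurable0.
  - by rewrite setTD preimage_setC; exact: measurableC.
  - by move=> mF; rewrite preimage_bigcup; exact: bigcupT_measurable.
move=> U oU; apply: sub_sigma_algebra.
by apply: open_comp => // x _; exact: sigma_continuous.
Qed.

Definition coord0 (x : borel T) : B := (x : T) 0.

Definition word n (x : T) : n.-tuple B := [tuple x i%:R | i < n].

Lemma itinerary_coord0 n : itin coord0 n = word n.
Proof.
apply/funext => x; apply: eq_from_tnth => i; rewrite !tnth_mktuple.
by rewrite /coord0 iter_sigmaE add0r.
Qed.

Lemma agree_word n : exists m, forall x y : T, agree e m x y -> word n x = word n y.
Proof.
have [k kE] := choice (fun i : nat => e_surj i%:R).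
exists (\sum_(i < n) (k i).+1)%N => x y xy.
apply: eq_from_tnth => i; rewrite !tnth_mktuple -kE; apply: xy.
by rewrite (bigD1 i)//= addSn ltnS leq_addr.
Qed.

Lemma word_clopen n (P : set (n.-tuple B)) : clopen [set x | P (word n x)].
Proof.
have [m H] := agree_word n.
by apply: (@saturated_clopen _ _ e m) => x y /H /= ->.
Qed.

(* Only nonnegative coordinates enter [word]; [forward] says that any coordinate
   is brought there by shifting. *)
Lemma word_agree m : exists N n, forall x y : T, word n x = word n y ->
  agree e m (iter N sigma x) (iter N sigma y).
Proof.
have [N Nj] := choice (fun k : nat => forward (e k)).
have [j jE] := choice Nj.
exists (\sum_(k < m) N k)%N, (\sum_(k < m) (j k + \sum_(k < m) N k).+1)%N.
move=> x y xy k km; rewrite !iter_sigmaE.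
pose k' := Ordinal km.
have NE : (\sum_(k < m) N k = N k + (\sum_(k < m) N k - N k))%N.
  by rewrite subnKC// (bigD1 k')//= leq_addr.
rewrite NE natrD addrA jE -natrD.
have lt : (j k + (\sum_(k < m) N k - N k) < \sum_(k < m) (j k + \sum_(k < m) N k).+1)%N.
  by rewrite [ltnRHS](bigD1 k')//= addSn ltnS; apply: leq_trans (leq_addr _ _);
    rewrite leq_add2l leq_subr.
by have := congr1 (fun t => tnth t (Ordinal lt)) xy; rewrite !tnth_mktuple.
Qed.

Lemma mrv_coord0 : mrv coord0.
Proof. by move=> b; apply: (clopen_measurable); exact: (coord_clopen 0 [set b]). Qed.

(** The shift by [N] is harmless for invariant measures. The length is written [n.+1] because
    [gibbs_lower] needs nonempty words. *)
Lemma clopen_word (C : set T) : clopen C -> exists N n (D : {set n.+1.-tuple B}),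
  forall x, C (iter N sigma x) <-> word n.+1 x \in D.
Proof.
move=> /(clopen_saturated e_surj)[m mC]; have [N [n Nn]] := word_agree m.
exists N, n, [set w | `[< exists2 x, word n.+1 x = w & C (iter N sigma x)>]]%SET.
move=> x; rewrite inE; split=> [Cx|/asboolP[y yx]]; first by apply/asboolP; exists x.
apply/mC/Nn/eq_from_tnth => i.
by have := congr1 (fun t => tnth t (widen_ord (leqnSn n) i)) yx; rewrite !tnth_mktuple.
Qed.

Variable mu : probability (borel T) R.
Hypothesis mu_inv : forall A : set (borel T), measurable A ->
  mu ((@sigma I B) @^-1` A) = mu A.

(* The cells of [xi] are approximated by clopen sets, so that [xi], after a shift,
   is recovered from a word [Z] and a correction [E] that is almost always [None]
   and thus has small entropy. *)
Lemma entropy_generator k (xi : borel T -> 'I_k) (eps : R) : mrv xi -> 0 < eps ->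
  exists K, forall n, entropy mu (itin xi n) <=
    entropy mu (word (n + K) : borel T -> _) + n%:R * eps.
Proof.
move=> mxi eps0.
(* [E] will be [None] with probability at least [1 - s ^ 2], which contributes at most [s ^ 2 <= s],
   and each of its [k] other values contributes at most [2 * s]. *)
pose s := Num.min 1 (eps / (1 + 2 * k%:R)).
have s0 : 0 < s by rewrite lt_min ltr01 divr_gt0// ltr_wpDr// mulr_ge0.
have s1 : s <= 1 by rewrite ge_min lexx.
have seps : s * (1 + 2 * k%:R) <= eps.
  rewrite -ler_pdivlMr; last by rewrite ltr_wpDr// mulr_ge0.
  by rewrite ge_min lexx orbT.
have dlt0 : 0 < s ^+ 2 / k.+1%:R by rewrite divr_gt0// exprn_gt0.
have Cv v : exists C : set T, clopen C /\
    pr mu (symdiff (xi @^-1` [set v]) C) < s ^+ 2 / k.+1%:R.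
  by have [C cC [H _]] := clopen_approx2 e_surj mu mu (mxi v) dlt0; exists C.
have [C CP] := choice Cv.
have Cm v : exists m, forall x y, agree e m x y -> C v x -> C v y.
  by apply: (clopen_saturated e_surj); have [] := CP v.
have [m mP] := choice Cm.
pose M := (\sum_v m v)%N.
have [N [K NK]] := word_agree M.
pose Z : borel T -> K.-tuple B := word K.
pose xi1 : borel T -> 'I_k := xi \o iter N sigma.
(* After the shift by [N], membership in [C v] depends on the word only, so any witness decides. The
   sets [C v] may overlap or leave points uncovered, but a wrong guess occurs only at points that
   the shift sends into one of the symmetric differences. *)
pose g0 (w : K.-tuple B) : 'I_k := odflt (xi point)
  [pick v | `[< exists2 x, word K x = w & C v (iter N sigma x) >]].
pose E x : option 'I_k := if xi1 x == g0 (Z x) then None else Some (xi1 x).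
pose g w (o : option 'I_k) := odflt (g0 w) o.
have mS A := @sigma_measurable A.
have mZ : mrv Z by move=> w; apply: clopen_measurable; exact: (word_clopen [set w]).
have mxi1 : mrv xi1 by exact: (mrv_iter mS N mxi).
have mE : mrv E.
  have := mrv_comp mu (fun z : 'I_k * K.-tuple B =>
    if z.1 == g0 z.2 then None else Some z.1) (mrv_pair mxi1 mZ).
  by [].
have XE x : xi1 x = g (Z x) (E x).
  by rewrite /E; case: eqP.
have mD v : measurable (symdiff (xi @^-1` [set v]) (C v)).
  have mC : measurable (C v : set (borel T)) by apply: clopen_measurable; have [] := CP v.
  by apply: measurableU; exact: measurableD.
pose bad : set (borel T) := [set x | exists v, symdiff (xi @^-1` [set v]) (C v) x].
have [mbad bad_sum] := pr_le_sum mu mD; rewrite -/bad in mbad bad_sum.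
exists K => n.
have -> : entropy mu (itin xi n) = entropy mu (itin xi1 n).
  rewrite -(entropy_iter mS mu_inv N (mrv_itinerary mu mS mxi (n := n))).
  congr entropy; apply/funext => x; apply: eq_from_tnth => i /=.
  by rewrite !tnth_mktuple /xi1 /= -!iterD addnC.
apply: le_trans (entropy_itinerary_factor mS mu_inv n mZ mE XE) _.
apply: lerD.
  pose h (t : (n + K).-tuple B) : n.-tuple (K.-tuple B) :=
    [tuple [tuple nth point t (i + j) | j < K] | i < n].
  have -> : itin Z n = h \o word (n + K).
    apply/funext => x; apply: eq_from_tnth => i; rewrite !tnth_mktuple.
    apply: eq_from_tnth => j; rewrite !tnth_mktuple.
    have lt : (i + j < n + K)%N by have := ltn_ord i; have := ltn_ord j; lia.
    by rewrite (nth_map (Ordinal lt)) ?size_enum_ord// nth_enum_ord//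
      iter_sigmaE natrD addrC.
  by apply: entropy_comp => w; apply: clopen_measurable; exact: (word_clopen [set w]).
apply: ler_wpM2l => //.
have badE x : E x != None -> bad (iter N sigma x).
  rewrite /E; case: (xi1 x =P g0 (Z x)) => // ne _.
  have [Cx|nCx] := pselect (C (xi1 x) (iter N sigma x)); last first.
    by exists (xi1 x); left.
  move: ne; rewrite /g0; case: pickP => [v /asboolP[y yx Cvy]|none] /= ne.
    exists v; right; split; last exact: ne.
    apply: (mP v (iter N sigma y)) Cvy; apply: agree_le (NK _ _ yx).
    by rewrite /M (bigD1 v)//= leq_addr.
  by have /asboolPn[] := negbT (none (xi1 x)); exists x.
have prbad : pr mu bad <= s ^+ 2.
  apply: le_trans bad_sum _.
  apply: (@le_trans _ _ (\sum_(v < k) s ^+ 2 / k.+1%:R)).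
    by apply: ler_sum => v _; apply/ltW; have [] := CP v.
  rewrite sumr_const card_ord -[_ *+ k]mulr_natr -mulrA ler_piMr ?sqr_ge0//.
  by rewrite mulrC ler_pdivrMr ?ltr0n// mul1r ler_nat.
have prE1 v : pr mu (E @^-1` [set Some v]) <= s ^+ 2.
  apply: le_trans prbad; rewrite -(pr_iter mS mu_inv N mbad).
  apply: (le_pr mu (mE (Some v)) (measurable_iter mS N mbad)).
  by move=> x /= Ex; apply: badE; rewrite Ex.
have prE0 : 1 - s ^+ 2 <= pr mu (E @^-1` [set None]).
  rewrite lerBlDr -lerBlDl; have := prC mu (mE None) => <-.
  apply: le_trans prbad; rewrite -(pr_iter mS mu_inv N mbad).
  apply: (le_pr mu (measurableC (mE None)) (measurable_iter mS N mbad)).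
  by move=> x /= Ex; apply: badE; apply/eqP.
have ets v : eta (pr mu (E @^-1` [set Some v])) <= 2 * s.
  apply: le_trans (eta_sqrt (pr_ge0 mu _)) _.
  rewrite ler_pM2l ?ltr0n// -[leRHS](ger0_norm (ltW s0)) -sqrtr_sqr.
  exact: ler_wsqrtr.
have -> : entropy mu E = eta (pr mu (E @^-1` [set None])) +
    \sum_v eta (pr mu (E @^-1` [set Some v])).
  rewrite /entropy (bigD1 None)//=; congr (_ + _).
  rewrite (reindex_omap Some id) /=; last by case.
  by apply: eq_bigl => v; rewrite !eqxx.
apply: (@le_trans _ _ (s ^+ 2 + \sum_(v < k) 2 * s)).
  apply: lerD; last by apply: ler_sum => v _.
  by apply: le_trans (eta_le1B (pr_ge0 mu _)) _; lra.
apply: le_trans seps.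
rewrite sumr_const card_ord -[_ *+ k]mulr_natr mulrDr mulr1.
by apply: lerD; [rewrite expr2 ler_piMl// ltW|rewrite mulrA (mulrC s)].
Qed.
End Generator.

(** * Measure entropy and topological entropy of a subshift *)

Section Rates.
Context {R : realType}.

Lemma eventually_nat_ge (x : R) : exists N, forall n, (N <= n)%N -> x <= n%:R.
Proof.
exists (Num.truncn x).+1 => n Nn.
by apply: (le_trans (ltW (truncnS_gt x))); rewrite ler_nat.
Qed.

(** [h] is the infimum of [a n / n], so the lower bound holds for every [n] without error; for the
    language this gives [lam ^+ n <= #|lang Y n|]. The upper bound comes from dividing [n] by a
    fixed [m.+1], the remainders being absorbed in a constant. *)
Lemma fekete (a : nat -> R) : (forall n, 0 <= a n) ->
  (forall m n, a (m + n)%N <= a m + a n) ->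
  exists h, [/\ 0 <= h, forall n, n%:R * h <= a n &
    forall eps, 0 < eps -> exists N, forall n, (N <= n)%N -> a n <= n%:R * (h + eps)].
Proof.
move=> a0 aD; pose S : set R := [set a n.+1 / n.+1%:R | n in [set: nat]].
have lbS : lbound S 0 by move=> _ [n _ <-]; rewrite divr_ge0.
have infS : has_inf S by split; [exists (a 1%N / 1); exists 0%N|exists 0].
have inf0 : 0 <= inf S by apply: lb_le_inf; [case: infS|].
exists (inf S); split => //.
- case=> [|n]; first by rewrite mul0r.
  rewrite mulrC -ler_pdivlMr ?ltr0n//; apply: ge_inf; first by exists 0.
  by exists n.
- move=> eps eps0.
  have [_ [m _ <-] mS] := inf_adherent (divr_gt0 eps0 (ltr0n R 2)) infS.
  have am : a m.+1 <= m.+1%:R * (inf S + eps / 2).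
    by rewrite mulrC -ler_pdivrMr ?ltr0n// ltW.
  pose C := \sum_(s < m.+1) a s.
  have C0 : 0 <= C by exact: sumr_ge0.
  have aC s : (s < m.+1)%N -> a s <= C.
    by move=> sm; rewrite /C (bigD1 (Ordinal sm))//= lerDl sumr_ge0.
  have aq q s : a (q * m.+1 + s)%N <= q%:R * a m.+1 + a s.
    elim: q => [|q IHq]; first by rewrite mul0r add0r.
    rewrite mulSn -addnA -natr1 mulrDl mul1r; apply: le_trans (aD _ _) _; lra.
  have [N NC] := eventually_nat_ge (2 * C / eps).
  exists N => n nN.
  pose q := (n %/ m.+1)%N; pose s := (n %% m.+1)%N.
  have aqs : a n <= q%:R * a m.+1 + a s.
    by have := aq q s; rewrite -divn_eq.
  have sC : a s <= C by apply: aC; rewrite ltn_mod.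
  have nC := NC n nN.
  have Cn : C <= n%:R * (eps / 2).
    by move: nC; rewrite ler_pdivrMr//; lra.
  have qa : q%:R * a m.+1 <= (q * m.+1)%:R * (inf S + eps / 2).
    by rewrite natrM -mulrA ler_wpM2l.
  have S0 : 0 <= inf S + eps / 2 by rewrite addr_ge0// ltW// divr_gt0.
  have qn : (q * m.+1)%:R * (inf S + eps / 2) <= n%:R * (inf S + eps / 2).
    by rewrite ler_wpM2r// ler_nat leq_trunc_div.
  lra.
Qed.

(* The limit of a divergent sequence is the default point [0] of [\bar R], so
   that a lack of convergence can only lower the suprema defining the entropies. *)
Lemma limn_ereal_default (u : nat -> \bar R) : cvgn u \/ limn u = 0%E.
Proof.
have [[l ul]|nu] := pselect (exists l : \bar R, u n @[n --> \oo] --> l).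
  by left; apply/cvg_ex; exists l.
by right; rewrite /lim /lim_in xgetPN// => l ul; apply: nu; exists l.
Qed.

Lemma limn_ereal_le (r : nat -> R) (h : R) : 0 <= h ->
  (forall eps, 0 < eps -> \forall n \near \oo, r n <= h + eps) ->
  (limn (fun n => (r n)%:E) <= h%:E)%E.
Proof.
move=> h0 rh; have [cr|->] := limn_ereal_default (fun n => (r n)%:E); last first.
  by rewrite lee_fin.
apply/lee_addgt0Pr => eps eps0; rewrite -EFinD; apply: lime_le => //.
by apply: filterS (rh _ eps0) => n; rewrite lee_fin.
Qed.

Lemma limn_ereal_gt (r : nat -> R) (c : R) : 0 <= c ->
  (c%:E < limn (fun n => (r n)%:E))%E -> \forall n \near \oo, c <= r n.
Proof.
move=> c0 rc; have [cr|r0] := limn_ereal_default (fun n => (r n)%:E); last first.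
  by move: rc; rewrite r0 lte_fin ltNge c0.
have cn : nbhs (limn (fun n => (r n)%:E)) [set y | (c%:E < y)%E].
  by apply: open_nbhs_nbhs; split; [exact: open_ereal_gt_ereal|exact: rc].
have : \forall n \near \oo, (c%:E < (r n)%:E)%E by exact: (cr _ cn).
by apply: filterS => n; rewrite lte_fin => /ltW.
Qed.

Lemma limn_ereal_eq (r : nat -> R) (h : R) :
  (forall eps, 0 < eps -> \forall n \near \oo, h - eps <= r n <= h + eps) ->
  limn (fun n => (r n)%:E) = h%:E.
Proof.
move=> rh; apply/cvg_lim => //; apply: cvg_EFin; first exact: nearW.
apply/cvgrPdist_le => eps /rh; apply: filterS => n /= H.
by rewrite distrC ler_distl.
Qed.

End Rates.

Section MeasureEntropy.
Context {R : realType} {I : pzSemiRingType} {B : alphabetType}.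
Variable e : nat -> I.
Hypothesis e_surj : forall i, exists k, e k = i.
Hypothesis forward : forall i : I, exists N j : nat, i + N%:R = j%:R.
Local Notation T := (fullshift I B).
Local Notation itin := (@itinerary _ (borel T) (@sigma I B) _).
Variable mu : probability (borel T) R.
Hypothesis mu_inv : forall A : set (borel T), measurable A ->
  mu ((@sigma I B) @^-1` A) = mu A.

Definition word_entropy n := entropy mu (word n : borel T -> n.-tuple B).

Lemma partition_entropyE k (xi : borel T -> 'I_k) n :
  partition_entropy (@sigma I B) mu xi n = entropy mu (itin xi n).
Proof.
apply: eq_bigr => w _; rewrite /eta /pr.
suff -> : [set x : borel T | forall i : 'I_n, xi (iter i (@sigma I B) x) = tnth w i] =
    itin xi n @^-1` [set w] by [].
apply/seteqP; split => x /=.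
  by move=> H; apply: eq_from_tnth => i; rewrite tnth_mktuple.
by move=> <- i; rewrite tnth_mktuple.
Qed.

Lemma mrv_word n : mrv (word n : borel T -> n.-tuple B).
Proof. by move=> w; apply: clopen_measurable; exact: (word_clopen e_surj [set w]). Qed.

Lemma word_entropyD m n : word_entropy (m + n) <= word_entropy m + word_entropy n.
Proof.
rewrite /word_entropy -!itinerary_coord0.
exact: (entropy_itineraryD (@sigma_measurable I B) mu_inv _ _ (@mrv_coord0 I B)).
Qed.

Lemma word_entropy_ge0 n : 0 <= word_entropy n.
Proof. by apply: entropy_ge0; exact: mrv_word. Qed.

Lemma measure_entropy_le (a : nat -> R) (h : R) : 0 <= h ->
  (forall n, word_entropy n <= a n) ->
  (forall eps, 0 < eps -> exists N, forall n, (N <= n)%N -> a n <= n%:R * (h + eps)) ->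
  (measure_entropy (@sigma I B) mu <= h%:E)%E.
Proof.
move=> h0 wa ah; apply: ge_ereal_sup => _ [k [xi [mxi ->]]].
apply: limn_ereal_le => // eps eps0.
have e30 : 0 < eps / 3 by rewrite divr_gt0.
have [K HK] := entropy_generator e_surj forward mu_inv mxi e30.
have [N HN] := ah _ e30.
have [M HM] := eventually_nat_ge (K%:R * (h + eps / 3) / (eps / 3)).
exists (maxn (maxn N 1) M) => // n /=.
rewrite !geq_max => /andP[/andP[Nn n1] nK].
rewrite partition_entropyE ler_pdivrMr ?ltr0n//.
apply: le_trans (HK n) _; rewrite -/(word_entropy _).
have := le_trans (wa (n + K)%N) (HN _ (leq_trans Nn (leq_addr _ _))).
rewrite natrD.
have := HM n nK.
rewrite ler_pdivrMr//; lra.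
Qed.

Lemma measure_entropy_ge0 : (0 <= measure_entropy (@sigma I B) mu)%E.
Proof.
apply: ereal_sup_ubound; exists 1%N, (fun=> ord0); split.
  move=> i; rewrite (_ : _ @^-1` _ = setT)//.
  by apply/seteqP; split=> // x _; exact/esym/ord1.
apply/esym/cvg_lim => //; apply: cvg_near_cst; apply: nearW => n.
rewrite partition_entropyE; congr _%:E.
suff -> : entropy mu (itin (fun=> ord0 : 'I_1) n) = 0 by rewrite mul0r.
apply: big1 => w _; rewrite (_ : _ @^-1` _ = setT).
  by rewrite pr_setT /eta ln1 mulr0 oppr0.
apply/seteqP; split=> // x _ /=; apply: eq_from_tnth => i.
by rewrite tnth_mktuple [RHS]ord1.
Qed.

(** The partition according to the coordinate [0] attains the supremum; [enum_rank] renames its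
    letters because labels of partitions are ordinals. The two bounds squeeze the quotients, so that
    their limit exists. *)
Lemma measure_entropy_eq (a : nat -> R) (h C : R) : 0 <= h ->
  (forall n, word_entropy n <= a n) ->
  (forall eps, 0 < eps -> exists N, forall n, (N <= n)%N -> a n <= n%:R * (h + eps)) ->
  (forall n, n%:R * h - C <= word_entropy n) ->
  measure_entropy (@sigma I B) mu = h%:E.
Proof.
move=> h0 wa ah hC; apply/eqP; rewrite eq_le; apply/andP; split.
  exact: measure_entropy_le wa ah.
pose xi (x : borel T) := enum_rank (coord0 x).
apply: ereal_sup_ubound; exists #|B|, xi; split.
  move=> i; rewrite (_ : _ @^-1` _ = coord0 @^-1` [set enum_val i]).
    exact: mrv_coord0.
  apply/seteqP; split => x /=; first by move=> <-; rewrite enum_rankK.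
  by rewrite /xi => ->; rewrite enum_valK.
have mxi : mrv xi by exact: (mrv_comp mu enum_rank (@mrv_coord0 I B)).
have E n : entropy mu (itin xi n) = word_entropy n.
  rewrite /word_entropy -itinerary_coord0.
  apply/eqP; rewrite eq_le; apply/andP; split.
    rewrite (_ : itin xi n = (@map_tuple n _ _ enum_rank) \o itin coord0 n).
      by apply: entropy_comp; exact: (mrv_itinerary mu (@sigma_measurable I B) (@mrv_coord0 I B)).
    by apply/funext => x; apply: eq_from_tnth => i; rewrite tnth_mktuple [RHS]tnth_map tnth_mktuple.
  rewrite (_ : itin coord0 n = (@map_tuple n _ _ enum_val) \o itin xi n).
    by apply: entropy_comp; exact: (mrv_itinerary mu (@sigma_measurable I B) mxi).
  apply/funext => x; apply: eq_from_tnth => i.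
  by rewrite tnth_mktuple [RHS]tnth_map tnth_mktuple /xi enum_rankK.
apply/esym/limn_ereal_eq => eps eps0.
have [N HN] := ah _ eps0.
have [M HM] := eventually_nat_ge (C / eps).
exists (maxn (maxn N 1) M) => // n /=.
rewrite !geq_max => /andP[/andP[Nn n1] nK].
rewrite partition_entropyE E.
have n0 : (0 : R) < n%:R by rewrite ltr0n.
rewrite ler_pdivrMr// ler_pdivlMr//.
have := HM n nK.
rewrite ler_pdivrMr// => Cn.
by have := hC n; have := le_trans (wa n) (HN n Nn); lra.
Qed.

(** Subadditivity removes the error term: a partition nearly attaining [h] is compared with words of
    length [j * n + K], these are cut into [j] words of length [n] and one of length [K], and [j] is
    taken large. *)
Lemma word_entropy_ge (h : R) : 0 < h ->
  measure_entropy (@sigma I B) mu = h%:E -> forall n, n%:R * h <= word_entropy n.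
Proof.
move=> h0 muh n; apply/ler_addgt0Pr => eps eps0.
have [->|n0] := posnP n; first by rewrite mul0r addr_ge0 ?word_entropy_ge0// ltW.
have nR : (0 : R) < n%:R by rewrite ltr0n.
(* [d <= h / 2] keeps [h - d] nonnegative, as [limn_ereal_gt] requires; the other bound keeps two
   losses of [d] per step within [2 * eps / 3] over [n] steps. *)
pose d := Num.min (h / 2) (eps / 3 / n%:R).
have d0 : 0 < d by rewrite lt_min !divr_gt0.
have dh : d <= h / 2 by rewrite ge_min lexx.
have dn : d * n%:R <= eps / 3 by rewrite -ler_pdivlMr// ge_min lexx orbT.
have : ((h - d)%:E < measure_entropy (@sigma I B) mu)%E.
  by rewrite muh lte_fin; lra.
move=> /ereal_sup_gt[_ [k [xi [mxi ->]]]] /limn_ereal_gt.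
case=> [|N _ HN]; first by lra.
have [K HK] := entropy_generator e_surj forward mu_inv mxi d0.
have jn (j : nat) : word_entropy (j * n + K) <= j%:R * word_entropy n + word_entropy K.
  elim: j => [|j IHj]; first by rewrite mul0n mul0r add0r.
  rewrite mulSn -addnA -natr1 mulrDl mul1r.
  by apply: le_trans (word_entropyD _ _) _; lra.
have [M HM] := eventually_nat_ge (word_entropy K / (eps / 3)).
pose j := (maxn (maxn N 1) M)%N.
have [Nj j1 jM] : [/\ (N <= j)%N, (0 < j)%N & (M <= j)%N].
  by rewrite /j; split; lia.
have := HN (j * n)%N; rewrite /= partition_entropyE.
have jn0 : (0 : R) < (j * n)%:R by rewrite ltr0n muln_gt0 j1 n0.
rewrite ler_pdivlMr// => /(_ (leq_trans Nj (leq_pmulr _ n0))) H1.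
have H2 := HK (j * n)%N; rewrite -/(word_entropy _) in H2.
have H3 := jn j.
have H4 : word_entropy K <= j%:R * (eps / 3).
  have := HM j jM.
  by rewrite ler_pdivrMr// divr_gt0.
have jR : (0 : R) < j%:R by rewrite ltr0n.
rewrite -(ler_pM2l jR).
rewrite natrM in H1 H2.
have : j%:R * (d * n%:R) <= j%:R * (eps / 3) by rewrite ler_wpM2l// ltW.
lra.
Qed.

End MeasureEntropy.

(** Counting by a relation instead of a map: each [u] is related to at most one [v]. This spares
    defining functions between tuples whose lengths agree only up to arithmetic. *)
Lemma card_rel (U V : finType) (P : {set U}) (Q : {set V}) (S : U -> V -> Prop) :
  (forall v, v \in Q -> exists2 u, u \in P & S u v) ->
  (forall u v v', S u v -> S u v' -> v = v') -> (#|Q| <= #|P|)%N.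
Proof.
move=> QP Sfun.
have fP (v : {v | v \in Q}) : exists u, u \in P /\ S u (val v).
  by have [u uP Suv] := QP (val v) (valP v); exists u.
have [f fS] := choice fP.
rewrite -(card_sig (fun v => v \in Q)).
apply: (@leq_trans #|[set f v | v in {: {v | v \in Q}}]%SET|).
  rewrite card_imset// => v w vw; apply: val_inj.
  have [_ Sv] := fS v; have [_ Sw] := fS w.
  by apply: Sfun Sv _; rewrite vw.
by apply: subset_leq_card; apply/fintype.subsetP => _ /imsetP[v _ ->]; have [] := fS v.
Qed.

Lemma bigminn_le (J : finType) (P : pred J) (F : J -> nat) c j : P j ->
  (\big[minn/c]_(i | P i) F i <= F j)%N.
Proof.
move=> Pj; rewrite unlock /reducebig.
have : j \in index_enum J by rewrite mem_index_enum.
elim: (index_enum J) => // i s IHs; rewrite inE => /predU1P[<-|js] /=.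
  by rewrite Pj geq_minl.
by case: ifP => _; [apply: leq_trans (geq_minr _ _) _|]; exact: IHs.
Qed.

Lemma leq_bigminn (J : finType) (P : pred J) (F : J -> nat) c m :
  (m <= c)%N -> (forall j, P j -> (m <= F j)%N) ->
  (m <= \big[minn/c]_(i | P i) F i)%N.
Proof.
move=> mc mF; elim/big_rec: _ => // i x Pi mx.
by rewrite leq_min mF.
Qed.

Section TopologicalEntropy.
Context {R : realType} {I : pzSemiRingType} {B : alphabetType}.
Variable e : nat -> I.
Hypothesis e_surj : forall i, exists k, e k = i.
Hypothesis forward : forall i : I, exists N j : nat, i + N%:R = j%:R.
Local Notation T := (fullshift I B).
Variable Y : set T.
Hypothesis Y0 : Y !=set0.
Hypothesis cY : closed Y.
Hypothesis sY : sigma @` Y `<=` Y.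

Lemma iter_sigma_in n y : Y y -> Y (iter n sigma y).
Proof. by move=> Yy; elim: n => //= n IHn; apply: sY; exists (iter n sigma y). Qed.

Definition lang n : {set n.-tuple B} :=
  [set w | `[< exists2 y, Y y & word n y = w >]]%SET.

Lemma word_lang n y : Y y -> word n y \in lang n.
Proof. by move=> Yy; rewrite inE; apply/asboolP; exists y. Qed.

Lemma langP n w : reflect (exists2 y, Y y & word n y = w) (w \in lang n).
Proof. by rewrite inE; exact: asboolP. Qed.

Lemma card_lang_gt0 n : (0 < #|lang n|)%N.
Proof. by have [y Yy] := Y0; rewrite (cardD1 (word n y)) word_lang. Qed.

Lemma tnth_word n (x : T) i : tnth (word n x) i = x i%:R.
Proof. by rewrite tnth_mktuple. Qed.

Lemma word_eqP n (x y : T) :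
  word n x = word n y <-> forall i, (i < n)%N -> x i%:R = y i%:R.
Proof.
split=> [xy i lt|xy].
  by have := congr1 (fun t => tnth t (Ordinal lt)) xy; rewrite !tnth_word.
by apply: eq_from_tnth => i; rewrite !tnth_word xy.
Qed.

Lemma card_langD m n : (#|lang (m + n)| <= #|lang m| * #|lang n|)%N.
Proof.
rewrite -cardsX.
apply: (card_rel (S := fun u w => exists y,
  [/\ word m y = u.1, word n (iter m sigma y) = u.2 & word (m + n) y = w])).
  move=> _ /langP[y Yy <-]; exists (word m y, word n (iter m sigma y)); last by exists y.
  by rewrite finset.in_setX /= !word_lang//; exact: iter_sigma_in.
move=> [u v] w w' [y [/= yu yv <-]] [y' [/= yu' yv' <-]]; apply/word_eqP => i im.
have [lt|ge] := ltnP i m.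
  by have /word_eqP := etrans yu (esym yu'); exact.
have /word_eqP/(_ (i - m)%N) := etrans yv (esym yv').
by rewrite !iter_sigmaE -natrD subnK//; apply; lia.
Qed.

Lemma lang_rate : exists h : R, [/\ 0 <= h,
  forall n, n%:R * h <= ln #|lang n|%:R &
  forall eps, 0 < eps -> exists N, forall n, (N <= n)%N ->
    ln #|lang n|%:R <= n%:R * (h + eps)].
Proof.
apply: fekete => [n|m n].
  by rewrite ln_ge0// ler1n card_lang_gt0.
rewrite -lnM ?posrE ?ltr0n ?card_lang_gt0// -natrM ler_ln ?posrE ?ltr0n ?muln_gt0 ?card_lang_gt0//.
by rewrite ler_nat card_langD.
Qed.

Variable h : R.
Hypothesis h0 : 0 <= h.
Hypothesis h_le : forall n, n%:R * h <= ln #|lang n|%:R.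
Hypothesis h_lim : forall eps, 0 < eps -> exists N, forall n, (N <= n)%N ->
  ln #|lang n|%:R <= n%:R * (h + eps).

(** By [word_agree], a word of length [n + K] determines the chosen element of the cover at all
    times from [N] on; the first [N] choices are free, whence the factor [k ^ N]. *)
Lemma cover_number_upper k (U : 'I_k -> set T) : (forall i, open (U i)) ->
  Y `<=` \bigcup_i U i ->
  exists N K, forall n, (cover_number (@sigma I B) Y U n <= #|lang (n + K)| * k ^ N)%N.
Proof.
move=> oU YU; have [y0 Yy0] := Y0; have [i0 _ _] := YU _ Yy0.
have [|y Yy|m mP] := @compact_agree_set _ _ _ e_surj Y
    [set V | exists i, V `<=` U i] cY.
- by move=> V W VW [i WU]; exists i; apply: subset_trans WU.
- have [i _ Uiy] := YU _ Yy; exists (U i); first exact: open_nbhs_nbhs.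
  by exists i => z [].
pose ix y := odflt i0 [pick i | `[< Y `&` [set z | agree e m y z] `<=` U i >]].
have ixE y z : agree e m y z -> ix y = ix z.
  move=> yz; rewrite /ix; congr odflt; apply: eq_pick => i; congr asbool.
  suff -> : [set x | agree e m y x] = [set x | agree e m z x] by [].
  apply/seteqP; split => x /= ?; [apply: agree_trans (agree_sym yz) _|apply: agree_trans yz _] => //.
have ixU y : Y y -> U (ix y) y.
  move=> Yy; have [i yU] := mP y Yy; rewrite /ix.
  case: pickP => [j /asboolP /(_ y)|/(_ i)/asboolPn[//]].
  by apply; split => //; exact: agreexx.
have [N [K NK]] := @word_agree _ B e forward m.
exists N, K => n; rewrite /cover_number.
pose F := [set w : n.-tuple 'I_k | `[< exists2 y, Y y &
   forall j : 'I_n, tnth w j = ix (iter j sigma y) >]]%SET.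
apply: (@leq_trans #|F|).
  apply: bigminn_le; apply/asboolP => y Yy.
  exists [tuple ix (iter j sigma y) | j < n].
    by rewrite /= inE; apply/asboolP; exists y => // j; rewrite tnth_mktuple.
  by move=> j; rewrite tnth_mktuple; apply: ixU; exact: iter_sigma_in.
have -> : (k ^ N = #|[set: N.-tuple 'I_k]%SET|)%N by rewrite cardsT card_tuple card_ord.
rewrite -cardsX; apply: (card_rel (S := fun (u : (n + K).-tuple B * N.-tuple 'I_k) w =>
  exists y, [/\ Y y, word (n + K) y = u.1, forall j : 'I_N, tnth u.2 j = ix (iter j sigma y)
  & forall j : 'I_n, tnth w j = ix (iter j sigma y)])).
  move=> w; rewrite inE => /asboolP[y Yy wy].
  exists (word (n + K) y, [tuple ix (iter j sigma y) | j < N]).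
    by rewrite finset.in_setX /= word_lang// inE.
  by exists y; split => //= j; rewrite tnth_mktuple.
move=> [u t] w w' [y [/= Yy yu ty wy]] [y' [/= Yy' yu' ty' wy']].
apply: eq_from_tnth => j; rewrite wy wy'.
have [jN|Nj] := ltnP j N.
  by have := ty (Ordinal jN); have := ty' (Ordinal jN) => /= -> ->.
apply: ixE; rewrite -(subnKC Nj) !iterD; apply: NK; apply/word_eqP => i iK.
rewrite !iter_sigmaE -natrD.
have /word_eqP := etrans yu (esym yu'); apply.
by have := ltn_ord j; lia.
Qed.

Lemma topological_entropyE : topological_entropy R (@sigma I B) Y = h%:E.
Proof.
apply/eqP; rewrite eq_le; apply/andP; split.
  apply: ge_ereal_sup => _ [k [U [oU YU ->]]].
  have [N [K NK]] := cover_number_upper oU YU.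
  apply: limn_ereal_le => // eps eps0.
  have k0 : (0 < k)%N.
    by have [y Yy] := Y0; have [[i ik] _ _] := YU _ Yy; apply: leq_trans ik.
  have e30 : 0 < eps / 3 by rewrite divr_gt0.
  have [N1 HN1] := h_lim e30.
  have [M HM] := eventually_nat_ge ((K%:R * (h + eps / 3) + ln (k ^ N)%:R) / (eps / 3)).
  exists (maxn (maxn N1 1) M) => // n /=.
  rewrite !geq_max => /andP[/andP[Nn n1] nM].
  rewrite ler_pdivrMr ?ltr0n//.
  have := HM n nM; rewrite ler_pdivrMr// => H1.
  have H2 := HN1 (n + K)%N (leq_trans Nn (leq_addr _ _)).
  rewrite natrD in H2.
  have kN0 : (0 < k ^ N)%N by rewrite expn_gt0 k0.
  have H3 : ln (cover_number (@sigma I B) Y U n)%:R <= ln #|lang (n + K)|%:R + ln (k ^ N)%:R :> R.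
    rewrite -lnM ?posrE ?ltr0n ?card_lang_gt0// -natrM.
    have [->|c0] := posnP (cover_number (@sigma I B) Y U n).
      by rewrite ln0// ln_ge0// ler1n muln_gt0 card_lang_gt0.
    by rewrite ler_ln ?posrE ?ltr0n ?muln_gt0 ?card_lang_gt0// ler_nat.
  have := mulr_ge0 (ler0n R n) (ltW eps0); lra.
apply: ereal_sup_ubound.
(* For the lower bound the cover by the cylinders of coordinate [0] is a partition. A cell of its
   join consists of the points with one given word, so no subcover is smaller than the language. *)
pose U (i : 'I_#|B|) : set T := [set x | x 0 = enum_val i].
exists #|B|, U; split.
- by move=> i; have [] := coord_clopen (B := B) (0 : I) [set enum_val i].
- by move=> y _; exists (enum_rank (y 0)) => //; rewrite /U /= enum_rankK.
have UE n (w : n.-tuple 'I_#|B|) y : join_cell (@sigma I B) U w y <->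
    word n y = map_tuple enum_val w.
  split=> [H|H i]; first apply: eq_from_tnth => i.
    by have := H i; rewrite /U /= iter_sigmaE add0r tnth_word tnth_map.
  by have := congr1 (fun t => tnth t i) H; rewrite /U /= iter_sigmaE add0r tnth_word tnth_map.
have cE n : cover_number (@sigma I B) Y U n = #|lang n|.
  apply/eqP; rewrite eqn_leq; apply/andP; split.
    apply: (@leq_trans #|[set map_tuple enum_rank w | w in lang n]%SET|); last exact: leq_imset_card.
    apply: bigminn_le; apply/asboolP => y Yy.
    exists (map_tuple enum_rank (word n y)).
      by rewrite /=; apply: imset_f; exact: word_lang.
    apply/UE; apply: eq_from_tnth => i; by rewrite [RHS]tnth_map [X in enum_val X]tnth_map enum_rankK.
  have key (F : {set n.-tuple 'I_#|B|}) :
      Y `<=` \bigcup_(w in [set` F]) join_cell (@sigma I B) U w ->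
      (#|lang n| <= #|F|)%N.
    move=> YF; apply: leq_trans (leq_imset_card (map_tuple enum_val) F).
    apply: subset_leq_card; apply/fintype.subsetP => _ /langP[y Yy <-].
    have [w /= Fw /UE yw] := YF y Yy; rewrite yw.
    exact: imset_f.
  apply: leq_bigminn => [|F /asboolP]; last exact: key.
  rewrite -cardsT; apply: key => y Yy; exists (map_tuple enum_rank (word n y)); first by rewrite /= inE.
  by apply/UE; apply: eq_from_tnth => i; rewrite [RHS]tnth_map [X in enum_val X]tnth_map enum_rankK.
apply/esym/limn_ereal_eq => eps eps0.
have [N HN] := h_lim eps0.
exists (maxn N 1) => // n /=; rewrite geq_max => /andP[Nn n1].
have n0 : (0 : R) < n%:R by rewrite ltr0n.
rewrite cE ler_pdivrMr// ler_pdivlMr//.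
have := h_le n; have := HN n Nn; have := mulr_gt0 n0 eps0; lra.
Qed.

Lemma word_entropy_lang (mu : probability (borel T) R) n : mu Y = 1%E ->
  word_entropy mu n <= ln #|lang n|%:R.
Proof.
move=> muY.
have mY : measurable (Y : set (borel T)).
  by rewrite -[Y]setCK; apply: measurableC; apply: sub_sigma_algebra; exact: closed_openC.
pose p w := pr mu ((word n : borel T -> _) @^-1` [set w]).
have p0 w : w \notin lang n -> p w = 0.
  move=> wl; apply/eqP; rewrite eq_le pr_ge0 andbT.
  have -> : 0 = pr mu (~` Y) by rewrite prC// /pr muY subrr.
  apply: le_pr; [exact: (mrv_word e_surj)|exact: measurableC|].
  by move=> y /= yw Yy; move: wl; rewrite -yw word_lang.
have p1 : \sum_(w in lang n) p w = 1.
  rewrite -(mrv_sum1 mu (mrv_word e_surj (n := n))) [RHS](bigID (mem (lang n)))/=.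
  by rewrite [X in _ = _ + X]big1 ?addr0// => w /p0.
rewrite /word_entropy /entropy (bigID (mem (lang n)))/=.
rewrite [X in _ + X]big1 ?addr0; last by move=> w /p0; rewrite /p => ->; exact: eta0.
apply: le_trans (sum_eta_le _ _) _; first by move=> w; exact: pr_ge0.
by rewrite p1 mul1r /eta ln1 mulr0 oppr0 addr0.
Qed.

End TopologicalEntropy.

(** * Counting words of a factor of a coded shift *)

Section BlockCode.
Context {A B : pointedType} (r : nat) (f : seq A -> B).
Implicit Types u v w g : seq A.

(** Sliding block code with windows of [r.+1] letters: the image is [r] letters shorter, and is
    empty for words of length at most [r]. *)
Definition block_code u : seq B :=
  mkseq (fun i => f (take r.+1 (drop i u))) (size u - r).
Local Notation Phi := block_code.

Lemma size_block_code u : size (Phi u) = (size u - r)%N.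
Proof. by rewrite size_mkseq. Qed.

Lemma nth_block_code b u i : (i < size u - r)%N ->
  nth b (Phi u) i = f (take r.+1 (drop i u)).
Proof. by move=> lt; rewrite nth_mkseq. Qed.

Lemma eq_window u v i j : (i + r < size u)%N -> (j + r < size v)%N ->
  (forall k, (k <= r)%N -> nth point u (i + k) = nth point v (j + k)) ->
  take r.+1 (drop i u) = take r.+1 (drop j v).
Proof.
move=> iu jv uv; have su : size (take r.+1 (drop i u)) = r.+1.
  by rewrite size_takel// size_drop; lia.
have sv : size (take r.+1 (drop j v)) = r.+1 by rewrite size_takel// size_drop; lia.
apply: (@eq_from_nth _ point); first by rewrite su sv.
by move=> k; rewrite su => kr; rewrite !nth_take// !nth_drop; apply: uv.
Qed.

Lemma nth_block_code_sub b u v w i : (i < size v - r)%N ->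
  nth b (Phi (u ++ v ++ w)) (size u + i) = nth b (Phi v) i.
Proof.
move=> iv; rewrite !nth_block_code//; last by rewrite !size_cat; lia.
congr f; apply: eq_window; rewrite ?size_cat; [lia|lia|].
move=> k kr; rewrite nth_cat ifN; last by lia.
rewrite nth_cat ifT; last by lia.
by congr nth; lia.
Qed.

Lemma block_code_take u v : take (size u - r) (Phi (u ++ v)) = Phi u.
Proof.
apply: (@eq_from_nth _ point).
  by rewrite size_takel ?size_block_code// size_cat; lia.
move=> i; rewrite size_takel ?size_block_code ?size_cat; last by lia.
by move=> iu; rewrite nth_take// -(nth_block_code_sub point [::] v iu).
Qed.

Lemma block_code_drop u v : drop (size u) (Phi (u ++ v)) = Phi v.
Proof.
apply: (@eq_from_nth _ point).
  by rewrite size_drop !size_block_code size_cat; lia.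
move=> i; rewrite size_drop size_block_code size_cat => iu.
rewrite nth_drop; have iv : (i < size v - r)%N by lia.
by rewrite -(nth_block_code_sub point u [::] iv) cats0.
Qed.

(** If [g] is longer than [r], a window that is not inside the core reads only letters among its
    first or its last [r], and these agree in [g] and [g']. Otherwise [g = g']. *)
Lemma block_code_middle p g g' s : size g = size g' ->
  take r g = take r g' -> drop (size g - r) g = drop (size g - r) g' ->
  Phi g = Phi g' -> Phi (p ++ g ++ s) = Phi (p ++ g' ++ s).
Proof.
move=> sg tg dg Pg.
have [gr|rg] := leqP (size g) r.
  by move: tg; rewrite !take_oversize -?sg// => ->.
apply: (@eq_from_nth _ point); first by rewrite !size_block_code !size_cat sg.
move=> i; rewrite size_block_code !size_cat => iu.
have [/andP[pi ig]|out] := boolP ((size p <= i) && (i + r < size p + size g))%N.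
  have -> : i = (size p + (i - size p))%N by lia.
  by rewrite !nth_block_code_sub ?Pg//; lia.
rewrite !nth_block_code ?size_cat -?sg//; congr f.
apply: eq_window; rewrite ?size_cat -?sg; [lia|lia|].
move=> k kr; rewrite !nth_cat -sg; case: ltnP => // pk.
case: ltnP => // kg.
have [ip|pi] := ltnP i (size p).
  have kk : (i + k - size p < r)%N by lia.
  by rewrite -(nth_take point kk) tg nth_take.
have kk : (i + k - size p = (size g - r) + (i + k - size p - (size g - r)))%N by lia.
by rewrite kk -!nth_drop dg.
Qed.

End BlockCode.

Section CodedCounting.
Context {R : realType} {I : pzSemiRingType} {A B : alphabetType}.
Local Notation T := (fullshift I B).
Variable Y : set T.
Hypothesis Y0 : Y !=set0.
Hypothesis sY : sigma @` Y `<=` Y.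
Variables (r : nat) (f : seq A -> B) (G : set (seq A)) (cp cs : nat -> seq A).
Local Notation Phi := (block_code r f).
Hypothesis G0 : G [::].
Hypothesis GD : forall g g', G g -> G g' -> G (g ++ g').
Hypothesis size_cp : forall n, size (cp n) = n.
Hypothesis size_cs : forall n, size (cs n) = n.

(* Climenhaga-Thompson decompositions: a core in the submonoid [G] between a
   prefix and a suffix, of which there is only one of each length. *)
Definition decomposed n (v : n.-tuple B) i j := exists g, [/\ G g,
  size (cp i ++ g ++ cs j) = (n + r)%N & tval v = Phi (cp i ++ g ++ cs j)].

Hypothesis Y_dec : forall y n, Y y -> exists i j, decomposed (word n y) i j.
Hypothesis Y_per : forall g, G g -> g != [::] ->
  exists y, [/\ Y y, iter (size g) sigma y = y &
    forall k n, (n + r <= k * size g)%N ->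
      tval (word n y) = take n (Phi (flatten (nseq k g)))].

Definition good m : {set (m - r).-tuple B} :=
  [set w | `[< exists g, [/\ G g, size g = m & Phi g = tval w] >]]%SET.

Lemma goodP m w : reflect (exists g, [/\ G g, size g = m & Phi g = tval w]) (w \in good m).
Proof. by rewrite inE; exact: asboolP. Qed.

(** The image of [g ++ g'] begins with that of [g] and ends with that of [g']; the letters read
    across the junction are ignored. *)
Lemma card_goodM m n : (#|good m| * #|good n| <= #|good (m + n)|)%N.
Proof.
rewrite -cardsX; apply: (card_rel (S := fun u w =>
  tval w.1 = take (m - r) (tval u) /\ tval w.2 = drop m (tval u))).
  move=> [w w']; rewrite finset.in_setX /= => /andP[/goodP[g [Gg sg gw]] /goodP[g' [Gg' sg' gw']]].
  have sgg : size (Phi (g ++ g')) == (m + n - r)%N.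
    by rewrite size_block_code size_cat sg sg'.
  exists (Tuple sgg).
    by apply/goodP; exists (g ++ g'); rewrite size_cat sg sg'; split => //; exact: GD.
  rewrite /= -gw -gw'; split; first by have := block_code_take r f g g'; rewrite sg.
  by have := block_code_drop r f g g'; rewrite sg.
by move=> u [a b] [a' b'] /= [au bu] [au' bu']; congr (_, _); apply: val_inj; rewrite /= ?au ?bu.
Qed.

Lemma card_good_exp m k : (#|good m| ^ k <= #|good (k * m)|)%N.
Proof.
elim: k => [|k IHk]; last first.
  by rewrite expnS mulSn; apply: leq_trans (card_goodM _ _); rewrite leq_mul2l IHk orbT.
rewrite expn0 card_gt0; apply/set0Pn.
have s0 : size (Phi [::]) == (0 * m - r)%N by rewrite size_block_code.
by exists (Tuple s0); apply/goodP; exists [::].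
Qed.

Lemma card_good_lang m : (#|good m| <= #|lang Y m|)%N.
Proof.
apply: (card_rel (S := fun u w => tval w = take (m - r) (tval u))); last first.
  by move=> u w w' wu wu'; apply: val_inj; rewrite /= wu.
move=> w /goodP[g [Gg sg gw]].
have [m0|m0] := posnP m.
  have [y Yy] := Y0; exists (word m y); first exact: word_lang.
  have sw : size w = 0%N by rewrite size_tuple m0.
  apply: etrans (size0nil sw) _; apply/esym/size0nil.
  by rewrite size_take_min size_tuple; lia.
have [|y [Yy _ yg]] := Y_per Gg; first by rewrite -size_eq0 sg -lt0n.
exists (word m y); first exact: word_lang.
have := yg r.+1 m; rewrite sg => ->; last first.
  by rewrite mulSn leq_add2l leq_pmulr.
rewrite take_takel ?leq_subr//= -gw -[in LHS](block_code_take r f g (flatten (nseq r g))).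
by rewrite sg.
Qed.

Variable h : R.
Hypothesis h0 : 0 <= h.
Hypothesis h_le : forall n, n%:R * h <= ln #|lang Y n|%:R.
Hypothesis h_lim : forall eps, 0 < eps -> exists N, forall n, (N <= n)%N ->
  ln #|lang Y n|%:R <= n%:R * (h + eps).

Let lam := expR h.

Lemma lamX n : lam ^+ n = expR (n%:R * h).
Proof. by rewrite /lam expRM_natl. Qed.

(** Supermultiplicativity removes the constant: the [N]-th power of [#|good m|] is at most the
    number of words of length [N * m], which has rate [h], and [N]-th roots are taken. *)
Lemma card_good_le m : #|good m|%:R <= lam ^+ m.
Proof.
have [->|c0] := posnP #|good m|; first by rewrite exprn_ge0// expR_ge0.
have cR : (0 : R) < #|good m|%:R by rewrite ltr0n.
rewrite lamX -[leLHS]lnK ?posrE// ler_expR.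
have [m0|m0] := posnP m.
  have g1 : (#|good m| <= 1)%N.
    apply: leq_trans (max_card _) _.
    by rewrite card_tuple (_ : (m - r)%N = 0%N) ?expn0//; lia.
  have -> : m%:R * h = 0 by rewrite m0 mul0r.
  by apply: ln_le0; move: g1; rewrite -(ler_nat R).
have mR : (0 : R) < m%:R by rewrite ltr0n.
apply/ler_addgt0Pr => eps eps0.
have em : 0 < eps / m%:R by rewrite divr_gt0.
have [N HN] := h_lim em.
have N0 : (0 : R) < N.+1%:R by rewrite ltr0n.
rewrite -(ler_pM2l N0) [X in X <= _]mulr_natl -lnXn// -natrX.
have Nm : (N <= N.+1 * m)%N by apply: leq_trans (leqnSn N) _; rewrite leq_pmulr.
apply: (@le_trans _ _ (ln #|lang Y (N.+1 * m)|%:R)).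
  have lt : (#|good m| ^ N.+1 <= #|lang Y (N.+1 * m)|)%N.
    exact: leq_trans (card_good_exp _ _) (card_good_lang _).
  rewrite ler_ln ?posrE ?ltr0n ?expn_gt0 ?c0 ?ler_nat//.
  by apply: leq_trans lt; rewrite expn_gt0 c0.
apply: le_trans (HN _ Nm) _; rewrite natrM -mulrA ler_pM2l//.
by rewrite mulrDr mulrCA divff ?gt_eqF// mulr1.
Qed.

Let K := ((#|{: option A}| ^ r) * (#|{: option A}| ^ r))%N.

Definition dec n i j : {set n.-tuple B} := [set v | `[< decomposed v i j >]]%SET.

Lemma decP n i j v : reflect (decomposed v i j) (v \in dec n i j).
Proof. by rewrite inE; exact: asboolP. Qed.

Lemma onth_ext (u v : seq A) : size u = size v ->
  (forall i, onth u i = onth v i) -> u = v.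
Proof.
move=> suv uv; apply: (@eq_from_nth _ point) => // i iu.
by rewrite -!odflt_onth uv.
Qed.

(* A word in [dec n i j] is determined by [Phi g] and the first and last [r]
   letters of its core [g]; [option A] accounts for cores shorter than [r]. *)
Lemma card_dec n i j : (#|dec n i j| <= K * #|good (n + r - (i + j))|)%N.
Proof.
pose code (u : seq A) : r.-tuple (option A) := [tuple onth u k | k < r].
have codeE u v : size u = size v -> (size u <= r)%N -> code u = code v -> u = v.
  move=> suv ur uv; apply: onth_ext => // k.
  have [kr|rk] := ltnP k r.
    by have := congr1 (fun t => tnth t (Ordinal kr)) uv; rewrite !tnth_mktuple.
  by rewrite !onth_default// -?suv; exact: leq_trans rk.
have -> : K = #|[set: r.-tuple (option A) * r.-tuple (option A)]%SET|.
  by rewrite cardsT card_prod !card_tuple.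
rewrite -cardsX; apply: (card_rel (S := fun u v => exists g,
    [/\ size (cp i ++ g ++ cs j) = (n + r)%N, u.1.1 = code (take r g),
       u.1.2 = code (drop (size g - r) g), tval u.2 = Phi g &
       tval v = Phi (cp i ++ g ++ cs j)])).
  move=> v /decP[g [Gg sg vg]].
  have sg' : size g = (n + r - (i + j))%N.
    by rewrite -sg !size_cat size_cp size_cs; lia.
  have s1 : size (Phi g) == (n + r - (i + j) - r)%N by rewrite size_block_code sg'.
  exists ((code (take r g), code (drop (size g - r) g)), Tuple s1).
    by rewrite finset.in_setX /= inE /=; apply/goodP; exists g.
  by exists g.
move=> [[a b] c] v v' [g [/= sg ag bg cg vg]] [g' [/= sg' ag' bg' cg' vg']].
apply: val_inj; rewrite /= vg vg'.
have sgg : size g = size g' by move: sg sg'; rewrite !size_cat; lia.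
apply: block_code_middle => //.
- by apply: codeE; [rewrite !size_take_min sgg|rewrite size_take_min geq_minl|rewrite -ag].
- apply: codeE; rewrite ?size_drop ?sgg//; first by lia.
  by rewrite sgg in bg; rewrite -bg.
- by rewrite -cg.
Qed.

Hypothesis hpos : 0 < h.
(** [z] is the inverse square root of [lam]. The weight of a prefix and a suffix is the square of
    [z ^ (i + j)]: one factor is summed over [i] and [j] as two geometric series, which gives the
    denominator of [C], and the other is at most [z ^ M] on the tail set. *)
Let z := expR (- (h / 2)).

Let z0 : 0 < z. Proof. exact: expR_gt0. Qed.
Let z1 : z < 1. Proof. by rewrite -expR0 ltr_expR oppr_lt0 divr_gt0. Qed.

Let sum_geo n : \sum_(i < n) z ^+ i <= (1 - z)^-1.
Proof.
rewrite -[leRHS]mul1r ler_pdivlMr ?subr_gt0//.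
have := subrX1 z n => E.
have : (z - 1) * \sum_(i < n) z ^+ i = z ^+ n - 1 by rewrite -E.
have := exprn_gt0 n z0; lra.
Qed.

Let lam_z n d : (d <= n)%N -> lam ^+ (n - d) = lam ^+ n * z ^+ (d + d).
Proof.
move=> dn; rewrite -[in RHS](subnK dn) exprD -mulrA; apply/esym.
rewrite -[RHS]mulr1; congr (_ * _); rewrite exprD -!exprMn_comm.
  by rewrite /lam /z -!expRD (_ : _ + _ = 0) ?expR0 ?expr1n//; lra.
all: exact: mulrC.
Qed.

Let C := K%:R * lam ^+ r / (1 - z) ^+ 2.

Definition tail_set n M : {set n.-tuple B} :=
  [set v | `[< exists i j, (M <= i + j)%N /\ decomposed v i j >]]%SET.

Lemma card_tail n M : #|tail_set n M|%:R <= C * z ^+ M * lam ^+ n.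
Proof.
pose N := (n + r).+1.
pose J := [set ij : 'I_N * 'I_N | (M <= ij.1 + ij.2)%N && (ij.1 + ij.2 <= n + r)%N]%SET.
have sub : tail_set n M \subset (\bigcup_(ij in J) dec n ij.1 ij.2)%SET.
  apply/fintype.subsetP => v; rewrite inE => /asboolP[i [j [Mij vij]]].
  have ijn : (i + j <= n + r)%N.
    by case: vij => g [_ <- _]; rewrite !size_cat size_cp size_cs; lia.
  have iN : (i < N)%N by rewrite /N; lia.
  have jN : (j < N)%N by rewrite /N; lia.
  apply/finset.bigcupP; exists (Ordinal iN, Ordinal jN); last exact/decP.
  by rewrite inE /= Mij.
have c1 : (#|tail_set n M| <= \sum_(ij in J) K * #|good (n + r - (ij.1 + ij.2))|)%N.
  apply: leq_trans (subset_leq_card sub) _.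
  elim/big_rec2: _ => [|ij m D _ mD]; first by rewrite cards0.
  apply: leq_trans (leq_card_setU _ _) _; apply: leq_add => //.
  exact: card_dec.
apply: (@le_trans _ _ (\sum_(ij in J) K%:R * lam ^+ (n + r) * (z ^+ M * (z ^+ ij.1 * z ^+ ij.2)))).
  rewrite -(ler_nat R) in c1; apply: le_trans c1 _.
  rewrite natr_sum; apply: ler_sum => -[i j]; rewrite inE /= => /andP[Mij ijn].
  rewrite natrM -mulrA ler_wpM2l//; apply: le_trans (card_good_le _) _.
  rewrite lam_z// ler_pM2l ?exprn_gt0 ?expR_gt0// exprD.
  rewrite -[z ^+ i * z ^+ j]exprD ler_pM2r ?exprn_gt0// ler_wiXn2l//.
    exact: ltW z0.
  exact: ltW z1.
rewrite -mulr_sumr -mulr_sumr.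
have -> : C * z ^+ M * lam ^+ n = K%:R * lam ^+ (n + r) * (z ^+ M * ((1 - z) ^- 2)).
  by rewrite /C exprD; ring.
rewrite ler_wpM2l ?mulr_ge0 ?exprn_ge0 ?expR_ge0//.
rewrite ler_pM2l ?exprn_gt0//.
apply: (@le_trans _ _ (\sum_(ij : 'I_N * 'I_N) z ^+ ij.1 * z ^+ ij.2)).
  rewrite [leRHS](bigID (mem J))/= lerDl sumr_ge0// => ij _.
  by rewrite mulr_ge0// exprn_ge0// ltW.
rewrite -(pair_big xpredT xpredT (fun i j : 'I_N => z ^+ i * z ^+ j))/=.
under eq_bigr do rewrite -mulr_sumr.
have s0 : 0 <= \sum_(i < N) z ^+ i by apply: sumr_ge0 => i _; rewrite exprn_ge0// ltW.
rewrite -mulr_suml expr2 invfM.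
by apply: ler_pM => //; exact: sum_geo.
Qed.

Lemma card_lang_le n : #|lang Y n|%:R <= C * lam ^+ n.
Proof.
have := card_tail n 0; rewrite expr0 mulr1; apply: le_trans.
rewrite ler_nat; apply: subset_leq_card; apply/fintype.subsetP => _ /langP[y Yy <-].
rewrite inE; apply/asboolP; have [i [j H]] := Y_dec n Yy.
by exists i, j.
Qed.

Lemma lam_le_card n : lam ^+ n <= #|lang Y n|%:R.
Proof.
have c0 : (0 : R) < #|lang Y n|%:R by rewrite ltr0n card_lang_gt0.
by rewrite lamX -[leRHS]lnK ?posrE// ler_expR.
Qed.

Let C_ge1 : 1 <= C.
Proof. by have := le_trans (lam_le_card 0) (card_lang_le 0); rewrite expr0 mulr1. Qed.

Lemma tail_small eps : 0 < eps -> exists M, forall n,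
  #|tail_set n M|%:R <= eps * lam ^+ n.
Proof.
move=> eps0; have C0 : 0 < C by apply: lt_le_trans C_ge1.
have : z ^+ n @[n --> \oo] --> (0 : R) by apply: cvg_expr; rewrite ger0_norm// ltW.
move=> /cvgrPdist_le /(_ (eps / C) (divr_gt0 eps0 C0))[M _ /(_ M (leqnn M))].
rewrite sub0r normrN ger0_norm; last by apply: exprn_ge0; exact: ltW z0.
rewrite ler_pdivlMr// => zM.
exists M => n; apply: le_trans (card_tail n M) _.
by rewrite ler_wpM2r ?exprn_ge0 ?expR_ge0// mulrC.
Qed.

(** Pigeonhole: at least half of the words of length [N - r] have prefix and suffix of total length
    below [M], and there are at most [M * M] such pairs of lengths, so the cores of one length
    account for a positive proportion of [lam ^+ N]. This length is only located within [W] of [N],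
    since [G] need not contain words of every length. *)
Lemma card_good_ge : exists c W, 0 < c /\ forall N, (W <= N)%N ->
  exists m, [/\ (N - W <= m)%N, (m <= N)%N & c * lam ^+ N <= #|good m|%:R].
Proof.
have [|M HM] := @tail_small (1 / 2); first by [].
pose D : R := 2 * K%:R * (M%:R * M%:R) + 1.
have D0 : 0 < D by rewrite ltr_wpDl// !mulr_ge0.
exists (lam ^- r / D), (M + r)%N; split.
  by rewrite divr_gt0// invr_gt0 exprn_gt0 ?expR_gt0.
move=> N WN; apply: contrapT => /forallNP small.
pose n := (N - r)%N.
have nN : (n + r = N)%N by rewrite /n; lia.
have cc : lam ^- r / D * lam ^+ N = lam ^+ n / D.
  rewrite -nN exprD mulrAC [lam ^- r * _]mulrCA mulVf ?mulr1//.
  by rewrite gt_eqF// exprn_gt0// expR_gt0.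
pose J := [set ij : 'I_M * 'I_M | (ij.1 + ij.2 < M)%N]%SET.
have sub : lang Y n \subset (tail_set n M :|: \bigcup_(ij in J) dec n ij.1 ij.2)%SET.
  apply/fintype.subsetP => _ /langP[y Yy <-]; have [i [j H]] := Y_dec n Yy.
  rewrite inE; have [Mij|ijM] := leqP M (i + j).
    by apply/orP; left; rewrite inE; apply/asboolP; exists i, j.
  apply/orP; right; have iM : (i < M)%N by lia.
  have jM : (j < M)%N by lia.
  by apply/finset.bigcupP; exists (Ordinal iM, Ordinal jM); rewrite ?inE//; apply/asboolP.
have c1 : (#|lang Y n| <= #|tail_set n M| + \sum_(ij in J) K * #|good (n + r - (ij.1 + ij.2))|)%N.
  apply: leq_trans (subset_leq_card sub) _.
  apply: leq_trans (leq_card_setU _ _) _; rewrite leq_add2l.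
  elim/big_rec2: _ => [|ij m E _ mE]; first by rewrite cards0.
  apply: leq_trans (leq_card_setU _ _) _; apply: leq_add => //.
  exact: card_dec.
have l0 : 0 < lam ^+ n by rewrite exprn_gt0// expR_gt0.
have c2 : (\sum_(ij in J) K * #|good (n + r - (ij.1 + ij.2))|)%:R <=
    M%:R * M%:R * (K%:R * (lam ^+ n / D)).
  rewrite natr_sum; apply: (@le_trans _ _ (\sum_(ij in J) K%:R * (lam ^+ n / D))).
    apply: ler_sum => -[i j]; rewrite inE /= => ijM.
    rewrite natrM ler_wpM2l// -cc leNgt; apply/negP => /ltW H.
    apply: (small (n + r - (i + j))%N); split; last exact: H.
      by rewrite nN leq_sub2l// (leq_trans (ltnW ijM))// leq_addr.
    by rewrite nN leq_subr.
  apply: (@le_trans _ _ (\sum_(ij : 'I_M * 'I_M) K%:R * (lam ^+ n / D))).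
    rewrite [leRHS](bigID (mem J))/= lerDl sumr_ge0// => ij _.
    by rewrite mulr_ge0// divr_ge0// ltW.
  by rewrite sumr_const card_prod !card_ord -[X in X <= _]mulr_natl natrM.
have c3 : M%:R * M%:R * (K%:R * (lam ^+ n / D)) < lam ^+ n / 2.
  rewrite (_ : _ * _ = lam ^+ n * ((M%:R * M%:R * K%:R) / D)); last by ring.
  rewrite ltr_pM2l// ltr_pdivrMr// /D.
  lra.
have := le_trans (lam_le_card n) _; rewrite -(ler_nat R) natrD in c1.
move=> /(_ _ c1); have := HM n; lra.
Qed.

End CodedCounting.

Lemma card_le_size (U : finType) (V : eqType) (D : {set U}) (s : seq V)
    (S : U -> V -> Prop) :
  (forall u, u \in D -> exists2 x, x \in s & S u x) ->
  (forall u u' x, S u x -> S u' x -> u = u') -> (#|D| <= size s)%N.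
Proof.
move=> Ds Sinj.
have fP (u : {u | u \in D}) : exists x, x \in s /\ S (val u) x.
  by have [x xs Sx] := Ds (val u) (valP u); exists x.
have [f fS] := choice fP.
rewrite -(card_sig (fun u => u \in D)) cardE -(size_map f).
apply: uniq_leq_size.
  rewrite map_inj_uniq ?enum_uniq// => u v uv; apply: val_inj.
  by have [_ Su] := fS u; have [_ Sv] := fS v; apply: Sinj Su _; rewrite uv.
by move=> _ /mapP[u _ ->]; have [] := fS u.
Qed.

Lemma size_le_card (U : finType) (V : choiceType) (D : {set U}) (s : seq V)
    (S : U -> V -> Prop) : uniq s ->
  (forall x, x \in s -> exists2 u, u \in D & S u x) ->
  (forall u x x', x \in s -> x' \in s -> S u x -> S u x' -> x = x') -> (size s <= #|D|)%N.
Proof.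
move=> us Ds Sinj; rewrite -(card_seq_sub us) -cardsT.
apply: (card_rel (S := fun u x => S u (val x))).
  by move=> x _; exact: Ds (valP x).
by move=> u x x' Sx Sx'; apply: val_inj; apply: Sinj Sx Sx'; exact: valP.
Qed.

(** * Periodic points and limits of their counting measures *)

Section Periodic.
Context {R : realType} {I : pzSemiRingType} {B : alphabetType}.
Variable e : nat -> I.
Hypothesis e_surj : forall i, exists k, e k = i.
Hypothesis forward : forall i : I, exists N j : nat, i + N%:R = j%:R.
Local Notation T := (fullshift I B).
Variable Y : set T.
Hypothesis cY : closed Y.
Hypothesis sY : sigma @` Y `<=` Y.

Lemma periodicM k q (y : T) : iter k sigma y = y -> iter (q * k) sigma y = y.
Proof. by move=> yk; elim: q => // q IHq; rewrite mulSn iterD IHq. Qed.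

(** In the two-sided case a coordinate may be negative; a multiple of the period moves it to the
    right of [N], where the given word decides. *)
Lemma periodic_ext k N (y y' : T) : (0 < k)%N ->
  iter k sigma y = y -> iter k sigma y' = y' ->
  word k (iter N sigma y) = word k (iter N sigma y') -> y = y'.
Proof.
move=> k0 yk yk' /word_eqP w.
have tail j : y (N + j)%:R = y' (N + j)%:R.
  have E (z : T) : iter k sigma z = z -> z (N + j)%:R = iter N sigma z (j %% k)%:R.
    move=> zk; rewrite iter_sigmaE -natrD -[in RHS](periodicM (j %/ k) zk).
    by rewrite iter_sigmaE -natrD; congr (z _%:R); have := divn_eq j k; lia.
  by rewrite !E// w// ltn_mod.
apply/funext => i; have [M [j ij]] := forward i.
have le : (M + N <= (M + N) * k)%N by rewrite leq_pmulr.
rewrite -(periodicM (M + N) yk) -(periodicM (M + N) yk') !iter_sigmaE.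
have -> : ((M + N) * k = M + (N + ((M + N) * k - (M + N))))%N by lia.
rewrite natrD addrA ij -natrD addnCA; exact: tail.
Qed.

Lemma finite_periodic k : (0 < k)%N -> finite_set [set y : T | iter k sigma y = y].
Proof.
move=> k0; pose g (w : k.-tuple B) : T :=
  xget point [set y : T | iter k sigma y = y /\ word k y = w].
apply: (@sub_finite_set _ _ (g @` [set: k.-tuple B])); last first.
  by apply: finite_image; exact: finite_finset.
move=> y yk; exists (word k y) => //; rewrite /g.
case: xgetP => [z _ [zk zy]|/(_ y)[]//].
by apply: (@periodic_ext k 0).
Qed.

Lemma finite_Per n : finite_set (Per sigma Y n).
Proof.
apply: (@sub_finite_set _ _ (\bigcup_(k in `I_n) [set y : T | iter k.+1 sigma y = y])).
  by move=> y [_ [k [/andP[k0 kn] yk]]]; exists k.-1; rewrite ?prednK//= -?iterS prednK.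
by apply: bigcup_finite => // k _; exact: finite_periodic.
Qed.

Definition per_seq n : seq T := finmap.enum_fset (fset_set (Per sigma Y n)).

Lemma mem_per_seq n y : (y \in per_seq n) = `[< Per sigma Y n y >].
Proof.
have := in_fset_set (finite_Per n) y.
rewrite (_ : (y \in per_seq n) = (y \in fset_set (Per sigma Y n)))// => ->.
Qed.

Lemma per_seqP n y : reflect (Per sigma Y n y) (y \in per_seq n).
Proof. by rewrite mem_per_seq; exact: asboolP. Qed.

Lemma uniq_per_seq n : uniq (per_seq n). Proof. exact: finmap.fset_uniq. Qed.

Definition per_ratio n (A : set T) : R :=
  (count (fun y => `[< A y >]) (per_seq n))%:R / (size (per_seq n))%:R.

Lemma periodic_measureE n (A : set (borel T)) :
  periodic_measure (R := R) sigma Y n A = (per_ratio n A)%:E.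
Proof.
rewrite /periodic_measure /= /mscale /= /msum /per_ratio mulrC EFinM.
congr (_ * _)%E; rewrite -/(per_seq n).
rewrite -sum1_count natr_sum -sumEFin (big_nth point) big_mkord.
rewrite [RHS]big_mkcond /=; apply: eq_bigr => i _.
rewrite diracE; case: ifPn => [/asboolP/mem_set -> //|].
by case: (boolP (nth point (per_seq n) i \in A)) => // /set_mem H /asboolPn[].
Qed.

Lemma per_ratio_itv n A : 0 <= per_ratio n A <= 1.
Proof.
rewrite /per_ratio divr_ge0//=; have [->|s0] := posnP (size (per_seq n)).
  by rewrite invr0 mulr0.
by rewrite ler_pdivrMr ?ltr0n// mul1r ler_nat count_size.
Qed.

Lemma per_ratioU n A C : A `&` C = set0 ->
  per_ratio n (A `|` C) = per_ratio n A + per_ratio n C.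
Proof.
move=> AC; rewrite /per_ratio -mulrDl -natrD -count_predUI; congr ((_)%:R / _).
rewrite [X in (_ + X)%N](_ : _ = 0%N) ?addn0.
  apply: eq_count => y /=; apply/asboolP/orP.
    by move=> [?|?]; [left|right]; apply/asboolP.
  by move=> [/asboolP ?|/asboolP ?]; [left|right].
apply/eqP; rewrite -leqn0 leqNgt -has_count; apply/hasPn => y _ /=.
apply/negP => /andP[/asboolP Ay /asboolP Cy].
by have : (A `&` C) y by []; rewrite AC.
Qed.

Lemma per_ratioT n : (0 < size (per_seq n))%N -> per_ratio n setT = 1.
Proof.
move=> s0; rewrite /per_ratio (eq_count (a2 := xpredT)) ?count_predT.
  by rewrite divff// gt_eqF// ltr0n.
by move=> y; apply/asboolP.
Qed.

Lemma per_ratio0 n A : (forall y, Y y -> ~ A y) -> per_ratio n A = 0.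
Proof.
move=> YA; rewrite /per_ratio (_ : count _ _ = 0%N) ?mul0r//.
apply/eqP; rewrite -leqn0 leqNgt -has_count; apply/hasPn => y /per_seqP[Yy _] /=.
exact/asboolPn/YA.
Qed.

(** [sigma] permutes [Per n]: it maps this finite set to itself, and two of its points with the same
    image are both fixed by the product of their periods, hence equal. *)
Lemma per_ratio_sigma n A : per_ratio n (@sigma I B @^-1` A) = per_ratio n A.
Proof.
rewrite /per_ratio; congr (_%:R / _).
rewrite -(count_map (@sigma I B) (fun y => `[< A y >])).
have inj : {in per_seq n &, injective (@sigma I B)}.
  move=> y y' /per_seqP[_ [k [/andP[k0 _] yk]]] /per_seqP[_ [k' [/andP[k'0 _] yk']]] yy'.
  have kk : (k' * k = (k' * k).-1.+1)%N by rewrite prednK// muln_gt0 k0 k'0.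
  rewrite -(periodicM k' yk) -(periodicM k yk') [(k * k')%N]mulnC kk.
  by rewrite [LHS]iterSr [RHS]iterSr yy'.
have us : uniq [seq sigma i | i <- per_seq n] by rewrite map_inj_in_uniq ?uniq_per_seq.
have sub : {subset [seq sigma i | i <- per_seq n] <= per_seq n}.
  move=> _ /mapP[y /per_seqP[Yy [k [kn yk]]] ->]; apply/per_seqP; split.
    by apply: sY; exists y.
  by exists k; split => //; rewrite -iterSr /= yk.
have le : (size (per_seq n) <= size [seq sigma i | i <- per_seq n])%N by rewrite size_map.
have [_ mem] := uniq_min_size us sub le.
by apply: permP; apply: uniq_perm => //; exact: uniq_per_seq.
Qed.

Lemma closed_borel : measurable (Y : set (borel T)).
Proof.
rewrite -[Y]setCK; apply: measurableC; apply: sub_sigma_algebra.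
exact: closed_openC.
Qed.

Lemma invariant_clopen (m : probability (borel T) R) :
  (forall C, clopen C -> m (@sigma I B @^-1` C) = m C) ->
  forall A : set (borel T), measurable A -> m (@sigma I B @^-1` A) = m A.
Proof.
move=> mC.
have ms : measurable_fun [set: borel T] (@sigma I B : borel T -> borel T).
  by move=> _ A mA; rewrite setTI; exact: sigma_measurable.
pose sm : {mfun borel T >-> borel T} :=
  HB.pack (@sigma I B : borel T -> borel T) (isMeasurableFun.Build _ _ _ _ _ ms).
pose m' : probability (borel T) R := distribution m sm.
exact: (probability_clopen_ext e_surj (m1 := m') (m2 := m) mC).
Qed.

Lemma per_ultralimit (F : set_system nat) : UltraFilter F -> \oo `<=` F ->
  (\forall n \near \oo, (0 < size (per_seq n))%N) ->
  exists m : probability (borel T) R, invariant_probability sigma Y m /\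
    forall C, clopen C -> per_ratio n C @[n --> F] --> pr m C.
Proof.
move=> UF oF pF.
have [m mC] := @ultralimit_probability R I B e e_surj F per_ratio UF
  per_ratio_itv per_ratioU (oF _ (filterS (fun n => @per_ratioT n) pF)).
exists m; split; last exact: mC.
split.
  (* The limits are known on clopen sets only, and [Y] is merely closed: its complement is written
     as a countable union of clopen sets, on each of which all ratios vanish. *)
  have [C [cC CE]] := open_bigcup_clopen e_surj (closed_openC cY).
  have C0 n : m (C n) = 0%E.
    have mCn : measurable (C n : set (borel T)) by exact: clopen_measurable.
    rewrite prE// /pr; congr _%:E.
    have := mC _ (cC n); rewrite (_ : (fun k => per_ratio k (C n)) = fun=> 0).
      by move/cvg_lim => <- //; rewrite lim_cst.
    apply/funext => k; apply: per_ratio0 => y Yy Cy.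
    by have : (~` Y) y by rewrite CE; exists n.
  have mYC : m (~` Y) = 0%E.
    have mCn n : measurable (C n : set (borel T)) by exact: clopen_measurable.
    have mUC := bigcupT_measurable _ mCn.
    apply/eqP; rewrite -measure_le0 CE.
    have := @measure_sigma_subadditive _ _ _ m _ _ mCn mUC (@subset_refl _ _).
    by rewrite eseries0// => n _ _; exact: C0.
  have mYm := closed_borel.
  rewrite prE//; congr _%:E; have := prC m mYm.
  by rewrite /pr mYC /= => H; lra.
apply: invariant_clopen => C cC.
have cS : clopen (@sigma I B @^-1` C).
  by apply: preimage_clopen => //; exact: sigma_continuous.
rewrite !prE; [|exact: clopen_measurable|exact: clopen_measurable].
congr _%:E; rewrite /pr; have := mC _ cS; under eq_fun do rewrite per_ratio_sigma.
by move=> /cvg_lim <-//; apply/cvg_lim => //; exact: mC.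
Qed.

End Periodic.

Lemma measure_setI_conull d (T : measurableType d) (R : realType)
    (mu : {measure set T -> \bar R}) (A D : set T) :
  measurable A -> measurable D -> mu (~` D) = 0%E -> mu (A `&` D) = mu A.
Proof.
move=> mA mD D0; have k0 : mu (A `\` D) = 0%E.
  apply/eqP; rewrite -measure_le0 -D0; apply: le_measure; rewrite ?inE.
  - exact: measurableD.
  - exact: measurableC.
  - by move=> x [].
have E : mu A = (mu (A `\` D) + mu (A `&` D))%E := measureDI mu mA mD.
by rewrite E k0 add0e.
Qed.

(** * Weak* convergence tested on clopen sets *)

Section WeakStar.
Context {R : realType} {I : pzSemiRingType} {B : alphabetType}.
Variable e : nat -> I.
Hypothesis e_surj : forall i, exists k, e k = i.
Hypothesis forward : forall i : I, exists N j : nat, i + N%:R = j%:R.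
Local Notation T := (fullshift I B).
Variable Y : set T.
Hypothesis cY : closed Y.
Hypothesis sY : sigma @` Y `<=` Y.

Lemma within_agree (g : T -> R) (U : set R) y : {within Y, continuous g} ->
  Y y -> open U -> U (g y) ->
  exists n, forall z, Y z -> agree e n y z -> U (g z).
Proof.
move=> /subspace_continuousP/(_ y) cg Yy oU Ugy.
have /(_ U (open_nbhs_nbhs (conj oU Ugy))) := cg Yy.
rewrite /within /= => /(nbhs_agree e_surj)[n nU].
by exists n => z Yz yz; apply: nU.
Qed.

Lemma within_measurable (g : T -> R) : {within Y, continuous g} ->
  measurable_fun (Y : set (borel T)) (g : borel T -> R).
Proof.
move=> cg; apply: (measurability _ (measurable_realfun.RGenOpens.measurableE R)).
move=> _ [_ [a [b ->]] <-].
set U := `]a, b[%classic.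
have oU : open U by exact: itv_open.
rewrite (_ : Y `&` _ = Y `&` [set x | exists n, forall z, Y z -> agree e n x z -> U (g z)]).
  apply: measurableI; first exact: closed_borel.
  apply: sub_sigma_algebra; rewrite openE => x [n nU].
  apply: filterS (agree_nbhs e n x) => y xy; exists n => z Yz yz.
  by apply: nU => //; apply: agree_trans yz.
apply/seteqP; split=> y [Yy].
  by move=> Ugy; split => //; exact: within_agree.
by move=> [n nU]; split => //; apply: nU => //; exact: agreexx.
Qed.

Definition pattern n (x : T) : n.-tuple B := [tuple x (e k) | k < n].

Lemma patternP n x y : pattern n x = pattern n y <-> agree e n x y.
Proof.
split=> [xy k kn|xy].
  by have := congr1 (fun t => tnth t (Ordinal kn)) xy; rewrite !tnth_mktuple.
by apply: eq_from_tnth => k; rewrite !tnth_mktuple; apply: xy.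
Qed.

Definition cylinder n (w : n.-tuple B) : set T := [set x | pattern n x = w].

Lemma cylinder_clopen n w : clopen (@cylinder n w).
Proof.
by apply: (@saturated_clopen _ _ e n) => x y /patternP xy /= <-.
Qed.

(** The cylinders and coefficients depend on [g] and [eps] alone, so that one approximation serves
    both the periodic measures and their limit. The mass is bounded by [1] rather than equal to it
    because the periodic measure is zero when [Per n] is empty. *)
Lemma integral_approx (g : T -> R) (eps : R) : {within Y, continuous g} -> 0 < eps ->
  exists n (c : n.-tuple B -> R),
    forall kappa : {measure set (borel T) -> \bar R}, (kappa setT <= 1)%E ->
      kappa (~` Y) = 0%E ->
      exists2 r, (\int[kappa]_(x in (Y : set (borel T))) (g x)%:E)%E = r%:E &
        `|r - \sum_w c w * fine (kappa (cylinder w))| <= eps.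
Proof.
move=> cg eps0.
have [|n nE] := @compact_agree _ _ e e_surj Y (fun y z => `|g y - g z| < eps) cY.
  move=> y Yy; have e20 : 0 < eps / 2 by rewrite divr_gt0.
  have [||n nP] := within_agree (U := ball (g y) (eps / 2)) cg Yy.
  - exact: ball_open.
  - exact: ballxx.
  exists [set z | agree e n y z]; first exact: agree_nbhs.
  move=> z z' Yz Yz' yz yz'.
  have := nP z Yz yz; have := nP z' Yz' yz'; rewrite /ball /= => h1 h2.
  rewrite (splitr eps); apply: le_lt_trans (ler_distD (g y) _ _) _.
  by rewrite distrC; apply: ltrD.
(* If the cylinder misses [Y], the representative is arbitrary; the cylinder is then null for
   [kappa]. *)
pose rep w := xget point (Y `&` @cylinder n w).
pose c w := g (rep w).
exists n, c => kappa k1 kY.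
have mY := closed_borel cY.
have mC w : measurable (@cylinder n w : set (borel T)).
  by apply: clopen_measurable; exact: cylinder_clopen.
have repE x : Y x -> `|g x - c (pattern n x)| < eps.
  move=> Yx; rewrite /c /rep; case: xgetP => [z _ [Yz xz]|/(_ x)]; last by case.
  by apply: nE => //; apply/patternP.
have koo : (kappa (Y : set (borel T)) < +oo)%E.
  apply: le_lt_trans (ltry 1); apply: le_trans k1; apply: le_measure => //.
    by rewrite inE.
  by rewrite inE; exact: measurableT.
have kC w : kappa (cylinder w `&` Y) = kappa (@cylinder n w).
  exact: measure_setI_conull.
have kCfin w : kappa (@cylinder n w) \is a fin_num.
  rewrite ge0_fin_numE//; apply: le_lt_trans (ltry 1); apply: le_trans k1.
  by apply: le_measure; rewrite ?inE//; exact: measurableT.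
pose s (a : n.-tuple B -> R) (x : borel T) : \bar R :=
  (\sum_w (a w)%:E * (\1_(@cylinder n w : set (borel T)) x)%:E)%E.
have sE a x : s a x = (a (pattern n x))%:E.
  rewrite /s (bigD1 (pattern n x))//= indicE mem_set// mule1 big1 ?adde0// => w wx.
  rewrite indicE memNset ?mule0// => xw; move: wx.
  by rewrite -xw eqxx.
have ind_int w : kappa.-integrable (Y : set (borel T))
    (fun x => (\1_(@cylinder n w : set (borel T)) x)%:E).
  apply: (measurable_bounded_integrable (f := \1_(@cylinder n w : set (borel T)))) => //.
  exists 1; split => // M M1 x _; apply: le_trans (ltW M1).
  by rewrite indicE normr_nat lern1 leq_b1.
have s_int a : kappa.-integrable (Y : set (borel T)) (s a).
  by apply: integrable_sum => // w _; apply: integrableZl.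
have s_val a : (\int[kappa]_(x in (Y : set (borel T))) s a x)%E =
    (\sum_w a w * fine (kappa (@cylinder n w)))%:E.
  rewrite integral_sum//; last by move=> w; apply: integrableZl.
  rewrite -sumEFin; apply: eq_bigr => w _.
  by rewrite integralZl// integral_indic// kC EFinM fineK.
have g_int : kappa.-integrable (Y : set (borel T)) (EFin \o g).
  apply: measurable_bounded_integrable => //; first exact: within_measurable.
  exists (\sum_w `|c w| + eps); split; first exact: num_real.
  move=> M HM x Yx /=.
  apply: ltW; apply: le_lt_trans HM.
  rewrite -(subrK (c (pattern n x)) (g x)) addrC.
  apply: le_trans (ler_normD _ _) _; apply: lerD; last exact/ltW/repE.
  by rewrite (bigD1 (pattern n x))//= lerDl sumr_ge0.
have gfin := integrable_fin_num mY g_int.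
exists (fine (\int[kappa]_(x in (Y : set (borel T))) (g x)%:E)%E); first by rewrite fineK.
(* The step functions with these coefficients enclose [g] on [Y]. *)
pose cl w : R := c w - eps; pose cu w : R := c w + eps.
have lo : (\int[kappa]_(x in (Y : set (borel T))) s cl x <=
    \int[kappa]_(x in (Y : set (borel T))) (g x)%:E)%E.
  apply: le_integral => // x /set_mem Yx; rewrite sE lee_fin.
  by have := repE x Yx; rewrite /cl ltr_distl => /andP[H _]; lra.
have hi : (\int[kappa]_(x in (Y : set (borel T))) (g x)%:E <=
    \int[kappa]_(x in (Y : set (borel T))) s cu x)%E.
  apply: le_integral => // x /set_mem Yx; rewrite sE lee_fin.
  by have := repE x Yx; rewrite /cu ltr_distl => /andP[_ H]; lra.
rewrite s_val -(fineK gfin) lee_fin /cl in lo; rewrite s_val -(fineK gfin) lee_fin /cu in hi.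
set S := \sum_w _; set r := fine _ in lo hi *.
have sum1 : \sum_w fine (kappa (@cylinder n w)) <= 1.
  have := s_val (fun=> 1); under eq_bigr do rewrite mul1r.
  move=> E; rewrite -lee_fin -E; under eq_integral do rewrite sE.
  rewrite integral_cst// mul1e; apply: le_trans k1; apply: le_measure => //.
    by rewrite inE.
  by rewrite inE; exact: measurableT.
have E d : \sum_w (c w + d) * fine (kappa (@cylinder n w)) =
    S + d * \sum_w fine (kappa (@cylinder n w)).
  rewrite mulr_sumr -big_split/=; apply: eq_bigr => w _; exact: mulrDl.
rewrite E in hi; rewrite (E (- eps)) in lo.
have : eps * \sum_w fine (kappa (@cylinder n w)) <= eps * 1 by rewrite ler_wpM2l// ltW.
by rewrite ler_distl; lra.
Qed.

Local Notation per_ratio := (@per_ratio R I B Y).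
Local Notation per_seq := (@per_seq I B Y).

Lemma weak_star_clopen (mu : probability (borel T) R) : mu Y = 1%E ->
  (forall C, clopen C -> per_ratio n C @[n --> \oo] --> pr mu C) ->
  weak_star_cvg Y (periodic_measure sigma Y) mu.
Proof.
move=> muY muC g cg.
have pE := @periodic_measureE R I B Y.
have p1 n : (periodic_measure (R := R) sigma Y n setT <= 1)%E.
  by rewrite pE lee_fin; have /andP[] := @per_ratio_itv R I B Y n setT.
have pY n : periodic_measure (R := R) sigma Y n (~` Y) = 0%E.
  by rewrite pE per_ratio0// => y Yy; apply.
have mY := closed_borel cY.
have m1 : (mu setT <= 1)%E by rewrite probability_setT.
have mYC : mu (~` Y) = 0%E.
  rewrite prE; last exact: measurableC.
  by rewrite prC// /pr muY /= subrr.
have fin n : exists r, (\int[periodic_measure sigma Y n]_(x in (Y : set (borel T))) (g x)%:E)%E = r%:E.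
  have [m [c H]] := integral_approx cg ltr01.
  by have [r rE _] := H _ (p1 n) (pY n); exists r.
have [r rE] := choice fin.
have [r0 r0E] : exists r, (\int[mu]_(x in (Y : set (borel T))) (g x)%:E)%E = r%:E.
  have [m [c H]] := integral_approx cg ltr01.
  by have [r' r'E _] := H mu m1 mYC; exists r'.
rewrite r0E; under eq_fun do rewrite rE.
apply: cvg_EFin; first exact: nearW.
apply/cvgrPdist_le => eps eps0 /=.
have e30 : 0 < eps / 3 by rewrite divr_gt0.
have [m [c H]] := integral_approx cg e30.
have S_cvg : \sum_w c w * per_ratio n (@cylinder m w) @[n --> \oo] -->
    \sum_w c w * pr mu (@cylinder m w).
  apply: cvg_big => [|w _]; first by move=> [a b]; exact: add_continuous.
  by apply: cvgM; [exact: cvg_cst|apply: muC; exact: cylinder_clopen].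
move/cvgrPdist_le : S_cvg => /(_ _ e30); apply: filterS => n /= Sn.
have [r0' r0'E H0] := H mu m1 mYC.
have [rn' rn'E Hn] := H _ (p1 n) (pY n).
have r0'r : r0' = r0 by apply: EFin_inj; rewrite -r0'E -r0E.
have rn'r : rn' = r n by apply: EFin_inj; rewrite -rn'E -rE.
move: H0 Hn; rewrite r0'r rn'r => H0.
under eq_bigr do rewrite pE /=.
move: Sn H0; rewrite /pr !ler_distl => /andP[a1 a2] /andP[b1 b2] /andP[c1 c2].
by apply/andP; split; lra.
Qed.

Definition per_limit (F : set_system nat) (m : probability (borel T) R) :=
  invariant_probability sigma Y m /\
  forall C, clopen C -> per_ratio n C @[n --> F] --> pr m C.

(* By compactness, weak* convergence can be tested along ultrafilters. *)
Lemma ultralimits_suffice :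
  (\forall n \near \oo, (0 < size (per_seq n))%N) ->
  (forall F m, UltraFilter F -> \oo `<=` F -> per_limit F m ->
     maximal_entropy_measure sigma Y m /\
     forall nu : probability (borel T) R, maximal_entropy_measure sigma Y nu ->
       forall A, measurable A -> nu A = m A) ->
  intrinsically_ergodic R sigma Y /\
  forall mu : probability (borel T) R, maximal_entropy_measure sigma Y mu ->
    weak_star_cvg Y (periodic_measure sigma Y) mu.
Proof.
move=> pF mmeP.
have lim F : UltraFilter F -> \oo `<=` F -> exists m, per_limit F m.
  by move=> UF oF; exact: (per_ultralimit e_surj forward cY sY UF oF pF).
split.
  have [F [UF oF]] := ultraFilterLemma (@eventually_filter).
  have [m mF] := lim F UF oF; have [m1 m2] := mmeP F m UF oF mF.
  split; first by exists m.
  by move=> mu nu muE nuE A mA; rewrite (m2 _ muE)// (m2 _ nuE).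
move=> mu muE; have muY : mu Y = 1%E by have [[]] := muE.
apply: weak_star_clopen => // C cC; apply/cvgrPdist_lt => eps eps0.
apply: contrapT => nev.
(* If the ratios did not converge on [C], an ultrafilter containing [D] would have a limit measure
   that differs from [mu] on [C]. *)
pose D := [set n | eps <= `|pr mu C - per_ratio n C|].
have DF : ProperFilter (within D \oo).
  split; last exact: within_filter.
  move=> W; apply: nev; have {}W : \forall n \near \oo, D n -> False := W.
  apply: filterS W => n; rewrite /D /= => H.
  by rewrite ltNge; apply/negP.
have [F [UF DlF]] := ultraFilterLemma DF.
have oF : \oo `<=` F.
  by move=> P oP; apply: DlF; apply: filterS oP => n Pn _.
have FD : F D by apply: DlF; exact: withinT.
have [m mF] := lim F UF oF; have [_ m2] := mmeP F m UF oF mF.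
have [_ /(_ C cC)] := mF; rewrite /pr -(m2 _ muE); last exact: clopen_measurable.
move=> /cvgrPdist_lt/(_ eps eps0) near.
have [n [/= Dn nn]] := filter_ex (filterI FD near).
by move: nn; rewrite ltNge Dn.
Qed.

End WeakStar.

Lemma count_le_sum (V : eqType) (s : seq V) (a : pred V) (q : nat -> pred V) N :
  (forall x, x \in s -> a x -> exists2 k, (k < N)%N & q k x) ->
  (count a s <= \sum_(k < N) count (q k) s)%N.
Proof.
elim: s => [|x s IHs] aq; first by rewrite big1.
rewrite /= big_split/=; apply: leq_add; last first.
  by apply: IHs => y ys; apply: aq; rewrite inE ys orbT.
case: (boolP (a x)) => //= ax; have [|k kN qx] := aq x _ ax; first by rewrite mem_head.
by rewrite (bigD1 (Ordinal kN))//= qx.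
Qed.

Lemma word_iter_clopen (I : pzSemiRingType) (B : alphabetType) (e : nat -> I)
  (e_surj : forall i, exists k, e k = i) n d (w : n.-tuple B) :
  clopen [set y : fullshift I B | word n (iter d sigma y) = w].
Proof.
have H : forall m (C : set (fullshift I B)), clopen C -> clopen (iter m sigma @^-1` C).
  elim=> [//|m IHm] C cC; rewrite (_ : _ @^-1` C = iter m sigma @^-1` (sigma @^-1` C))//.
  by apply: IHm; apply: preimage_clopen => //; exact: sigma_continuous.
exact: (H d _ (word_clopen e_surj [set w])).
Qed.

(** * Transient words *)

Section Recurrence.
Context {R : realType} {I : pzSemiRingType} {B : alphabetType}.
Variable e : nat -> I.
Hypothesis e_surj : forall i, exists k, e k = i.
Local Notation T := (fullshift I B).
Variable Y : set T.
Hypothesis cY : closed Y.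
Hypothesis sY : sigma @` Y `<=` Y.

(* The occurrences of [w] in a point of [Y] lie within a bounded distance, so by
   Poincare recurrence [w] has measure zero for every invariant measure. *)
Definition transient n (w : n.-tuple B) := exists K, forall y, Y y ->
  word n y = w -> forall k, (K <= k)%N -> word n (iter k sigma y) <> w.

Lemma transient_null (m : probability (borel T) R) n (w : n.-tuple B) :
  invariant_probability sigma Y m -> transient w ->
  pr m ((word n : borel T -> _) @^-1` [set w]) = 0.
Proof.
move=> [mY m_inv] [K wK].
have mYm := closed_borel cY.
have mw := mrv_word (B := B) e_surj (n := n) w.
have mS := @sigma_measurable I B.
(* By transience these preimages under multiples of [K.+1] steps are disjoint; all have the measure
   of the cylinder of [w], which must therefore vanish. *)
pose F (j : nat) : set (borel T) :=
  Y `&` (iter (j * K.+1) (@sigma I B) @^-1` ((word n : borel T -> _) @^-1` [set w])).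
have mi j := measurable_iter (T := borel T) (f := @sigma I B) mS j mw.
have mF j : measurable (F j) by apply: measurableI => //; exact: mi.
have mYC : m (~` Y) = 0%E.
  rewrite prE; last exact: measurableC.
  by rewrite prC// /pr mY /= subrr.
have prF j : pr m (F j) = pr m ((word n : borel T -> _) @^-1` [set w]).
  rewrite -(pr_iter (T := borel T) (f := @sigma I B) mS m_inv (j * K.+1) mw).
  rewrite /F setIC /pr; congr fine.
  by apply: measure_setI_conull => //; exact: mi.
have tF i j (x : borel T) : F i x -> F j x -> i = j.
  have key (i' j' : nat) : F i' x -> F j' x -> (i' < j')%N -> False.
    move=> [Yx xi] [_ xj] ij.
    apply: (wK _ (iter_sigma_in sY (i' * K.+1) Yx) xi ((j' - i') * K.+1)%N).
      by apply: leq_trans (leqnSn K) _; rewrite leq_pmull// subn_gt0.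
    by rewrite -iterD -mulnDl subnK// ltnW.
  move=> Fi Fj; case: (ltngtP i j) => // ij; first by case: (key _ _ Fi Fj ij).
  by case: (key _ _ Fj Fi ij).
set p := pr m _ in prF *; apply/eqP; rewrite eq_le pr_ge0 andbT leNgt; apply/negP => p0.
have [N HN] := eventually_nat_ge (2 / p).
have [mU sU] := pr_sum_seq m (iota_uniq 0 N.+1) mF tF.
have : pr m [set x | exists2 j, j \in iota 0 N.+1 & F j x] <= 1 by exact: pr_le1.
rewrite sU; under eq_bigr do rewrite prF.
rewrite big_const_seq count_predT size_iota iter_addr_0 -mulr_natl.
have := HN _ (leqnSn N); rewrite ler_pdivrMr//; lra.
Qed.

End Recurrence.

(** * Gibbs bounds *)

Section CodedGibbs.
Context {R : realType} {I : pzSemiRingType} {A B : alphabetType}.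
Variable e : nat -> I.
Hypothesis e_surj : forall i, exists k, e k = i.
Hypothesis forward : forall i : I, exists N j : nat, i + N%:R = j%:R.
Local Notation T := (fullshift I B).
Variable Y : set T.
Hypothesis Y0 : Y !=set0.
Hypothesis cY : closed Y.
Hypothesis sY : sigma @` Y `<=` Y.
Variables (r : nat) (f : seq A -> B) (G : set (seq A)) (cp cs : nat -> seq A).
Local Notation Phi := (block_code r f).
Hypothesis G0 : G [::].
Hypothesis GD : forall g g', G g -> G g' -> G (g ++ g').
Hypothesis size_cp : forall n, size (cp n) = n.
Hypothesis size_cs : forall n, size (cs n) = n.
Local Notation decomposed := (@decomposed A B r f G cp cs).
Hypothesis Y_dec : forall y n, Y y -> exists i j, decomposed (word n y) i j.
Definition coded_periodic g (y : T) := [/\ Y y, iter (size g) sigma y = y &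
    forall k n, (n + r <= k * size g)%N ->
      tval (word n y) = take n (Phi (flatten (nseq k g)))].
Hypothesis Y_per : forall g, G g -> g != [::] -> exists y, coded_periodic g y.
Variable h : R.
Hypothesis hpos : 0 < h.
Hypothesis h_le : forall n, n%:R * h <= ln #|lang Y n|%:R.
Hypothesis h_lim : forall eps, 0 < eps -> exists N, forall n, (N <= n)%N ->
  ln #|lang Y n|%:R <= n%:R * (h + eps).

Let lam := expR h.
Let lam_gt1 : 1 < lam. Proof. by rewrite /lam -expR0 ltr_expR. Qed.
Let lam0 : 0 < lam. Proof. exact: expR_gt0. Qed.
Let lamX0 n : 0 < lam ^+ n. Proof. by rewrite exprn_gt0. Qed.

Lemma coded_periodic_nth g y p b s i : coded_periodic g y -> g = p ++ b ++ s ->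
  (i < size b - r)%N -> y (size p + i)%:R = nth point (Phi b) i.
Proof.
move=> [_ _ yg] gE ib; pose n := (size p + i).+1.
have sg : (size p + size b <= size g)%N by rewrite gE !size_cat; lia.
have := yg r.+1 n; rewrite /n mulSn => /(_ _)/(congr1 (fun t => nth point t (size p + i))) H.
have lt : (size p + i < (size p + i).+1)%N by [].
rewrite -(tnth_word _ (Ordinal lt)) (tnth_nth point) /= H; last first.
  by apply: leq_add; [lia|rewrite leq_pmulr//; lia].
rewrite nth_take// (_ : flatten (nseq r.+1 g) = p ++ b ++ (s ++ flatten (nseq r g))).
  exact: nth_block_code_sub.
by rewrite /= {1}gE -!catA.
Qed.

Let langC : exists2 C : R, 1 <= C & forall n, #|lang Y n|%:R <= C * lam ^+ n.
Proof.
have := card_lang_le (R := R) Y0 G0 GD size_cp size_cs Y_dec Y_per (ltW hpos) h_lim hpos.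
set C := _ / _ => HC; exists C; last exact: HC.
have := le_trans (lam_le_card Y0 h_le 0) (HC 0%N).
by rewrite !expr0 mulr1.
Qed.

(* If [n h <= H(alpha^n) <= a ln #D + (1 - a) ln (C lam^n) + 2], where [a] is the
   measure of [D], then [#D] cannot be small. *)
Lemma mme_card : exists2 K : R, 0 <= K &
  forall (m : probability (borel T) R) n (D : {set n.-tuple B}),
  m Y = 1%E -> n%:R * h <= word_entropy m n ->
  0 < pr m [set y : borel T | word n y \in D] ->
  lam ^+ n * expR (- (K / pr m [set y : borel T | word n y \in D])) <= #|D|%:R.
Proof.
have [C C1 HC] := langC; exists (ln C + 2); first by rewrite addr_ge0// ln_ge0.
move=> m n D mY mn a0; set a := pr m _ in a0 *.
have mW := mrv_word (B := B) e_surj (n := n).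
pose p w := pr m ((word n : borel T -> _) @^-1` [set w]).
have aE : a = \sum_(w in D) p w by rewrite /a; have [_ ->] := mrv_preimage m D mW.
have a1 : a <= 1 by apply: pr_le1; have [] := mrv_preimage m D mW.
pose D' : {set n.-tuple B} := (lang Y n :\: D)%SET.
have p_lang w : w \notin lang Y n -> p w = 0.
  move=> wl; apply/eqP; rewrite eq_le pr_ge0 andbT.
  have -> : 0 = pr m (~` Y) by rewrite prC ?/pr ?mY ?subrr//; exact: closed_borel.
  apply: le_pr; [exact: mW|by apply: measurableC; exact: closed_borel|].
  by move=> y /= yw Yy; move: wl; rewrite -yw word_lang.
have sumD (q : n.-tuple B -> R) : (forall w, p w = 0 -> q w = 0) ->
    \sum_w q w = \sum_(w in D) q w + \sum_(w in D') q w.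
  move=> q0; rewrite (bigID (mem D))/=; congr (_ + _).
  rewrite [LHS](bigID (mem (lang Y n)))/= [X in _ + X]big1 ?addr0; last first.
    by move=> w /andP[_ /p_lang /q0].
  by apply: eq_bigl => w; rewrite finset.in_setD.
have p1 : a + \sum_(w in D') p w = 1.
  by rewrite aE -(mrv_sum1 m mW) [RHS]sumD.
have H1 := @sum_eta_le R _ D p (fun w => pr_ge0 _ _).
have H2 := @sum_eta_le R _ D' p (fun w => pr_ge0 _ _).
have : word_entropy m n <= a * ln #|D|%:R + eta a + ((1 - a) * ln #|D'|%:R + eta (1 - a)).
  rewrite /word_entropy /entropy sumD; last by move=> w; rewrite /p => ->; exact: eta0.
  have E : \sum_(w in D') p w = 1 - a by rewrite -p1; lra.
  by rewrite -aE in H1; rewrite E in H2; apply: lerD.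
have eta1 : eta a <= 1 by have := eta_le1B (ltW a0); lra.
have eta2 : eta (1 - a) <= 1.
  have a10 : 0 <= 1 - a by lra.
  by have := eta_le1B a10; lra.
have C0 : 0 < C by lra.
have lnD' : ln #|D'|%:R <= ln C + n%:R * h.
  have [->|D0] := posnP #|D'|.
    by rewrite ln0// addr_ge0 ?ln_ge0// mulr_ge0// ltW.
  have -> : ln C + n%:R * h = ln (C * lam ^+ n).
    by rewrite lnM ?posrE//; congr (_ + _); rewrite (lamX h n) expRK.
  rewrite ler_ln ?posrE ?ltr0n ?mulr_gt0//; apply: le_trans (HC n).
  by rewrite ler_nat; apply: subset_leq_card; exact: finset.subsetDl.
have H3 : (1 - a) * ln #|D'|%:R <= (1 - a) * (ln C + n%:R * h).
  by rewrite ler_wpM2l// subr_ge0.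
have lnC0 : 0 <= ln C by rewrite ln_ge0.
have H4 : (1 - a) * ln C <= ln C by rewrite ler_piMl//; lra.
move=> H5; have key : a * (n%:R * h) <= a * ln #|D|%:R + (ln C + 2).
  have : (1 - a) * (ln C + n%:R * h) = (1 - a) * ln C + n%:R * h - a * (n%:R * h) by ring.
  lra.
have D0 : (0 < #|D|)%N.
  rewrite lt0n; apply/negP => /eqP D0; move: a0; rewrite aE.
  have -> : D = finset.set0 by apply/eqP; rewrite -cards_eq0 D0.
  by rewrite big_set0 ltxx.
have DR : (0 : R) < #|D|%:R by rewrite ltr0n.
rewrite (lamX h n) -expRD -[leRHS]lnK ?posrE// ler_expR.
rewrite -(ler_pM2l a0) mulrBr [a * (_ / a)]mulrC divfK ?gt_eqF//; lra.
Qed.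

(** Different images of cores of one length [m] begin different periodic points. It is enough to
    have [m] between [N - W] and [N], because [Per] collects all periods up to [N]. *)
Lemma card_per_ge : exists2 c : R, 0 < c &
  \forall N \near \oo, c * lam ^+ N <= (size (per_seq Y N))%:R.
Proof.
have [c [W [c0 HW]]] := card_good_ge (R := R) Y0 G0 GD size_cp size_cs Y_dec Y_per
  (ltW hpos) h_le h_lim hpos.
exists c => //; exists W.+1 => // N /= WN.
have [m [Nm mN cm]] := HW N (ltnW WN).
apply: le_trans cm _; rewrite ler_nat.
apply: (card_le_size (S := fun w y => tval w = take (m - r) (tval (word m y)))); last first.
  by move=> u u' y uy u'y; apply: val_inj; rewrite /= uy.
move=> w /goodP[g [Gg sg gw]].
have [|y yg] := Y_per Gg; first by rewrite -size_eq0 sg; lia.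
exists y.
  have [Yy yk _] := yg; apply/(per_seqP forward); split => //.
  by exists m; rewrite -sg yk; split => //; apply/andP; split; lia.
have [_ _ H] := yg; have := H r.+1 m; rewrite sg => ->; last first.
  by rewrite mulSn leq_add2l leq_pmulr//; lia.
rewrite take_takel ?leq_subr//= -gw -[in LHS](block_code_take r f g (flatten (nseq r g))).
by rewrite sg.
Qed.

(** The word read after [w] completes the period. For a period of at most [n] the truncated length
    is [0]: then [w] alone determines the point. *)
Lemma count_per_le n (w : n.-tuple B) N :
  (count (fun y => word n y == w) (per_seq Y N) <= \sum_(k < N) #|lang Y (k.+1 - n)|)%N.
Proof.
pose q k (y : T) := `[< word n y = w /\ iter k.+1 sigma y = y >].
apply: (@leq_trans (\sum_(k < N) count (q k) (per_seq Y N))).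
  apply: count_le_sum => y /(per_seqP forward)[Yy [k [/andP[k0 kN] yk]]] /eqP yw.
  exists k.-1; first by lia.
  by rewrite /q prednK//; apply/asboolP.
apply: leq_sum => k _; rewrite -size_filter.
apply: (size_le_card (S := fun u y => word (k.+1 - n) (iter n sigma y) = u)).
- by rewrite filter_uniq// uniq_per_seq.
- move=> y; rewrite mem_filter => /andP[_ /(per_seqP forward)[Yy _]].
  by exists (word (k.+1 - n) (iter n sigma y)) => //; apply: word_lang; exact: iter_sigma_in.
- move=> u y y'; rewrite !mem_filter => /andP[/asboolP[yw yk] _] /andP[/asboolP[yw' yk'] _] yu yu'.
  apply: (periodic_ext forward (k := k.+1) (N := 0%N)) => //; apply/word_eqP => i ik /=.
  have [lt|ge] := ltnP i n.
    by have /word_eqP := etrans yw (esym yw'); apply.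
  have /word_eqP/(_ (i - n)%N) := etrans yu (esym yu').
  by rewrite !iter_sigmaE -natrD subnK//; apply; lia.
Qed.

(** The sum of the powers of [lam^-1]. In [sum_lam] the separate summand [n] stems from the periods
    up to [n], each contributing [1]. *)
Let Dl := (1 - lam^-1)^-1.
Let lamV1 : lam^-1 < 1. Proof. by rewrite invf_lt1. Qed.
Let Dl1 : 1 <= Dl.
Proof.
rewrite /Dl -[leLHS]invr1 lef_pV2 ?posrE//; last by rewrite subr_gt0.
by rewrite gerBl invr_ge0 ltW.
Qed.

Let sum_lam n N : (n <= N)%N ->
  \sum_(k < N) lam ^+ (k.+1 - n) <= n%:R + Dl * lam ^+ (N - n).
Proof.
move=> nN; rewrite -(subnK nN); elim: (N - n)%N => [|d IHd].
  rewrite add0n subnn expr0 mulr1; apply: (@le_trans _ _ n%:R); last first.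
    by rewrite lerDl; have := Dl1; lra.
  rewrite (eq_bigr (fun=> 1)) => [|k _]; last first.
    by rewrite (_ : (k.+1 - n = 0)%N) ?expr0//; have := ltn_ord k; lia.
  by rewrite sumr_const card_ord.
rewrite addSn big_ord_recr/=; apply: le_trans (lerD IHd (lexx _)) _.
rewrite addnK -addSn addnK -addrA lerD2l exprS.
have D0 : 1 - lam^-1 != 0 by rewrite gt_eqF// subr_gt0.
have l0 : lam != 0 by rewrite gt_eqF.
have E : lam = Dl * (lam - 1).
  have -> : lam - 1 = lam * (1 - lam^-1) by rewrite mulrBr mulr1 divff.
  by rewrite mulrCA /Dl mulVf ?mulr1.
have : lam * lam ^+ d = Dl * (lam - 1) * lam ^+ d by rewrite -E.
lra.
Qed.

Let lam_large (x : R) : \forall N \near \oo, x <= lam ^+ N.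
Proof.
have [N HN] := eventually_nat_ge (x / h).
exists N => // n /= Nn; have := HN n Nn; rewrite ler_pdivrMr// => H.
apply: le_trans H _; rewrite (lamX h n); apply: le_trans (expR_ge1Dx _); lra.
Qed.

(* A periodic orbit through [w] determines a word of [Y] on the rest of its period,
   of which there are at most [C lam^(N-n)]. *)
Lemma gibbs_upper : exists2 C : R, 1 <= C & forall n (w : n.-tuple B),
  \forall N \near \oo, @per_ratio R I B Y N [set y | word n y = w] <= C / lam ^+ n.
Proof.
have [c c0 Hc] := card_per_ge; have [C C1 HC] := langC.
pose C' := C * (Dl + Dl) / c + 1.
have C0 : 0 < C by lra.
exists C'.
  by rewrite lerDr divr_ge0 ?mulr_ge0//; have := Dl1; lra.
move=> n w; near=> N.
have Nc : c * lam ^+ N <= (size (per_seq Y N))%:R by near: N; exact: Hc.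
have nN : (n <= N)%N by near: N; exists n.
(* [N] is so large that the [n] short periods weigh no more than [lam ^+ (N - n)]. *)
have Nl : n%:R * lam ^+ n <= lam ^+ N by near: N; exact: lam_large.
have s0 : (0 : R) < (size (per_seq Y N))%:R by apply: lt_le_trans Nc; rewrite mulr_gt0.
rewrite /per_ratio ler_pdivrMr//.
have cnt : (count (fun y => `[< [set y | word n y = w] y >]) (per_seq Y N))%:R <=
    C * (n%:R + Dl * lam ^+ (N - n)).
  rewrite (eq_count (a2 := fun y => word n y == w)); last first.
    by move=> y; apply/asboolP/eqP.
  apply: (@le_trans _ _ (\sum_(k < N) C * lam ^+ (k.+1 - n))).
    have := count_per_le w N; rewrite -(ler_nat R) natr_sum => /le_trans; apply.
    by apply: ler_sum => k _; exact: HC.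
  by rewrite -mulr_sumr ler_wpM2l ?sum_lam// ltW.
apply: le_trans cnt _.
have nl : n%:R <= lam ^+ (N - n).
  by rewrite -(ler_pM2r (lamX0 n)) -exprD subnK.
have Dn : n%:R <= Dl * lam ^+ (N - n).
  by apply: le_trans nl _; rewrite ler_peMl// ltW.
apply: (@le_trans _ _ (C * (Dl + Dl) * lam ^+ (N - n))).
  have H : n%:R + Dl * lam ^+ (N - n) <= (Dl + Dl) * lam ^+ (N - n).
    by rewrite mulrDl lerD2r.
  by rewrite -mulrA ler_wpM2l//; exact: ltW.
apply: (@le_trans _ _ (C * (Dl + Dl) / c / lam ^+ n * (c * lam ^+ N))).
  have -> : lam ^+ N = lam ^+ (N - n) * lam ^+ n by rewrite -exprD subnK.
  have l0 : lam ^+ n != 0 by rewrite gt_eqF.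
  have c00 : c != 0 by rewrite gt_eqF.
  rewrite (_ : _ / c / _ * _ = C * (Dl + Dl) * lam ^+ (N - n))//.
  by field; rewrite c00 l0.
apply: ler_pM => //.
- by rewrite !divr_ge0 ?mulr_ge0 ?(ltW (lamX0 _))//; have := Dl1; lra.
- by rewrite mulr_ge0// ltW.
by rewrite ler_wpM2r /C' ?lerDl// invr_ge0 ltW.
Unshelve. all: by end_near. Qed.

(** [b] is a preimage of [u] inside a core. The bound [t] on the completions does not depend on [n],
    which makes the range of the gaps beyond [n] and the constant of [gibbs_lower] uniform. *)
Definition framed t n (u : n.-tuple B) := exists a b c : seq A,
  [/\ (size a <= t)%N, (size c <= t)%N, size b = (n + r)%N, G (a ++ b ++ c)
    & tval u = Phi b].

(* If [u] and [v] are framed in cores [g] and [g'], then every [g ++ g' ++ z] with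
   [G z] codes a periodic point through both of them. *)
Lemma gibbs_lower t : exists2 c : R, 0 < c & forall n (u v : n.-tuple B),
  (0 < n)%N -> framed t u -> framed t v -> exists2 d, (d <= n + r + 2 * t)%N /\ (n + r <= d)%N &
  \forall N \near \oo, c / lam ^+ (2 * n) <=
    @per_ratio R I B Y N ([set y | word n y = u] `&`
      [set y | word n (iter d sigma y) = v]).
Proof.
have [C C1 HC] := langC.
have [c [W [c0 HW]]] := card_good_ge (R := R) Y0 G0 GD size_cp size_cs Y_dec Y_per
  (ltW hpos) h_le h_lim hpos.
have C0 : 0 < C by lra.
have Dl0 : 0 < Dl by have := Dl1; lra.
(* Besides [2 * n] letters for [u] and [v], the two cores contain [2 * r] letters for the windows
   and four completions of at most [t] letters. *)
pose L0 := (2 * r + 4 * t)%N.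
exists (c / (C * Dl) / lam ^+ L0).
  by apply: divr_gt0 => //; apply: divr_gt0 => //; exact: mulr_gt0.
move=> n u v n0 [a [b [a' [sa sa' sb Gu ub]]]] [d [b' [d' [sd sd' sb' Gv vb]]]].
exists (size (b ++ a' ++ d)); first by rewrite !size_cat sb; move: sa' sd; clear; split; lia.
set dd := size (b ++ a' ++ d).
pose L := size ((a ++ b ++ a') ++ (d ++ b' ++ d')).
have Lle : (L <= 2 * n + L0)%N by rewrite /L /L0 !size_cat sb sb'; move: sa sa' sd sd'; clear; lia.
have Lpos : (0 < L)%N by rewrite /L !size_cat sb; move: n0; clear; lia.
near=> N.
have NL : (L + W <= N)%N by near: N; exists (L + W)%N.
(* Every point begins with the empty word, so the count of occurrences also bounds the number of all
   periodic points. *)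
have cntC : (size (per_seq Y N))%:R <= C * Dl * lam ^+ N.
  have := count_per_le [tuple] N; rewrite (eq_count (a2 := xpredT)); last first.
    by move=> y /=; apply/eqP; apply: val_inj; exact: size0nil (size_tuple _).
  rewrite count_predT -(ler_nat R) natr_sum => /le_trans; apply.
  apply: (@le_trans _ _ (\sum_(k < N) C * lam ^+ (k.+1 - 0))).
    by apply: ler_sum => k _; exact: HC.
  rewrite -mulr_sumr -mulrA ler_wpM2l ?(ltW C0)//.
  by have := sum_lam (leq0n N); rewrite add0r subn0.
have [|m [Nm mN cm]] := HW (N - L)%N; first by move: NL; clear; lia.
have cnt : (#|good r f G m| <= count (fun y => `[< ([set y | word n y = u] `&`
      [set y | word n (iter dd sigma y) = v]) y >]) (per_seq Y N))%N.
  rewrite -size_filter.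
  (* The periodic point is shifted by [size a], so that [u] occurs at [0] and [v] at [dd]; the image
     of [z] is then read from [L - size a] on and distinguishes the points. *)
  apply: (card_le_size (S := fun w (y : T) =>
    forall i : 'I_(m - r), tnth w i = y (L - size a + i)%:R)); last first.
    by move=> w w' y wy w'y; apply: eq_from_tnth => i; rewrite wy w'y.
  move=> w /goodP[z [Gz sz zw]].
  pose g := (a ++ b ++ a') ++ (d ++ b' ++ d') ++ z.
  have Gg : G g by apply: GD => //; exact: GD.
  have sgL : size g = (L + m)%N by rewrite /g catA size_cat sz.
  have [|y yg] := Y_per Gg; first by rewrite -size_eq0 sgL; move: Lpos; clear; lia.
  have [Yy yk _] := yg.
  have aL : (size a <= L)%N by rewrite /L !size_cat; clear; lia.
  exists (iter (size a) sigma y); last first.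
    move=> i; rewrite iter_sigmaE -natrD (_ : (_ + size a = L + i)%N); last by move: aL; clear; lia.
    rewrite (coded_periodic_nth (p := (a ++ b ++ a') ++ (d ++ b' ++ d')) (b := z) (s := [::]) yg).
    - by rewrite zw (tnth_nth point).
    - by rewrite /g cats0 catA.
    - by rewrite sz.
  rewrite mem_filter; apply/andP; split; last first.
    apply/(per_seqP forward); split; first exact: iter_sigma_in.
    exists (size g); split; first by rewrite sgL; move: Lpos NL mN; clear; move=> *; apply/andP; split; lia.
    by rewrite -iterD addnC iterD yk.
  apply/asboolP; split; apply: eq_from_tnth => i; rewrite tnth_word iter_sigmaE.
    rewrite -natrD addnC (coded_periodic_nth (p := a) (b := b) (s := a' ++ (d ++ b' ++ d') ++ z) yg).
    - by rewrite -ub (tnth_nth point).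
    - by rewrite /g -!catA.
    - by rewrite sb addnK.
  rewrite iter_sigmaE -!natrD.
  have -> : (i + dd + size a = size (a ++ b ++ a' ++ d) + i)%N.
    by rewrite /dd !size_cat; clear; lia.
  rewrite (coded_periodic_nth (p := a ++ b ++ a' ++ d) (b := b') (s := d' ++ z) yg).
  - by rewrite -vb (tnth_nth point).
  - by rewrite /g -!catA.
  - by rewrite sb' addnK.
have g0 : 0 < c * lam ^+ (N - L) by rewrite mulr_gt0.
have s0 : (0 : R) < (size (per_seq Y N))%:R.
  rewrite ltr0n; apply: leq_trans (count_size _ _); apply: leq_trans cnt.
  by rewrite -(ltr0n R); apply: lt_le_trans cm.
rewrite /per_ratio ler_pdivlMr//.
rewrite -(ler_nat R) in cnt; apply: le_trans cnt; apply: le_trans cm.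
apply: (@le_trans _ _ (c / (C * Dl) / lam ^+ L0 / lam ^+ (2 * n) * (C * Dl * lam ^+ N))).
  have CDl : 0 < C * Dl by rewrite mulr_gt0.
  rewrite ler_wpM2l//; apply: divr_ge0; last exact: (ltW (lamX0 _)).
  apply: divr_ge0; last exact: (ltW (lamX0 _)).
  by apply: divr_ge0; exact: ltW.
have -> : c / (C * Dl) / lam ^+ L0 / lam ^+ (2 * n) * (C * Dl * lam ^+ N) =
    c * (lam ^+ N / (lam ^+ L0 * lam ^+ (2 * n))).
  have fE (x y z s q p : R) : s != 0 -> q != 0 -> y != 0 -> z != 0 ->
      x / (y * z) / s / q * (y * z * p) = x * (p / (s * q)).
    by move=> s0' q0 y0 z0; field; rewrite s0' q0 y0 z0.
  have l1 : lam ^+ L0 != 0 by rewrite gt_eqF.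
  have l2 : lam ^+ (2 * n) != 0 by rewrite gt_eqF.
  have l3 : C != 0 by rewrite gt_eqF.
  have l4 : Dl != 0 by rewrite gt_eqF.
  by rewrite fE.
rewrite ler_wpM2l ?(ltW c0)// ler_pdivrMr ?mulr_gt0// -!exprD.
rewrite ler_weXn2l ?(ltW lam_gt1)//; by move: NL Lle; clear; lia.
Unshelve. all: by end_near. Qed.

End CodedGibbs.

(** * Uniqueness of the measure of maximal entropy *)

(* If [P] is a Hahn positive set of the invariant charge [nu - m], then
   [P `\` f^-k P] is null for this charge, and [\bigcap_k f^-k P] is the set
   that we want. *)
Lemma forward_invariant_gt d (T : measurableType d) (R : realType) (f : T -> T)
  (m nu : probability T R) (A0 : set T) :
  (forall A, measurable A -> measurable (f @^-1` A)) ->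
  (forall A, measurable A -> m (f @^-1` A) = m A) ->
  (forall A, measurable A -> nu (f @^-1` A) = nu A) ->
  measurable A0 -> pr m A0 < pr nu A0 ->
  exists A, [/\ measurable A, A `<=` f @^-1` A & pr m A < pr nu A].
Proof.
move=> mf m_inv nu_inv mA0 A0lt.
have [P [mP pos neg]] : exists P, [/\ measurable P,
    forall S, measurable S -> S `<=` P -> pr m S <= pr nu S &
    forall S, measurable S -> S `<=` ~` P -> pr nu S <= pr m S].
  have [P [N [[mP posP] [mN negN] PN PN0]]] := Hahn_decomposition
    (cadd (charge_of_finite_measure nu) (copp (charge_of_finite_measure m))).
  have NP : ~` P = N.
    apply/seteqP; split=> [x nPx|x Nx Px]; last by rewrite -[False]/(set0 x) -PN0.
    by have : [set: T] x by []; rewrite -PN => -[].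
  exists P; split=> // S mS.
    move=> SP; have : (0 <= nu S - m S)%E := posP S mS SP.
    by rewrite !prE// -EFinB lee_fin subr_ge0.
  rewrite NP => SN; have : (nu S - m S <= 0)%E := negN S mS SN.
  by rewrite !prE// -EFinB lee_fin subr_le0.
have Plt : pr m P < pr nu P.
  have mD := measurableD mA0 mP; have mI := measurableI _ _ mA0 mP.
  have mD' := measurableD mP mA0; have mI' := measurableI _ _ mP mA0.
  have := neg _ mD (fun x => @proj2 _ _); have := pos _ mD' (fun x => @proj1 _ _).
  move: A0lt; rewrite (prDI m mA0 mP) (prDI nu mA0 mP) (prDI m mP mA0) (prDI nu mP mA0).
  by rewrite (setIC P A0); lra.
have mi k := measurable_iter mf k mP.
(* [P] and its preimage [Q] have the same charge, hence so have [P \ Q] and [Q \ P]. The first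
   charge is at least [0], the second at most [0], so both vanish; by positivity on [P] so does the
   charge of every part of [P \ Q]. *)
have eqP' k S : measurable S -> S `<=` P `\` (iter k f @^-1` P) -> pr nu S = pr m S.
  move=> mS SP; set Q := _ @^-1` P in SP.
  have mQ : measurable Q := mi k.
  have mPQ := measurableD mP mQ; have mQP := measurableD mQ mP.
  have e1 : pr nu Q = pr nu P := pr_iter mf nu_inv k mP.
  have e2 : pr m Q = pr m P := pr_iter mf m_inv k mP.
  have := neg _ mQP (fun x => @proj2 _ _).
  have p1 := pos S mS (subset_trans SP (fun x => @proj1 _ _)).
  have mPS := measurableD mPQ mS.
  have := pos _ mPS (fun x H => proj1 (proj1 H)).
  have := prDI m mPQ mS; have := prDI nu mPQ mS.
  rewrite (setIC _ S) (setIidl SP).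
  move: e1 e2; rewrite (prDI nu mP mQ) (prDI m mP mQ) (prDI nu mQ mP) (prDI m mQ mP) (setIC Q P).
  by move: p1; lra.
pose F n := [set x | forall k, (k <= n)%N -> P (iter k f x)].
have FS n : F n.+1 = F n `&` (iter n.+1 f @^-1` P).
  apply/seteqP; split=> [x Fx|x [Fx Px] k].
    by split=> [k kn|]; apply: Fx; rewrite ?leqnn// (leq_trans kn).
  by rewrite leq_eqVlt => /predU1P[->//|]; rewrite ltnS; exact: Fx.
have F0 : F 0%N = P.
  by apply/seteqP; split=> [x /(_ 0%N (leqnn _))//|x Px k]; rewrite leqn0 => /eqP ->.
have mF n : measurable (F n).
  by elim: n => [|n IHn]; rewrite ?F0// FS; apply: measurableI.
have dF n : pr nu (F n) - pr m (F n) = pr nu P - pr m P.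
  elim: n => [|n IHn]; first by rewrite F0.
  rewrite -IHn (prDI nu (mF n) (mi n.+1)) (prDI m (mF n) (mi n.+1)) -FS.
  rewrite (eqP' n.+1 (F n `\` iter n.+1 f @^-1` P)); first by lra.
    exact: measurableD.
  by move=> x [/(_ 0%N (leq0n n)) /= Px nPx]; split.
have mA : measurable (\bigcap_n F n) by apply: bigcapT_measurable.
exists (\bigcap_n F n); split=> //.
  by move=> x Fx n _ k kn; have /(_ k.+1 kn) := Fx n.+1 Logic.I; rewrite iterSr.
have prF (mu : probability T R) : pr mu (F n) @[n --> \oo] --> pr mu (\bigcap_n F n).
  have : mu (F n) @[n --> \oo] --> (pr mu (\bigcap_n F n))%:E.
    rewrite -prE//; apply: nonincreasing_cvg_mu => //.
      exact: le_lt_trans (probability_le1 mu (mF 0%N)) (ltry _).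
    by apply/nonincreasing_seqP => n; apply/subsetPset; rewrite FS; exact: subIsetl.
  by move=> /fine_cvg.
have : pr nu (\bigcap_n F n) - pr m (\bigcap_n F n) = pr nu P - pr m P.
  have H : (fun n => pr nu (F n) - pr m (F n)) @ \oo -->
      pr nu (\bigcap_n F n) - pr m (\bigcap_n F n) by apply: cvgB; exact: prF.
  rewrite (_ : (fun n => _) = fun=> pr nu P - pr m P) in H; last exact/funext.
  by move: H => /cvg_lim <- //; rewrite lim_cst.
by move: Plt; lra.
Qed.

Section MaximalEntropy.
Context {R : realType} {I : pzSemiRingType} {A B : alphabetType}.
Variable e : nat -> I.
Hypothesis e_surj : forall i, exists k, e k = i.
Hypothesis forward : forall i : I, exists N j : nat, i + N%:R = j%:R.
Local Notation T := (fullshift I B).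
Variable Y : set T.
Hypothesis Y0 : Y !=set0.
Hypothesis cY : closed Y.
Hypothesis sY : sigma @` Y `<=` Y.
Variables (r : nat) (f : seq A -> B) (G : set (seq A)) (cp cs : nat -> seq A).
Local Notation Phi := (block_code r f).
Hypothesis G0 : G [::].
Hypothesis GD : forall g g', G g -> G g' -> G (g ++ g').
Hypothesis size_cp : forall n, size (cp n) = n.
Hypothesis size_cs : forall n, size (cs n) = n.
Local Notation decomposed := (@decomposed A B r f G cp cs).
Hypothesis Y_dec : forall y n, Y y -> exists i j, decomposed (word n y) i j.
Hypothesis Y_per : forall g, G g -> g != [::] ->
  exists y, coded_periodic Y r f g y.

Definition extendable n (v : n.-tuple B) := exists i j g p s,
  [/\ G g, G (p ++ cp i), G (cs j ++ s),
    size (cp i ++ g ++ cs j) = (n + r)%N & tval v = Phi (cp i ++ g ++ cs j)].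
Hypothesis Y_ext : forall y n, Y y ->
  extendable (word n y) \/ transient Y (word n y).

Variable h : R.
Hypothesis hpos : 0 < h.
Hypothesis h_le : forall n, n%:R * h <= ln #|lang Y n|%:R.
Hypothesis h_lim : forall eps, 0 < eps -> exists N, forall n, (N <= n)%N ->
  ln #|lang Y n|%:R <= n%:R * (h + eps).
Let lam := expR h.
Let lam0 : 0 < lam. Proof. exact: expR_gt0. Qed.
Let lamX0 n : 0 < lam ^+ n. Proof. by rewrite exprn_gt0. Qed.
Let topE : topological_entropy R (@sigma I B) Y = h%:E.
Proof. exact: (topological_entropyE e_surj forward Y0 cY sY (ltW hpos)). Qed.

Let bounded_choice (E : nat -> set (seq A)) M : exists t, forall i, (i < M)%N ->
  E i !=set0 -> exists2 p, (size p <= t)%N & E i p.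
Proof.
elim: M => [|M [t IH]]; first by exists 0%N.
have [[p Ep]|nE] := pselect (E M !=set0); last first.
  by exists t => i; rewrite ltnS leq_eqVlt => /predU1P[-> /nE//|]; exact: IH.
exists (maxn t (size p)) => i; rewrite ltnS leq_eqVlt => /predU1P[-> _|iM /(IH i iM)[q qt Eq]].
  by exists p => //; exact: leq_maxr.
by exists q => //; apply: leq_trans qt _; exact: leq_maxl.
Qed.

(** Outside the tail set only finitely many prefixes and suffixes occur, so one completion of each
    yields a common bound [t]. *)
Lemma extendable_framed M : exists t, forall n (v : n.-tuple B),
  extendable v -> v \notin tail_set r f G cp cs n M -> framed r f G t v.
Proof.
have [t1 H1] := bounded_choice (fun i => [set p | G (p ++ cp i)]) M.
have [t2 H2] := bounded_choice (fun j => [set s | G (cs j ++ s)]) M.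
exists (maxn t1 t2) => n v [i [j [g [p [s [Gg Gp Gs sz vE]]]]]].
rewrite inE => /asboolP nT.
have ijM : (i + j < M)%N.
  by rewrite ltnNge; apply/negP => ijM; apply: nT; exists i, j; split=> //; exists g.
have [|p' pt Gp'] := H1 i (leq_ltn_trans (leq_addr _ _) ijM); first by exists p.
have [|s' st Gs'] := H2 j (leq_ltn_trans (leq_addl _ _) ijM); first by exists s.
exists p', (cp i ++ g ++ cs j), s'; split=> //.
- by rewrite leq_max pt.
- by rewrite leq_max st orbT.
rewrite -!catA catA; apply: GD => //; exact: GD.
Qed.

(** Transient words are null and may be dropped from [D]; by [mme_card] at least [k * lam ^+ n]
    words remain, and the tail set takes at most half of this number. The constants depend on [a]
    only, not on [mu] or [n]. *)
Lemma many_framed (a : R) : 0 < a -> exists t, exists2 c : R, 0 < c &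
  forall (mu : probability (borel T) R) n (D : {set n.-tuple B}),
  maximal_entropy_measure sigma Y mu ->
  a <= pr mu [set y : borel T | word n y \in D] ->
  exists D' : {set n.-tuple B}, [/\ {subset D' <= D},
    forall v, v \in D' -> framed r f G t v & c * lam ^+ n <= #|D'|%:R].
Proof.
move=> a0.
have [K K0 HK] := mme_card (R := R) e_surj Y0 cY G0 GD size_cp size_cs Y_dec Y_per hpos h_le h_lim.
pose k := expR (- (K / a)).
have k0 : 0 < k by exact: expR_gt0.
have [M HM] := tail_small (R := R) Y0 G0 GD size_cp size_cs Y_dec Y_per (ltW hpos) h_le h_lim hpos
  (divr_gt0 k0 (ltr0n R 2)).
have [t Ht] := extendable_framed M.
exists t, (k / 2); first by rewrite divr_gt0.
move=> mu n D [mu_inv mu_max] aD.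
have mW := mrv_word (B := B) e_surj (n := n).
pose D1 : {set n.-tuple B} := [set w in D | ~~ `[< transient Y w >]]%SET.
exists (D1 :\: tail_set r f G cp cs n M)%SET; split.
- by move=> v; rewrite !inE => /andP[_ /andP[]].
- move=> v; rewrite finset.in_setD => /andP[vT]; rewrite inE => /andP[_ /asboolP vt].
  apply: Ht vT; apply: contrapT => nv; apply: (vt); exists 0%N => y Yy yv.
  by exfalso; case: (Y_ext n Yy); rewrite yv => // /vt.
have prD1 : pr mu [set y : borel T | word n y \in D1] = pr mu [set y : borel T | word n y \in D].
  have [_ ->] := mrv_preimage mu D1 mW; have [_ ->] := mrv_preimage mu D mW.
  rewrite [RHS](big_setID [set w | `[< transient Y w >]]%SET) /=.
  rewrite [X in _ = X + _]big1 ?add0r; last first.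
    by move=> w; rewrite !inE => /andP[_ /asboolP]; exact: transient_null.
  by apply: eq_bigl => w; rewrite !inE andbC.
have D1k : k * lam ^+ n <= #|D1|%:R.
  have := HK mu n D1 mu_inv.1 _ _; rewrite prD1 => H.
  apply: le_trans (H _ _); last exact: lt_le_trans aD.
    rewrite mulrC ler_wpM2l ?(ltW (lamX0 _))// ler_expR lerN2 ler_wpM2l// lef_pV2//.
    by rewrite posrE; apply: lt_le_trans aD.
  by apply: (word_entropy_ge e_surj forward mu_inv.2 hpos); rewrite mu_max.
have := cardsID (tail_set r f G cp cs n M) D1 => /(congr1 (fun n => n%:R : R)).
rewrite natrD; have := HM n.
have : (#|D1 :&: tail_set r f G cp cs n M|%SET%:R : R) <= #|tail_set r f G cp cs n M|%:R.
  by rewrite ler_nat subset_leq_card// finset.subsetIr.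
by move: D1k; rewrite -/lam; lra.
Qed.

Variables (F : set_system nat) (m : probability (borel T) R).
Hypothesis UF : UltraFilter F.
Hypothesis oF : \oo `<=` F.
Hypothesis Fm : per_limit Y F m.

Let lim_le C (a : R) : clopen C -> (\forall N \near \oo, per_ratio Y N C <= a) -> pr m C <= a.
Proof. by move=> cC /oF H; have [_ /(_ C cC)] := Fm; move/cvgr_to_le; apply. Qed.

Let lim_ge C (a : R) : clopen C -> (\forall N \near \oo, a <= per_ratio Y N C) -> a <= pr m C.
Proof. by move=> cC /oF H; have [_ /(_ C cC)] := Fm; move/cvgr_to_ge; apply. Qed.

Lemma per_limit_mme : maximal_entropy_measure sigma Y m.
Proof.
have [m_inv _] := Fm; split=> //; rewrite topE.
have [C C1 HC] := gibbs_upper (R := R) forward Y0 sY G0 GD size_cp size_cs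
  Y_dec Y_per hpos h_le h_lim.
have C0 : 0 < C by lra.
apply: (measure_entropy_eq e_surj forward m_inv.2
  (a := fun n => ln #|lang Y n|%:R) (C := ln C)) => //.
- exact: ltW.
- by move=> n; apply: (word_entropy_lang e_surj cY); have [] := m_inv.
move=> n; rewrite /word_entropy /entropy.
have mW := mrv_word (B := B) e_surj (n := n).
rewrite -[X in X <= _]mul1r -[X in X * _ <= _](mrv_sum1 m mW) mulr_suml; apply: ler_sum => w _.
rewrite /eta -mulrN.
have := pr_ge0 m ((word n : borel T -> _) @^-1` [set w]); rewrite le_eqVlt => /predU1P[<-|p0].
  by rewrite !mul0r.
rewrite ler_wpM2l// ?(ltW p0)// lerNr opprB.
apply: (@le_trans _ _ (ln (C / lam ^+ n))).
  rewrite ler_ln ?posrE ?divr_gt0//.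
  by apply: lim_le (HC n w); exact: (word_clopen e_surj [set w]).
by rewrite lnM ?posrE ?invr_gt0// lnV ?posrE// /lam lamX expRK.
Qed.

(* [gibbs_lower] summed over framed words; the gap [d] may depend on the words
   but takes boundedly many values. *)
Lemma mixing (a : R) : 0 < a -> exists2 c : R, 0 < c & forall (mu nu : probability (borel T) R) n
  (D E : {set n.+1.-tuple B}),
  maximal_entropy_measure sigma Y mu -> maximal_entropy_measure sigma Y nu ->
  a <= pr mu [set y : borel T | word n.+1 y \in D] ->
  a <= pr nu [set y : borel T | word n.+1 y \in E] ->
  exists d, c <= pr m ([set y : borel T | word n.+1 y \in D] `&`
    [set y : borel T | word n.+1 (iter d sigma y) \in E]).
Proof.
move=> a0; have [t [c c0 Hc]] := many_framed a0.
have [b b0 Hb] := gibbs_lower (R := R) forward Y0 sY G0 GD size_cp size_cs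
  Y_dec Y_per hpos h_le h_lim t.
pose K := (2 * t).+1.
have K0 : 0 < K%:R :> R by rewrite ltr0n.
exists (c * c * b / K%:R); first by rewrite divr_gt0 ?mulr_gt0.
move=> mu nu n D E mu_max nu_max /(Hc mu _ _ mu_max)[D' [sD fD D'c]].
move=> /(Hc nu _ _ nu_max)[E' [sE fE E'c]].
pose dd (k : 'I_K) := (n.+1 + r + k)%N.
have mW := mrv_word (B := B) e_surj (n := n.+1).
have mS := @sigma_measurable I B.
pose W (k : 'I_K) (y : borel T) := (word n.+1 y, word n.+1 (iter (dd k) sigma y)).
have mWk k : mrv (W k).
  move=> [u v]; rewrite (_ : _ @^-1` _ = (word n.+1 : borel T -> _) @^-1` [set u] `&`
    (iter (dd k) (@sigma I B) @^-1` ((word n.+1 : borel T -> _) @^-1` [set v]))).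
    by apply: measurableI => //; exact: (measurable_iter (T := borel T)).
  by apply/seteqP; split=> y /=; rewrite /W => -[-> ->].
pose S k := pr m [set y : borel T | W k y \in finset.setX D' E'].
have SE k : S k = \sum_(u in D') \sum_(v in E') pr m (W k @^-1` [set (u, v)]).
  rewrite /S; have [_ ->] := mrv_preimage m (finset.setX D' E') (mWk k).
  by rewrite pair_big /=; apply: eq_big => [[u v]|[u v] _] //=; rewrite finset.in_setX.
have key : c * c * b <= \sum_k S k.
  under eq_bigr do rewrite SE.
  rewrite exchange_big /=.
  have l2 : 0 < lam ^+ n.+1 * lam ^+ n.+1 by rewrite mulr_gt0.
  have inner u v : u \in D' -> v \in E' ->
      b / (lam ^+ n.+1 * lam ^+ n.+1) <= \sum_k pr m (W k @^-1` [set (u, v)]).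
    move=> uD vE; have [d [dle dge] H] := Hb n.+1 u v (ltn0Sn _) (fD u uD) (fE v vE).
    have dK : (d - (n.+1 + r) < K)%N by rewrite /K; move: dle dge; clear; lia.
    rewrite (bigD1 (Ordinal dK))//= -[X in X <= _]addr0; apply: lerD; last first.
      by apply: sumr_ge0 => k _; exact: pr_ge0.
    have -> : (W (Ordinal dK) @^-1` [set (u, v)]) = [set y | word n.+1 y = u] `&`
        [set y | word n.+1 (iter d sigma y) = v].
      have dE : dd (Ordinal dK) = d by exact: subnKC.
      rewrite /W dE.
      by apply/seteqP; split=> y /=; [move=> [-> ->]|move=> [-> ->]].
    apply: lim_ge; last by move: H; rewrite mul2n -addnn exprD.
    by apply: clopenI; [exact: (word_iter_clopen e_surj 0)|exact: (word_iter_clopen e_surj)].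
  apply: (@le_trans _ _ (\sum_(u in D') \sum_(v in E') b / (lam ^+ n.+1 * lam ^+ n.+1))).
    rewrite !sumr_const -mulrnA -[X in _ <= X]mulr_natr.
    have -> : c * c * b = b / (lam ^+ n.+1 * lam ^+ n.+1) * ((c * lam ^+ n.+1) * (c * lam ^+ n.+1)).
      by field; rewrite gt_eqF.
    rewrite ler_wpM2l//; first by rewrite divr_ge0// ltW.
    by rewrite natrM ler_pM// mulr_ge0// ltW.
  apply: ler_sum => u uD; rewrite exchange_big /=.
  by apply: ler_sum => v vE; exact: inner.
have [k Sk] : exists k, c * c * b / K%:R <= S k.
  apply: contrapT => /forallNP nS; have : \sum_k S k < \sum_(k < K) c * c * b / K%:R.
    apply: ltr_sum; first by apply/hasP; exists ord0; rewrite ?mem_index_enum.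
    by move=> k _; rewrite ltNge; apply/negP/nS.
  have -> : \sum_(k < K) c * c * b / K%:R = c * c * b.
    by rewrite sumr_const card_ord -[LHS]mulr_natr divfK ?gt_eqF.
  by rewrite ltNge key.
exists (dd k); apply: le_trans Sk _; apply: le_pr.
- by have [] := mrv_preimage m (finset.setX D' E') (mWk k).
- apply: measurableI; first by have [] := mrv_preimage m D mW.
  have [mE _] := mrv_preimage m E mW.
  exact: (measurable_iter (T := borel T) (f := @sigma I B) mS (dd k) mE).
by move=> y /=; rewrite /W finset.in_setX => /andP[/sD ? /sE ?].
Qed.

(* Otherwise [Q] and its complement are approximated by unions [D] and [~: D] of
   cylinders, and [mixing] shows that some iterate leaves [Q]. *)
Lemma forward_invariant_full (nu : probability (borel T) R) (Q : set (borel T)) :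
  maximal_entropy_measure sigma Y nu -> measurable Q -> Q `<=` sigma @^-1` Q ->
  0 < pr nu Q -> pr m Q = 1.
Proof.
move=> nu_max mQ Qs nuQ; have m_max := per_limit_mme.
have [[mY m_inv] _] := m_max; have [[nuY nu_inv] _] := nu_max.
have mS := @sigma_measurable I B.
apply/eqP; rewrite eq_le pr_le1//= leNgt; apply/negP => mQ1.
pose a := Num.min (pr nu Q) (1 - pr m Q) / 2.
have a0 : 0 < a by rewrite divr_gt0// lt_min nuQ subr_gt0.
have a1 : 2 * a <= pr nu Q by rewrite mulrC divfK// ge_min lexx.
have a2 : 2 * a <= 1 - pr m Q by rewrite mulrC divfK// ge_min lexx orbT.
(* The order matters: [c] depends on [a] only, [eps] is chosen after [c], and the length [n.+1] of
   the words describing [C] depends on [eps]. *)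
have [c c0 Hc] := mixing a0.
pose eps := Num.min a (c / 3).
have eps0 : 0 < eps by rewrite lt_min a0 divr_gt0.
have e1 : eps <= a by rewrite ge_min lexx.
have e2 : eps <= c / 3 by rewrite ge_min lexx orbT.
have [C cC [mQC nuQC]] := clopen_approx2 e_surj m nu mQ eps0.
have [N [n [D CD]]] := clopen_word e_surj forward cC.
have mC : measurable (C : set (borel T)) := clopen_measurable cC.
pose Q' : set (borel T) := iter N (@sigma I B) @^-1` Q.
have mQ' : measurable Q' := measurable_iter (T := borel T) (f := @sigma I B) mS N mQ.
pose U : set (borel T) := [set y | word n.+1 y \in D].
have UE : U = iter N (@sigma I B) @^-1` C by apply/seteqP; split=> y /CD.
have mU : measurable U by rewrite UE; exact: (measurable_iter (T := borel T) (f := @sigma I B)).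
have transfer (mu : probability (borel T) R) (S : set (borel T)) :
    (forall S : set (borel T), measurable S -> mu (@sigma I B @^-1` S) = mu S) ->
    measurable S -> pr mu (iter N (@sigma I B) @^-1` S) = pr mu S.
  by move=> mu_inv mS'; exact: (pr_iter (T := borel T) (f := @sigma I B) mS mu_inv).
have mQD := measurableD mQ mC; have mDQ := measurableD mC mQ.
have symd (mu : probability (borel T) R) : pr mu (symdiff Q C) < eps ->
    pr mu (Q `\` C) < eps /\ pr mu (C `\` Q) < eps.
  have mSy : measurable (symdiff Q C) by exact: measurableU.
  by move=> lt; split; apply: le_lt_trans lt; apply: le_pr => // x ?; [left|right].
have [m1 m2] := symd m mQC; have [nu1 nu2] := symd nu nuQC.
have aU : a <= pr nu U.
  rewrite UE transfer//; have := prDI nu mQ mC; have := prDI nu mC mQ; rewrite setIC.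
  by have := pr_ge0 nu (C `\` Q); move: nu1 a1 e1; lra.
have aCU : a <= pr m [set y : borel T | word n.+1 y \in (~: D)%SET].
  rewrite (_ : [set y : borel T | _] = ~` U); last first.
    by apply/seteqP; split=> y /=; rewrite finset.in_setC => /negP.
  rewrite prC// UE transfer//.
  have := prDI m mQ mC; have := prDI m mC mQ; rewrite setIC.
  by have := pr_ge0 m (Q `\` C); move: m2 a2 e1; lra.
have [d cd] := Hc nu m n D (~: D)%SET nu_max m_max aU aCU.
have Qsd (k : nat) x : Q x -> Q (iter k sigma x).
  by elim: k => // k IHk /IHk; exact: Qs.
have miter (S : set (borel T)) : measurable S ->
    measurable (iter d (@sigma I B) @^-1` S : set (borel T)).
  exact: (measurable_iter (T := borel T) (f := @sigma I B) mS d).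
have mUQ := measurableD mU mQ'; have mQU := measurableD mQ' mU.
have := prU_le m mUQ (miter _ mQU).
have -> : pr m (iter d (@sigma I B) @^-1` (Q' `\` U)) = pr m (Q `\` C).
  rewrite (pr_iter (T := borel T) (f := @sigma I B) mS m_inv)//.
  by rewrite -(transfer m (Q `\` C))// UE.
have -> : pr m (U `\` Q') = pr m (C `\` Q) by rewrite -(transfer m (C `\` Q))// UE.
suff : c <= pr m ((U `\` Q') `|` (iter d (@sigma I B) @^-1` (Q' `\` U))).
  by move: m1 m2 e2 c0; lra.
apply: le_trans cd _; apply: le_pr.
- apply: measurableI => //.
  apply: (miter [set y : borel T | word n.+1 y \in (~: D)%SET]).
  by have [] := mrv_preimage m (~: D)%SET (mrv_word (B := B) e_surj (n := n.+1)).
- by apply: measurableU => //; exact: miter.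
move=> y [/= yU]; rewrite finset.in_setC => /negP ynU.
(* If [y] lies in [Q'], so does its whole orbit, which at time [d] is outside [U]. Both exceptional
   sets have measure below [eps <= c / 3]. *)
have [Q'y|] := pselect (Q' y); last by left.
right; split=> //=; rewrite /Q' /= -iterD addnC iterD.
exact: Qsd.
Qed.

Lemma per_limit_unique (nu : probability (borel T) R) :
  maximal_entropy_measure sigma Y nu ->
  forall Q : set (borel T), measurable Q -> nu Q = m Q.
Proof.
move=> nu_max; have [[_ m_inv] _] := per_limit_mme; have [[_ nu_inv] _] := nu_max.
have mS := @sigma_measurable I B.
have le Q : measurable Q -> pr nu Q <= pr m Q.
  move=> mQ; rewrite leNgt; apply/negP => /(forward_invariant_gt mS m_inv nu_inv mQ)[P [mP Ps Pgt]].
  have P1 : pr m P = 1.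
    by apply: (forward_invariant_full nu_max mP Ps); apply: le_lt_trans Pgt; exact: pr_ge0.
  by have := pr_le1 nu mP; rewrite leNgt -P1 Pgt.
move=> Q mQ; rewrite !prE//; congr _%:E; apply/eqP; rewrite eq_le le//=.
by have := le _ (measurableC mQ); rewrite !prC// lerD2l lerN2.
Qed.

End MaximalEntropy.

(** * Factors of coded shifts *)

Section CodedShift.
Context {R : realType} {I : pzSemiRingType} {A B : alphabetType}.
Variable e : nat -> I.
Hypothesis e_surj : forall i, exists k, e k = i.
Hypothesis forward : forall i : I, exists N j : nat, i + N%:R = j%:R.
Local Notation T := (fullshift I B).
Variable Y : set T.
Hypothesis Y0 : Y !=set0.
Hypothesis cY : closed Y.
Hypothesis sY : sigma @` Y `<=` Y.
Variables (r : nat) (f : seq A -> B) (G : set (seq A)) (cp cs : nat -> seq A).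
Local Notation Phi := (block_code r f).
Hypothesis G0 : G [::].
Hypothesis GD : forall g g', G g -> G g' -> G (g ++ g').
Hypothesis size_cp : forall n, size (cp n) = n.
Hypothesis size_cs : forall n, size (cs n) = n.
Hypothesis Y_dec : forall y n, Y y -> exists i j, decomposed r f G cp cs (word n y) i j.
Hypothesis Y_per : forall g, G g -> g != [::] -> exists y, coded_periodic Y r f g y.
Hypothesis Y_ext : forall y n, Y y ->
  extendable r f G cp cs (word n y) \/ transient Y (word n y).
Variable z : A.
Hypothesis G_nseq : forall N, exists n b, (N <= n)%N /\ G (nseq n z ++ b).

Lemma per_seq_gt0 : \forall n \near \oo, (0 < size (per_seq Y n))%N.
Proof.
have [n [b [n1 Gb]]] := G_nseq 1.
have [|y [Yy yk _]] := Y_per Gb; first by move: n1; case: n {Gb}.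
exists (size (nseq n z ++ b)) => // N /= NS; rewrite -has_predT; apply/hasP; exists y => //.
apply/(per_seqP forward); split=> //; exists (size (nseq n z ++ b)); split=> //.
by rewrite NS andbT size_cat size_nseq addn_gt0 n1.
Qed.

Section ZeroEntropy.
Hypothesis h_lim : forall eps : R, 0 < eps -> exists N, forall n, (N <= n)%N ->
  ln #|lang Y n|%:R <= n%:R * (0 + eps).

Let Gpow g k : G g -> G (flatten (nseq k g)).
Proof. by move=> Gg; elim: k => [|k IHk] //=; exact: GD. Qed.

Let size_pow (g : seq A) k : size (flatten (nseq k g)) = (k * size g)%N.
Proof. by elim: k => [|k IHk] //=; rewrite size_cat IHk mulSn. Qed.

(* In zero entropy two cores of the same length have the same image. *)
Lemma block_code_const g i : G g -> (i < size g - r)%N ->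
  nth point (Phi g) i = f (nseq r.+1 z).
Proof.
move=> Gg ig; have g0 : (0 < size g)%N by move: ig; clear; case: (size g).
(* [u] starts with at least [size g] letters [z]. Powers of [g] and of [u] of a common length have
   the same image, whose first letters are read both inside [g] and inside the run of [z]. *)
have [n [b [gn Gb]]] := G_nseq (size g); set u := nseq n z ++ b in Gb.
have u0 : (0 < size u)%N by rewrite size_cat size_nseq addn_gt0 (leq_trans g0 gn).
have [l lE] : exists l, size u = l.+1 by exists (size u).-1; rewrite prednK.
have [k kE] : exists k, size g = k.+1 by exists (size g).-1; rewrite prednK.
have E : Phi (flatten (nseq (size u) g)) = Phi (flatten (nseq (size g) u)).
  pose M := (size u * size g)%N.
  have s1 : size (Phi (flatten (nseq (size u) g))) == (M - r)%N.
    by rewrite size_block_code size_pow.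
  have s2 : size (Phi (flatten (nseq (size g) u))) == (M - r)%N.
    by rewrite size_block_code size_pow mulnC.
  have := card_good_le (R := R) Y0 G0 GD Y_per (lexx 0) h_lim M.
  rewrite expR0 expr1n (_ : 1 = 1%:R)// ler_nat => /card_le1P/(_ (Tuple s1)).
  have in1 : Tuple s1 \in good r f G M.
    by apply/goodP; exists (flatten (nseq (size u) g)); split; [exact: Gpow|by rewrite size_pow|].
  have in2 : Tuple s2 \in good r f G M.
    by apply/goodP; exists (flatten (nseq (size g) u)); split; [exact: Gpow|by rewrite size_pow mulnC|].
  by move=> /(_ in1 (Tuple s2)); rewrite in2 inE => /esym/eqP[].
have := congr1 (fun t => nth point t i) E; rewrite lE kE /= /u -catA.
have zi : (i < size (nseq n z) - r)%N by rewrite size_nseq; move: ig gn; clear; lia.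
rewrite -(nth_block_code_sub f point [::] (flatten (nseq l g)) ig) /= => ->.
have := nth_block_code_sub f point [::] (b ++ flatten (nseq k (nseq n z ++ b))) zi.
rewrite /= => ->; rewrite nth_block_code// drop_nseq take_nseq //.
by move: zi; rewrite size_nseq; clear; lia.
Qed.

Lemma extendable_const n (v : n.-tuple B) : extendable r f G cp cs v ->
  v = nseq_tuple n (f (nseq r.+1 z)).
Proof.
move=> [i [j [g [p [s [Gg Gp Gs sz vE]]]]]]; apply: eq_from_tnth => k.
rewrite !(tnth_nth point) vE nth_nseq ltn_ord.
have kn : (k < size (cp i ++ g ++ cs j) - r)%N by rewrite sz addnK.
rewrite -(nth_block_code_sub f point p s kn).
have -> : p ++ (cp i ++ g ++ cs j) ++ s = (p ++ cp i) ++ g ++ (cs j ++ s) by rewrite !catA.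
apply: block_code_const; first by apply: GD => //; exact: GD.
have lt a b c d x : (k < b + (c + d) - r -> a + k < a + b + (c + (d + x)) - r)%N by clear; lia.
by move: kn; rewrite !size_cat; exact: lt.
Qed.

(** A word of [Y] other than the constant one is not extendable, so it is transient and null; both
    measures therefore give full mass to the constant word of each length. *)
Lemma zero_entropy_unique (m nu : probability (borel T) R) :
  invariant_probability sigma Y m -> invariant_probability sigma Y nu ->
  forall Q : set (borel T), measurable Q -> m Q = nu Q.
Proof.
move=> m_inv nu_inv.
have mS := @sigma_measurable I B.
have wE n (w : n.-tuple B) : pr m ((word n : borel T -> _) @^-1` [set w]) =
    pr nu ((word n : borel T -> _) @^-1` [set w]).
  pose c : n.-tuple B := nseq_tuple n (f (nseq r.+1 z)).
  have null (mu : probability (borel T) R) v : invariant_probability sigma Y mu ->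
      v != c -> pr mu ((word n : borel T -> _) @^-1` [set v]) = 0.
    move=> mu_inv vc; apply: (transient_null e_surj cY sY mu_inv).
    apply: contrapT => vt; apply: (vt); exists 0%N => y Yy yv; exfalso.
    case: (Y_ext n Yy); rewrite yv; last by move/vt.
    by move=> /extendable_const vE; rewrite vE eqxx in vc.
  have one (mu : probability (borel T) R) : invariant_probability sigma Y mu ->
      pr mu ((word n : borel T -> _) @^-1` [set c]) = 1.
    move=> mu_inv; have := mrv_sum1 mu (mrv_word (B := B) e_surj (n := n)).
    by rewrite (bigD1 c)//= big1 ?addr0// => v; exact: null.
  have [->|wc] := eqVneq w c; first by rewrite !one.
  by rewrite !null.
apply: (probability_clopen_ext e_surj) => C cC.
have [N [n [D CD]]] := clopen_word e_surj forward cC.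
have mC : measurable (C : set (borel T)) := clopen_measurable cC.
have CE (mu : probability (borel T) R) : invariant_probability sigma Y mu ->
    pr mu C = \sum_(w in D) pr mu ((word n.+1 : borel T -> _) @^-1` [set w]).
  move=> [_ mu_inv]; have [_ <-] := mrv_preimage mu D (mrv_word (B := B) e_surj (n := n.+1)).
  rewrite -(pr_iter (T := borel T) (f := @sigma I B) mS mu_inv N)//.
  by congr pr; apply/seteqP; split=> y /CD.
have mE : m C = (pr m C)%:E := prE m mC; have nuE : nu C = (pr nu C)%:E := prE nu mC.
by rewrite mE nuE !CE//; congr _%:E; exact: eq_bigr.
Qed.

End ZeroEntropy.

Theorem coded_shift_ergodic : intrinsically_ergodic R sigma Y /\
  forall mu : probability (borel T) R, maximal_entropy_measure sigma Y mu ->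
    weak_star_cvg Y (periodic_measure sigma Y) mu.
Proof.
apply: (ultralimits_suffice e_surj forward cY sY per_seq_gt0) => F m UF oF Fm.
have [h [h0 h_le h_lim]] := lang_rate (R := R) Y0 sY.
move: h0; rewrite le_eqVlt => /predU1P[hE|hpos]; last first.
  split.
    exact: (per_limit_mme e_surj forward Y0 cY sY G0 GD size_cp size_cs
      Y_dec Y_per hpos h_le h_lim UF oF Fm).
  exact: (per_limit_unique e_surj forward Y0 cY sY G0 GD size_cp size_cs
    Y_dec Y_per Y_ext hpos h_le h_lim UF oF Fm).
have h0 : 0 <= h by rewrite -hE.
have h_lim0 (eps : R) : 0 < eps ->
    exists N, forall n, (N <= n)%N -> ln #|lang Y n|%:R <= n%:R * (0 + eps).
  by move=> /h_lim; rewrite -hE.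
have [m_inv _] := Fm; split; last first.
  by move=> nu [nu_inv _]; exact: (zero_entropy_unique h_lim0).
split=> //; rewrite (topological_entropyE e_surj forward Y0 cY sY h0 h_le h_lim) -hE.
apply/eqP; rewrite eq_le measure_entropy_ge0 andbT.
apply: (measure_entropy_le e_surj forward m_inv.2 (lexx _) _ h_lim0).
by move=> n; apply: (word_entropy_lang e_surj cY); have [] := m_inv.
Qed.

End CodedShift.

Section Factor.
Context {R : realType} {I : pzSemiRingType} {A B : alphabetType}.
Variable e : nat -> I.
Hypothesis e_surj : forall i, exists k, e k = i.
Hypothesis forward : forall i : I, exists N j : nat, i + N%:R = j%:R.

Lemma tval_word (C : alphabetType) n (x : fullshift I C) :
  tval (word n x) = mkseq (fun i => x i%:R) n.
Proof.
apply: (@eq_from_nth _ point); first by rewrite size_tuple size_mkseq.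
move=> i; rewrite size_tuple => lt; rewrite nth_mkseq//.
by rewrite -(tnth_nth _ _ (Ordinal lt)) tnth_word.
Qed.

Lemma take_word (C : alphabetType) m n (x : fullshift I C) : (m <= n)%N ->
  take m (word n x) = word m x.
Proof.
by move=> mn; rewrite !tval_word /mkseq -map_take take_iota (minn_idPl mn).
Qed.

Lemma take_drop_word (C : alphabetType) m n i (x : fullshift I C) : (i + m <= n)%N ->
  take m (drop i (word n x)) = word m (iter i sigma x).
Proof.
move=> imn; have s : size (take m (drop i (word n x))) = m.
  by rewrite size_takel// size_drop size_tuple; move: imn; clear; lia.
apply: (@eq_from_nth _ point); first by rewrite s size_tuple.
rewrite s => j jm; rewrite nth_take// nth_drop !tval_word !nth_mkseq//; last first.
  by move: imn jm; clear; lia.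
by rewrite iter_sigmaE -natrD addnC.
Qed.

Lemma iterC (C : Type) (h : C -> C) i j x : iter i h (iter j h x) = iter j h (iter i h x).
Proof. by rewrite -!iterD addnC. Qed.

Variable X : set (fullshift I A).
Hypothesis cX : closed X.
Hypothesis sX : sigma @` X `<=` X.
Hypothesis X_pre : forall x, X x -> exists2 x', X x' & sigma x' = x.

Lemma block_code_exists (phi : fullshift I A -> fullshift I B) :
  {within X, continuous phi} ->
  (forall x, X x -> phi (sigma x) = sigma (phi x)) ->
  exists N r f, forall x n, X x ->
    tval (word n (phi (iter N sigma x))) = block_code r f (word (n + r) x).
Proof.
move=> cphi phis.
have [m mP] : exists m, forall y z, X y -> X z -> agree e m y z -> phi y 0 = phi z 0.
  apply: (compact_agree (e := e) e_surj (E := fun y z => phi y 0 = phi z 0) cX) => x Xx.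
  pose V := [set y : fullshift I B | [set phi x 0] (y 0)].
  have cV : clopen V := coord_clopen 0 [set phi x 0].
  exists [set y | X y -> V (phi y)].
    have /subspace_continuousP/(_ x Xx)/(_ V) := cphi.
    by apply; apply: open_nbhs_nbhs; split; [exact: cV.1|].
  by move=> y z Xy Xz /(_ Xy) -> /(_ Xz) ->.
have [N [r rP]] := @word_agree I A e forward m.
have iterX k x : X x -> X (iter k sigma x) by move=> Xx; exact: iter_sigma_in.
(* The rule is evaluated at any point of [X] that begins with [u]; by the choice of [N] and [r] the
   result does not depend on it. *)
pose f (u : seq A) : B := phi (iter N sigma (xget point [set x | X x /\ tval (word r.+1 x) = u])) 0.
have fP x : X x -> phi (iter N sigma x) 0 = f (word r.+1 x).
  move=> Xx; rewrite /f.
  have [Xz zx] := @xgetI _ point [set y | X y /\ tval (word r.+1 y) = word r.+1 x] x (conj Xx erefl).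
  apply: mP; [exact: iterX|exact: iterX|]; apply: rP; apply: val_inj => /=.
  by rewrite -(take_word x (leqnSn r)) -zx take_word.
have phi_iter k x : X x -> phi (iter k sigma x) = iter k sigma (phi x).
  by move=> Xx; elim: k => //= k <-; rewrite phis//; exact: iterX.
exists N, r, f => x n Xx; apply: (@eq_from_nth _ point).
  by rewrite size_block_code !size_tuple addnK.
move=> i; rewrite size_tuple => lt.
rewrite nth_block_code ?size_tuple ?addnK//.
rewrite take_drop_word; last by move: lt; clear; lia.
rewrite -fP; last exact: iterX.
rewrite iterC [in RHS]phi_iter; last exact: iterX.
by rewrite iter_sigmaE add0r tval_word nth_mkseq.
Qed.

Variables (G : set (seq A)) (cp cs : nat -> seq A) (z : A).
Hypothesis G0 : G [::].
Hypothesis GD : forall g g', G g -> G g' -> G (g ++ g').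
Hypothesis size_cp : forall n, size (cp n) = n.
Hypothesis size_cs : forall n, size (cs n) = n.
Hypothesis X_dec : forall x n, X x -> exists i j g, G g /\
  tval (word n x) = cp i ++ g ++ cs j.
Hypothesis X_per : forall g, G g -> g != [::] -> exists x, [/\ X x,
  iter (size g) sigma x = x & tval (word (size g) x) = g].
(* The second case is that of the words [g ++ w_0 .. w_(j-1)] of a beta-shift with
   [w_k = 0] for all [k >= j], which must be followed by zeros. *)
Hypothesis X_ext : forall x n, X x ->
  (exists i j g p s, [/\ G g, G (p ++ cp i), G (cs j ++ s) &
     tval (word n x) = cp i ++ g ++ cs j]) \/
  (forall k n', (n <= k)%N -> G (word n' (iter k sigma x))).
Hypothesis G_nseq : forall N, exists n b, (N <= n)%N /\ G (nseq n z ++ b).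

Theorem coded_factor_ergodic (Y : set (fullshift I B)) : subshift_factor X Y ->
  intrinsically_ergodic R sigma Y /\
  forall mu : probability (borel (fullshift I B)) R, maximal_entropy_measure sigma Y mu ->
    weak_star_cvg Y (periodic_measure sigma Y) mu.
Proof.
move=> [[Y0 cY sY] [phi [cphi phiX phis]]].
have [N [r [f fP]]] := block_code_exists cphi phis.
have iterX k x : X x -> X (iter k sigma x) by move=> Xx; exact: iter_sigma_in.
have phi_iter k x : X x -> phi (iter k sigma x) = iter k sigma (phi x).
  by move=> Xx; elim: k => //= k <-; rewrite phis//; exact: iterX.
have lift y : Y y -> exists2 x, X x & y = phi (iter N sigma x).
  rewrite -phiX => -[x Xx <-].
  (* [X_pre] undoes the [N] shifts built into the block code. *)
  suff [x' Xx' <-] : exists2 x', X x' & iter N sigma x' = x by exists x'.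
  elim: N {fP} => [|N [x' Xx' <-]]; first by exists x.
  by have [x'' Xx'' <-] := X_pre Xx'; exists x'' => //; rewrite iterSr.
have Y_ext y n : Y y -> extendable r f G cp cs (word n y) \/
    forall k, (n + r <= k)%N -> extendable r f G cp cs (word n (iter k sigma y)).
  move=> /lift[x Xx ->]; have [[i [j [g [p [s [Gg Gp Gs xE]]]]]]|Gk] := X_ext (n + r) Xx.
    by left; exists i, j, g, p, s; split; rewrite -?xE ?size_tuple// fP.
  right=> k nk; have cp0 := size0nil (size_cp 0); have cs0 := size0nil (size_cs 0).
  exists 0%N, 0%N, (word (n + r) (iter k sigma x)), [::], [::].
  rewrite cp0 cs0 cat0s cats0; split=> //; first exact: Gk.
    by rewrite size_tuple.
  rewrite -phi_iter; last exact: iterX.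
  by rewrite iterC fP//; exact: iterX.
apply: (coded_shift_ergodic e_surj forward Y0 cY sY (r := r) (f := f)
  G0 GD size_cp size_cs _ _ _ G_nseq).
- move=> y n /lift[x Xx ->]; have [i [j [g [Gg xE]]]] := X_dec (n + r) Xx.
  by exists i, j, g; split; rewrite -?xE ?size_tuple// fP.
- move=> g Gg g0; have [x [Xx xk xg]] := X_per Gg g0.
  exists (phi (iter N sigma x)); split.
  + by rewrite -phiX; exists (iter N sigma x) => //; exact: iterX.
  + by rewrite -phi_iter; [rewrite iterC xk|exact: iterX].
  move=> k n nk; rewrite fP//.
  have -> : flatten (nseq k g) = word (k * size g) x.
    elim: k {nk} => [|k IHk] /=; first by rewrite tval_word.
    rewrite {}IHk mulSn -{1}xg -(take_word (m := size g) (n := size g + k * size g)) ?leq_addr//.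
    rewrite -[RHS](cat_take_drop (size g)); congr (_ ++ _).
    have := @take_drop_word A (k * size g) (size g + k * size g) (size g) x (leqnn _).
    rewrite xk => <-; rewrite take_oversize// size_drop size_tuple.
    by clear; lia.
  have s : size (take (n + r) (word (k * size g) x)) = (n + r)%N.
    by rewrite size_takel// size_tuple.
  have := block_code_take r f
    (take (n + r) (word (k * size g) x)) (drop (n + r) (word (k * size g) x)).
  by rewrite s addnK cat_take_drop => ->; rewrite take_word.
(* For a word that is not extendable, every occurrence is in the second case: the words read [n + r]
   or more steps later are extendable and so differ from it. *)
move=> y n Yy; have [|nE] := pselect (extendable r f G cp cs (word n y)); first by left.
right; exists (n + r)%N => y' Yy' y'E k nk yk; apply: nE.
by have [] := Y_ext y' n Yy'; [rewrite y'E|move=> /(_ k nk); rewrite yk].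
Qed.

End Factor.

Lemma closed_agree (I : pzSemiRingType) (A : alphabetType) (e : nat -> I)
  (K : set (fullshift I A)) :
  (forall x, (forall n, exists2 y, K y & agree e n x y) -> K x) -> closed K.
Proof.
move=> H x Kx; apply: H => n; have [y [Ky xy]] := Kx _ (agree_nbhs e n x).
by exists y.
Qed.

Lemma nth_flatten_nseq (C : Type) (d : C) (g : seq C) k m : (m < k * size g)%N ->
  nth d (flatten (nseq k g)) m = nth d g (m %% size g).
Proof.
elim: k m => [//|k IHk] m; rewrite mulSn /= nth_cat => mk.
have [mg|gm] := ltnP m (size g); first by rewrite modn_small.
rewrite IHk; last by move: mk gm; clear; lia.
by rewrite -[in RHS](subnK gm) modnDr.
Qed.

(** * S-gap shifts *)

Section GapShift.
Variable S : set nat.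
Hypothesis S_inf : infinite_set S.

(** Arbitrarily long gaps allow every run of zeros, at either end of a word, to be completed to a
    gap in [S]. *)
Let S_unbounded N : exists2 k, (N <= k)%N & S k.
Proof.
apply: contrapT => H; apply: S_inf; apply: (@sub_finite_set _ _ `I_N); last exact: finite_II.
by move=> k Sk /=; rewrite ltnNge; apply/negP => Nk; apply: H; exists k.
Qed.

Definition gap_word k := rcons (nseq k false) true.
Definition gap_code : set (seq bool) :=
  [set u | exists2 s, (forall k, k \in s -> S k) & u = flatten (map gap_word s)].
(** A leading run of zeros up to the first [1], whose length [k] need not lie in [S]. The empty
    prefix of index [0] serves the words without a [1]. *)
Definition gap_prefix i := if i is k.+1 then gap_word k else [::].

Lemma gap_code_cat g g' : gap_code g -> gap_code g' -> gap_code (g ++ g').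
Proof.
move=> [s Ss ->] [s' Ss' ->]; exists (s ++ s'); last by rewrite map_cat flatten_cat.
by move=> k; rewrite mem_cat => /orP[/Ss|/Ss'].
Qed.

Lemma gap_code1 k : S k -> gap_code (gap_word k).
Proof. by move=> Sk; exists [:: k]; rewrite /= ?cats0// => k'; rewrite inE => /eqP->. Qed.

Lemma gap_word_cat j k : gap_word (j + k) = nseq j false ++ gap_word k.
Proof. by rewrite /gap_word nseqD rcons_cat. Qed.

Lemma gap_prefix_ext i : exists p, gap_code (p ++ gap_prefix i).
Proof.
case: i => [|i]; first by exists [::]; exists [::].
have [k ik Sk] := S_unbounded i; exists (nseq (k - i) false).
by rewrite /= -gap_word_cat subnK//; exact: gap_code1.
Qed.

Lemma nseq_false_ext N : exists2 k, (N <= k)%N & gap_code (nseq k false ++ [:: true]).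
Proof.
have [k Nk Sk] := S_unbounded N; exists k => //.
by rewrite cats1; exact: gap_code1.
Qed.

Lemma gap_suffix_ext j : exists s, gap_code (nseq j false ++ s).
Proof.
have [k jk Gk] := nseq_false_ext j; exists (nseq (k - j) false ++ [:: true]).
by rewrite catA -nseqD subnKC.
Qed.

Lemma gap_language_dec u : gap_language S u ->
  exists i j g, gap_code g /\ u = gap_prefix i ++ g ++ nseq j false.
Proof.
move=> [[n [m [s [Ss ->]]]]|[n ->]]; last by exists 0%N, n, [::]; split=> //; exists [::].
exists n.+1, m, (flatten (map gap_word s)); split; first by exists s.
by rewrite /= /gap_word cat_rcons.
Qed.

Lemma take_gap_code s n : (forall k, k \in s -> S k) -> exists s' m,
  (forall k, k \in s' -> S k) /\
  take n (flatten (map gap_word s)) = flatten (map gap_word s') ++ nseq m false.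
Proof.
elim: s n => [|k s IHs] n Ss; first by exists [::], 0%N.
have [nk|kn] := leqP n k.
  exists [::], n; split=> //=; rewrite take_cat size_rcons size_nseq ltnS nk.
  rewrite /gap_word -cats1 takel_cat ?size_nseq// take_nseq//.
have [|s' [m [Ss' E]]] := IHs (n - k.+1)%N; first by move=> k' k's; apply: Ss; rewrite inE k's orbT.
exists (k :: s'), m; split.
  by move=> k'; rewrite inE => /predU1P[->|/Ss'//]; apply: Ss; exact: mem_head.
by rewrite /= take_cat size_rcons size_nseq ltnNge kn /= E catA.
Qed.

Lemma drop_gap_code s i : (forall k, k \in s -> S k) ->
  drop i (flatten (map gap_word s)) = [::] \/ exists n s',
  (forall k, k \in s' -> S k) /\
  drop i (flatten (map gap_word s)) = nseq n false ++ true :: flatten (map gap_word s').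
Proof.
elim: s i => [|k s IHs] i Ss; first by left.
have Ss' k' : k' \in s -> S k' by move=> k's; apply: Ss; rewrite inE k's orbT.
rewrite /= drop_cat size_rcons size_nseq; case: ltnP => ik; last exact: IHs.
right; exists (k - i)%N, s; split=> //.
by rewrite -{1}(subnKC (ik : (i <= k)%N)) gap_word_cat drop_size_cat ?size_nseq// cat_rcons.
Qed.

Lemma gap_language_sub s i n : (forall k, k \in s -> S k) ->
  gap_language S (take n (drop i (flatten (map gap_word s)))).
Proof.
move=> Ss; have [->|[a [s' [Ss' ->]]]] := drop_gap_code i Ss; first by right; exists 0%N.
have [na|an] := leqP n a.
  by right; exists n; rewrite takel_cat ?size_nseq// take_nseq.
have [s'' [m [Ss'' E]]] := take_gap_code (n - a.+1) Ss'.
left; exists a, m, s''; split=> //.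
rewrite take_cat size_nseq ltnNge (ltnW an)/=; congr (_ ++ _).
by rewrite -(subnKC an) addSnnS addKn /= E.
Qed.

Definition periodic_extension (g : seq bool) : fullshift int bool :=
  fun i => nth false g `|(i %% (size g)%:Z)%Z|%N.

Lemma periodic_extensionD g i j : (0 < size g)%N -> periodic_extension g (i + j%:Z) =
  nth false g ((`|(i %% (size g)%:Z)%Z| + j) %% size g).
Proof.
move=> g0; rewrite /periodic_extension -modzDml.
have i0 : (0 <= (i %% (size g)%:Z)%Z) by rewrite modz_ge0// eqz_nat -lt0n.
by rewrite -{1}(gez0_abs i0) -PoszD modz_nat.
Qed.

Lemma gap_shift_periodic g : gap_code g -> g != [::] -> exists x, [/\ gap_shift S x,
  iter (size g) sigma x = x & tval (word (size g) x) = g].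
Proof.
move=> [s Ss gE]; rewrite -size_eq0 -lt0n => g0.
have Ss' k l : l \in flatten (nseq k s) -> S l.
  by elim: k => //= k IHk; rewrite mem_cat => /orP[/Ss|].
exists (periodic_extension g); split.
- move=> i n; pose r := `|(i %% (size g)%:Z)%Z|%N.
  have rg : (r < size g)%N.
    rewrite /r -ltz_nat gez0_abs; first by rewrite ltz_pmod.
    by rewrite modz_ge0// eqz_nat -lt0n.
  (* A window of length [n] that starts in one copy of [g] fits into [n.+1] copies, as [g] is not
     empty. *)
  rewrite (_ : [seq _ | j <- _] = take n (drop r (flatten (nseq n.+1 g)))).
    rewrite gE; have := gap_language_sub r n (Ss' n.+1).
    congr (gap_language S (take n (drop r _))).
    by elim: n.+1 => //= k; rewrite map_cat flatten_cat => ->.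
  have sE : size (flatten (nseq n.+1 g)) = (n.+1 * size g)%N.
    by elim: n.+1 => //= k IHk; rewrite size_cat IHk mulSn.
  have rn : (r + n <= n.+1 * size g)%N by move: rg g0; clear; nia.
  have st : size (take n (drop r (flatten (nseq n.+1 g)))) = n.
    by rewrite size_takel// size_drop sE; move: rn; clear; lia.
  apply: (@eq_from_nth _ false); first by rewrite size_map size_iota st.
  move=> j; rewrite size_map size_iota => jn.
  rewrite (nth_map 0%N) ?size_iota// nth_iota// add0n periodic_extensionD//.
  rewrite nth_take// nth_drop nth_flatten_nseq//.
  by move: rn jn; clear; lia.
- apply/funext => i; rewrite iter_sigmaE natz periodic_extensionD// modnDr modn_small//.
  rewrite -ltz_nat gez0_abs; first by rewrite ltz_pmod.
  by rewrite modz_ge0// eqz_nat -lt0n.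
apply: (@eq_from_nth _ false); first by rewrite size_tuple.
move=> j; rewrite size_tuple => jg; rewrite tval_word nth_mkseq// natz -[j%:Z]add0r.
by rewrite periodic_extensionD// mod0z add0n modn_small.
Qed.

Lemma word_gap_language n x : gap_shift S x -> gap_language S (word n x).
Proof.
move=> /(_ 0 n); rewrite tval_word /mkseq.
by under eq_map do rewrite add0r -natz.
Qed.

Definition enum_int (k : nat) : int := odflt 0 (choice.unpickle k).

Lemma enum_int_surj i : exists k, enum_int k = i.
Proof. by exists (choice.pickle i); rewrite /enum_int choice.pickleK. Qed.

Lemma int_forward (i : int) : exists N j : nat, i + N%:R = j%:R.
Proof.
exists (absz i), (absz (i + (absz i)%:Z)); rewrite !natz [RHS]gez0_abs// abszE.
by rewrite -lerBlDl sub0r -normrN ler_norm.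
Qed.

Lemma gap_shift_closed : closed (gap_shift S).
Proof.
apply: (closed_agree (e := enum_int)) => x xP i n.
have [k kE] := choice enum_int_surj.
have [y Sy xy] := xP (\sum_(j < n) (k (i + j%:Z)%R).+1)%N.
rewrite (_ : [seq _ | j <- _] = [seq (y (i + j%:Z) : bool) | j <- iota 0 n]); first exact: Sy.
apply/eq_in_map => j; rewrite mem_iota add0n => /= jn.
rewrite -(kE (i + j%:Z)); apply: xy.
by rewrite (bigD1 (Ordinal jn)) //= leq_addr.
Qed.

Theorem gap_factor_ergodic (R : realType) (B : alphabetType) (Y : set (fullshift int B)) :
  subshift_factor (gap_shift S) Y -> intrinsically_ergodic R sigma Y /\
  forall mu : probability (borel (fullshift int B)) R, maximal_entropy_measure sigma Y mu ->
    weak_star_cvg Y (periodic_measure sigma Y) mu.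
Proof.
have dec x n : gap_shift S x -> exists i j g, gap_code g /\
    tval (word n x) = gap_prefix i ++ g ++ nseq j false.
  by move=> Sx; apply: gap_language_dec; exact: word_gap_language.
apply: (coded_factor_ergodic enum_int_surj int_forward gap_shift_closed _ _
  (G := gap_code) (cp := gap_prefix) (cs := nseq^~ false) (z := false)) => //.
- move=> _ [x Sx <-] i n; have := Sx (i + 1) n.
  by under eq_map do rewrite addrAC.
- move=> x Sx; exists (fun i => x (i - 1)); last first.
    by apply/funext => i; rewrite /sigma addrK.
  by move=> i n; have := Sx (i - 1) n; under eq_map do rewrite addrAC.
- by exists [::].
- exact: gap_code_cat.
- by case=> [|n] //=; rewrite size_rcons size_nseq.
- by move=> n; rewrite size_nseq.
- exact: gap_shift_periodic.
- move=> x n Sx; left; have [i [j [g [Gg E]]]] := dec x n Sx.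
  have [p Gp] := gap_prefix_ext i; have [s Gs] := gap_suffix_ext j.
  by exists i, j, g, p, s.
- by move=> N; have [k Nk Gk] := nseq_false_ext N; exists k, [:: true].
Qed.

End GapShift.

(** * Beta-shifts *)

Lemma iter_sigma_nat (A : alphabetType) k (x : fullshift nat A) i :
  iter k sigma x i = x (i + k)%N.
Proof. by rewrite iter_sigmaE natn. Qed.

Section BetaShiftCode.
Variables (R : realType) (beta : R).
Hypothesis beta1 : 1 < beta.
Local Notation D := 'I_(top_digit beta).+1.
Local Notation digits := (digits beta).
Local Notation w := (w_beta beta).
Implicit Types x y v : digits.

Let beta0 : 0 < beta. Proof. exact: lt_trans beta1. Qed.

(** In this form the order is tested at one index under a hypothesis of agreement, which suits
    closedness, shifts and induction; no first difference has to be produced. *)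
Lemma lex_leP x y : lex_le x y <->
  forall n, (forall i, (i < n)%N -> x i = y i) -> (val (x n) <= val (y n))%N.
Proof.
split=> [[->//|[m [xy lt]]] n H|H].
  by case: (ltngtP n m) => [nm|mn|->]; [rewrite xy|rewrite H // ltnn in lt|exact: ltnW].
have [->|xy] := pselect (x = y); [by left|right].
have E : exists n, x n != y n.
  by apply: contrapT => /forallNP E; apply: xy; apply/funext => n; apply/eqP/negPn/negP/E.
exists (ex_minn E); case: ex_minnP => n xyn nmin.
have pre i : (i < n)%N -> x i = y i.
  by move=> lt; apply/eqP/negPn/negP => /nmin; rewrite leqNgt lt.
by split=> //; rewrite ltn_neqAle H// andbT.
Qed.

Lemma lex_le_anti x y : lex_le x y -> lex_le y x -> x = y.
Proof.
move=> [//|[n [xy lt]]] /lex_leP/(_ n); rewrite leqNgt lt => H.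
by have := H (fun i ni => esym (xy i ni)).
Qed.

Lemma lex_le_total x y : lex_le x y \/
  exists n, (forall i, (i < n)%N -> x i = y i) /\ (val (y n) < val (x n))%N.
Proof.
have [|nle] := pselect (lex_le x y); [by left|right].
apply: contrapT => H; apply: nle; apply/lex_leP => n xy.
by rewrite leqNgt; apply/negP => lt; apply: H; exists n.
Qed.

(* The orbit of [1] under [t |-> beta t - floor (beta t)]; the greedy digits of [1]
   are those of [w_beta beta]. *)
Fixpoint remainder n : R := if n is n'.+1
  then beta * remainder n' - (Num.truncn (beta * remainder n'))%:R else 1.

Lemma remainder_itv n : 0 <= remainder n <= 1.
Proof.
elim: n => [|n /andP[r0 r1]] /=; first by rewrite ler01 lexx.
have := truncn_itv (mulr_ge0 (ltW beta0) r0) => /andP[H1 H2].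
by rewrite subr_ge0 H1 /= lerBlDl natr1 ltW.
Qed.

Let digit n := Num.truncn (beta * remainder n).

Let digit_le n : (digit n < (top_digit beta).+1)%N.
Proof.
have /andP[r0 r1] := remainder_itv n.
rewrite ltnS -(ler_nat R); apply: (@le_trans _ _ (beta * remainder n)).
  by rewrite truncn_le mulr_ge0// ltW.
apply: (@le_trans _ _ beta); first by rewrite ler_piMr// ltW.
rewrite /top_digit natr_absz ger0_norm ?ceil_ge//.
by rewrite ceil_ge0 (lt_trans _ beta0).
Qed.

Definition greedy : digits := fun n => Ordinal (digit_le n).

Let term v i := (val (v i))%:R / beta ^+ i.+1.

Lemma greedy_series n : series (term greedy) n = 1 - remainder n / beta ^+ n.
Proof.
elim: n => [|n IHn]; first by rewrite seriesEnat /= big_geq// expr0 divr1 subrr.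
rewrite seriesSr IHn /term /= /digit exprS; field.
by rewrite expf_neq0 gt_eqF.
Qed.

Lemma greedy_expansion : expansion_of_one greedy.
Proof.
rewrite /expansion_of_one /= -/(term greedy).
apply: (@squeeze_cvgr _ _ _ _ (fun n => 1 - beta^-1 ^+ n) (fun=> 1)).
- near=> n; rewrite greedy_series; have /andP[r0 r1] := remainder_itv n.
  have b0 : 0 < beta ^+ n by rewrite exprn_gt0.
  rewrite lerD2l lerN2 exprVn ler_piMl ?invr_ge0 ?(ltW b0)//= gerBl.
  by rewrite divr_ge0// ltW.
- rewrite -[X in _ --> X]subr0; apply: cvgB; first exact: cvg_cst.
  by apply: cvg_expr; rewrite ger0_norm ?invr_ge0 ?(ltW beta0)// invf_lt1.
exact: cvg_cst.
Unshelve. all: by end_near. Qed.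

(** Where [v] first exceeds the greedy digit, the integer part of [beta * remainder n], its digit is
    larger than [beta * remainder n] itself, so a partial sum already exceeds [1]. *)
Lemma greedy_max v : expansion_of_one v -> lex_le v greedy.
Proof.
move=> v1; have [//|[n [pre lt]]] := lex_le_total v greedy.
have le1 : series (term v) n.+1 <= 1.
  apply: (cvgr_to_ge v1); near=> N.
  rewrite !seriesEnat; apply: (nondecreasing_series (P := xpredT)).
    by move=> i _ _; rewrite divr_ge0 ?exprn_ge0 ?(ltW beta0).
  by near: N; exists n.+1.
move: le1; rewrite leNgt => /negP[].
have -> : series (term v) n.+1 = 1 - remainder n / beta ^+ n + term v n.
  rewrite seriesSr -greedy_series !seriesEnat; congr (_ + _).
  by apply: eq_big_nat => i /= ni; rewrite /term pre.
have bn : 0 < beta ^+ n by rewrite exprn_gt0.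
rewrite -addrA ltrDl addrC subr_gt0 /term exprS invfM mulrA ltr_pM2r ?invr_gt0//.
rewrite ltr_pdivlMr// mulrC; apply: lt_le_trans (truncnS_gt _) _.
by rewrite ler_nat.
Unshelve. all: by end_near. Qed.

Lemma w_betaE : w = greedy.
Proof.
have [|wmax wle] := @xgetPex _ point (lex_sup (@expansion_of_one R beta)).
  by exists greedy; split=> [|u]; [exact: greedy_max|apply; exact: greedy_expansion].
apply: lex_le_anti; first by apply: wle; exact: greedy_max.
by apply: wmax; exact: greedy_expansion.
Qed.

Lemma w_beta0 : (0 < val (w 0%N))%N.
Proof. by rewrite w_betaE /= /digit /= mulr1 truncn_gt0 ltW. Qed.

(** As long as the digits agree, the remainders from index [i] and those from index [0] undergo the
    same increasing affine maps. They keep the initial order [remainder i <= 1], and the next digits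
    inherit it. *)
Lemma w_beta_shift i : lex_le (iter i sigma w) w.
Proof.
rewrite w_betaE; apply/lex_leP => n; rewrite iter_sigma_nat => pre.
suff H m : (m <= n)%N -> remainder (m + i) <= remainder m.
  by apply: le_truncn; rewrite ler_wpM2l ?(ltW beta0)// H.
elim: m => [|m IHm] mn; first by have /andP[] := remainder_itv i.
have /(congr1 val) := pre m mn; rewrite iter_sigma_nat /= /digit => ->.
by rewrite lerD2r ler_wpM2l ?(ltW beta0)// IHm// ltnW.
Qed.

Definition beta_word j (a : D) : seq D := rcons (word j w) a.
(** The blocks follow [w] for [j] letters and then drop below it: they are the first-return loops at
    the base vertex of the standard graph presenting the beta-shift. *)
Definition beta_block := [set b | exists j (a : D), (val a < val (w j))%N /\ b = beta_word j a].
Definition beta_code : set (seq D) :=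
  [set g | exists2 s, (forall b, b \in s -> beta_block b) & g = flatten s].

Lemma beta_code_cat g g' : beta_code g -> beta_code g' -> beta_code (g ++ g').
Proof.
move=> [s Ss ->] [s' Ss' ->]; exists (s ++ s'); last by rewrite flatten_cat.
by move=> b; rewrite mem_cat => /orP[/Ss|/Ss'].
Qed.

Lemma beta_code0 : beta_code [::]. Proof. by exists [::]. Qed.

Lemma beta_code1 b : beta_block b -> beta_code b.
Proof. by move=> Bb; exists [:: b]; rewrite /= ?cats0// => b'; rewrite inE => /eqP->. Qed.

Lemma beta_code_nseq n : beta_code (nseq n ord0).
Proof.
elim: n => [|n IHn]; first exact: beta_code0.
rewrite -[nseq _ _]/([:: ord0] ++ nseq n ord0); apply: beta_code_cat => //.
apply: beta_code1; exists 0%N, ord0; split; first exact: w_beta0.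
by rewrite /beta_word tval_word.
Qed.

Lemma word_beta_block j a b s x : (val a < val (w j))%N -> b = beta_word j a ->
  tval (word (size (b ++ s)) x) = b ++ s ->
  [/\ forall i, (i < j)%N -> x i = w i, x j = a &
    tval (word (size s) (iter (size b) sigma x)) = s].
Proof.
move=> aw bE xE; have sb : size b = j.+1 by rewrite bE size_rcons size_tuple.
have nx i : (i < size (b ++ s))%N -> x i = nth ord0 (b ++ s) i.
  by move=> lt; rewrite -xE tval_word nth_mkseq// natn.
have nb i : (i < j.+1)%N -> x i = nth ord0 b i.
  by move=> lt; rewrite nx ?nth_cat ?sb ?lt// size_cat sb; move: lt; clear; lia.
split.
- move=> i ij; rewrite (nb i (ltnW ij)) bE nth_rcons size_tuple ij.
  by rewrite tval_word nth_mkseq// natn.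
- by rewrite nb// bE nth_rcons size_tuple ltnn eqxx.
rewrite -(take_drop_word (n := size (b ++ s))); last by rewrite size_cat.
by rewrite xE drop_size_cat// take_oversize.
Qed.

(* [w] is shift-maximal, and [x] falls below [w] at [j]. *)
Lemma block_lex_le j x : (forall i, (i < j)%N -> x i = w i) -> (val (x j) < val (w j))%N ->
  forall i, (i <= j)%N -> lex_le (iter i sigma x) w.
Proof.
move=> xw lt i ij; apply/lex_leP => n; rewrite iter_sigma_nat => pre.
have [nj|jn] := ltnP (n + i) j.
  have /lex_leP/(_ n) := w_beta_shift i; rewrite iter_sigma_nat xw// => -> // k kn.
  rewrite iter_sigma_nat -[in RHS]pre// iter_sigma_nat xw//.
  by move: kn nj; clear; lia.
have {}jn : (j - i <= n)%N by move: jn; clear; lia.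
have /lex_leP/(_ (j - i)%N) := w_beta_shift i; rewrite iter_sigma_nat subnK// => H.
have lt' : (val (x j) < val (w (j - i)%N))%N.
  apply: leq_trans lt _; apply: H => k kji.
  rewrite iter_sigma_nat -[in RHS]pre; last exact: leq_trans kji jn.
  by rewrite iter_sigma_nat xw//; move: kji; clear; lia.
move: jn; rewrite leq_eqVlt => /predU1P[<-|jn]; first by rewrite subnK// ltnW.
by have := pre _ jn; rewrite iter_sigma_nat subnK// => E; rewrite E ltnn in lt'.
Qed.

Lemma beta_code_lex_le g x : beta_code g -> tval (word (size g) x) = g ->
  forall k, (k < size g)%N -> lex_le (iter k sigma x) w.
Proof.
move=> [s Ss ->]; elim: s x Ss => [//|b s IHs] x Ss xE k.
have [|j [a [aw bE]]] := Ss b; first exact: mem_head.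
have sb : size b = j.+1 by rewrite bE size_rcons size_tuple.
have [xw xj xs] := word_beta_block aw bE xE.
rewrite /= size_cat sb => ks; have [kj|jk] := leqP k j.
  by apply: (block_lex_le xw) => //; rewrite xj.
have := IHs _ _ xs (k - size b)%N; rewrite -iterD subnK ?sb//; apply.
  by move=> b' b's; apply: Ss; rewrite inE b's orbT.
by rewrite ltn_subLR.
Qed.

(** Cut after the first letter that differs from [w]: it is smaller, so a block ends there, and the
    rest begins another point of the shift. What follows [w] to the end is the suffix. *)
Lemma beta_shift_dec x n : beta_shift beta x -> exists j g, beta_code g /\
  tval (word n x) = g ++ word j w.
Proof.
elim/ltn_ind: n x => n IHn x Xx.
have [E|/eqP nE] := eqVneq (word n x) (word n w).
  by exists n, [::]; split; [exact: beta_code0|rewrite E].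
have E : exists j, (j < n)%N && (x j != w j).
  apply: contrapT => /forallNP E; apply: nE; apply/word_eqP => i lt.
  by rewrite natn; apply/eqP/negPn/negP => H; apply: (E i); rewrite lt.
have [j /andP[jn xwj] jmin] := ex_minnP E.
have xw i : (i < j)%N -> x i = w i.
  move=> ij; apply/eqP/negPn/negP => H.
  by have := jmin i; rewrite H (ltn_trans ij jn) leqNgt ij => /(_ isT).
have lt : (val (x j) < val (w j))%N.
  by rewrite ltn_neqAle xwj; have /lex_leP := Xx 0%N; apply.
have [||j' [g [Gg gE]]] := IHn (n - j.+1)%N _ (iter j.+1 sigma x).
- by move: jn; clear; lia.
- by move=> k; rewrite -iterD; exact: Xx.
exists j', (beta_word j (x j) ++ g); split.
  by apply: beta_code_cat => //; apply: beta_code1; exists j, (x j).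
rewrite -catA -gE -(take_drop_word (n := n)); last by rewrite subnKC.
rewrite [X in _ = _ ++ X]take_oversize; last by rewrite size_drop size_tuple.
rewrite -[LHS](cat_take_drop j.+1) take_word//; congr (_ ++ _).
rewrite tval_word mkseqS natn; congr rcons.
by rewrite tval_word; apply/eq_in_map => i; rewrite mem_iota add0n !natn => /andP[_ /xw].
Qed.

(** A nonzero digit of [w] at some [k >= j] completes the suffix to a block ending in [0], which is
    below that digit. Without one, the lexicographic bound leaves only zeros after the suffix, and
    words of zeros are cores. *)
Lemma beta_shift_ext x n : beta_shift beta x ->
  (exists j g s, [/\ beta_code g, beta_code (word j w ++ s) & tval (word n x) = g ++ word j w]) \/
  (forall k n', (n <= k)%N -> beta_code (word n' (iter k sigma x))).
Proof.
move=> Xx; have [j [g [Gg gE]]] := beta_shift_dec n Xx.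
have [[k [jk wk]]|H] := pselect (exists k, (j <= k)%N /\ (0 < val (w k))%N).
  left; exists j, g, (rcons (drop j (word k w)) ord0); split=> //.
  rewrite -rcons_cat -{1}(take_word w jk) cat_take_drop.
  by apply: beta_code1; exists k, ord0.
right=> k n' nk.
have w0 i : (j <= i)%N -> w i = ord0.
  move=> ji; apply: val_inj => /=; apply/eqP; rewrite -leqn0 leqNgt; apply/negP => H'.
  by apply: H; exists i.
have sg : (size g + j = n)%N by have := congr1 size gE; rewrite size_cat !size_tuple.
pose y : digits := iter (size g) sigma x.
have yw i : (i < j)%N -> y i = w i.
  move=> ij; rewrite /y iter_sigma_nat.
  have := congr1 (fun t => nth ord0 t (i + size g)) gE.
  rewrite nth_cat ifN -?leqNgt ?leq_addl// addnK !tval_word !nth_mkseq ?natn//.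
  by rewrite -sg addnC ltn_add2l.
have y0 i : (j <= i)%N -> y i = ord0.
  elim/ltn_ind: i => i IHi ji; apply: val_inj => /=; apply/eqP; rewrite -leqn0.
  have /lex_leP/(_ i) := Xx (size g); rewrite -/y (w0 i ji); apply => l li.
  by have [/yw//|jl] := ltnP l j; rewrite IHi// w0.
suff -> : tval (word n' (iter k sigma x)) = nseq n' ord0 by exact: beta_code_nseq.
apply: (@eq_from_nth _ ord0); first by rewrite size_tuple size_nseq.
move=> i; rewrite size_tuple => lt; rewrite tval_word nth_mkseq// nth_nseq lt natn.
rewrite iter_sigma_nat.
have := y0 (i + k - size g)%N; rewrite /y iter_sigma_nat subnK; last by move: nk sg; clear; lia.
by apply; move: nk sg; clear; lia.
Qed.

Theorem beta_factor_ergodic (B : alphabetType) (Y : set (fullshift nat B)) :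
  subshift_factor (beta_shift beta) Y -> intrinsically_ergodic R sigma Y /\
  forall mu : probability (borel (fullshift nat B)) R, maximal_entropy_measure sigma Y mu ->
    weak_star_cvg Y (periodic_measure sigma Y) mu.
Proof.
have id_surj (i : nat) : exists k, id k = i by exists i.
have id_forward (i : nat) : exists N j : nat, i + N%:R = j%:R by exists 0%N, i; rewrite addr0 natn.
(* The decompositions all start with the empty prefix [cp 0]; runs of zeros supply one prefix of
   each length. *)
apply: (coded_factor_ergodic id_surj id_forward _ _ _ (G := beta_code)
  (cp := nseq^~ ord0) (cs := fun j => word j w) (z := ord0)) => //.
- apply: (closed_agree (e := id)) => x xP k; apply/lex_leP => n; rewrite iter_sigma_nat => pre.
  have [y /(_ k)/lex_leP/(_ n) H xy] := xP (n + k).+1.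
  move: H; rewrite iter_sigma_nat -(xy (n + k)%N)//; apply => i ni.
  rewrite -pre// !iter_sigma_nat -(xy (i + k)%N)//.
  by move: ni; clear; lia.
- by move=> _ [x Xx <-] k; rewrite -iterSr; exact: Xx.
(* A point preceded by [0] is still below [w], whose first digit is positive. *)
- move=> x Xx; pose x' : digits := fun i => if i is k.+1 then x k else ord0.
    have x's : sigma x' = x by apply/funext => i; rewrite -[LHS]/(x' (i + 1)%N) addn1.
  exists x' => // -[|k]; last by rewrite iterSr x's; exact: Xx.
  by right; exists 0%N; split=> //; exact: w_beta0.
- exact: beta_code0.
- exact: beta_code_cat.
- by move=> n; rewrite size_nseq.
- by move=> n; rewrite size_tuple.
- move=> x n Xx; have [j [g [Gg gE]]] := beta_shift_dec n Xx.
  by exists 0%N, j, g.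
- move=> g Gg; rewrite -size_eq0 -lt0n => g0.
  pose x : digits := fun i => nth ord0 g (i %% size g).
  have xk : iter (size g) sigma x = x.
    by apply/funext => i; rewrite iter_sigma_nat /x modnDr.
  have xg : tval (word (size g) x) = g.
    apply: (@eq_from_nth _ ord0); first by rewrite size_tuple.
    by move=> i; rewrite size_tuple => lt; rewrite tval_word nth_mkseq// natn /x modn_small.
  exists x; split=> // k.
  have -> : iter k sigma x = iter (k %% size g) sigma x.
    by apply/funext => i; rewrite !iter_sigma_nat /x modnDmr.
  by apply: (beta_code_lex_le Gg xg); rewrite ltn_mod.
- move=> x n Xx; have [[j [g [s [Gg Gs gE]]]]|?] := beta_shift_ext n Xx; last by right.
  by left; exists 0%N, j, g, [::], s; split=> //; exact: beta_code0.
by move=> N; exists N, [::]; rewrite cats0; split=> //; exact: beta_code_nseq.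
Qed.

End BetaShiftCode.

Theorem theorem1 (R : realType) :
  (forall (beta : R), 1 < beta ->
   forall (B : alphabetType) (Y : set (fullshift nat B)),
     subshift_factor (beta_shift beta) Y ->
     intrinsically_ergodic R sigma Y /\
     forall mu : probability (borel (fullshift nat B)) R,
       maximal_entropy_measure sigma Y mu ->
       weak_star_cvg Y (periodic_measure sigma Y) mu) /\
  (forall (S : set nat), infinite_set S ->
   forall (B : alphabetType) (Y : set (fullshift int B)),
     subshift_factor (gap_shift S) Y ->
     intrinsically_ergodic R sigma Y /\
     forall mu : probability (borel (fullshift int B)) R,
       maximal_entropy_measure sigma Y mu ->
       weak_star_cvg Y (periodic_measure sigma Y) mu).
Proof.
split=> [beta beta1 B Y|S S_inf B Y]; first exact: beta_factor_ergodic.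
exact: gap_factor_ergodic.
Qed.
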